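(* Assume (F1), (F2), (H1), (H2). For each solution $(c,\varphi)$ of the travelling wave problem with $c\ge c^*$ there exists $\eta=\eta(\varphi)\in\mathbb{R}$ such that $$\lim_{\xi\to-\infty}\frac{\varphi(\xi+\eta)}{e^{\lambda_1(c)\xi}}=1\quad\text{if } c>c^*,\qquad \lim_{\xi\to-\infty}\frac{\varphi(\xi+\eta)}{-\xi\, e^{\lambda_1(c)\xi}}=1\quad\text{if } c=c^*.$$ Moreover, $\lim_{\xi\to-\infty}\varphi'(\xi)/\varphi(\xi)=\lambda_1(c)$ for $c\geq c^*$.
   Context: Fix constants $d>0$, $\tau\geq0$, $K>0$, $f:[0,K]^2\to\mathbb{R}$ and $h:\mathbb{R}\to\mathbb{R}$ (partial derivatives of $f$ assumed to exist). (F1) $f\in C([0,K]^2,\mathbb{R})$, $f(0,0)=f(K,K)=0$, $f(u,u)>0$ for $u\in(0,K)$, $\partial_2f(u,v)\geq0$ on $[0,K]^2$. (F2) There exist $M>0$, $\sigma\in(0,1]$ with $0\leq \partial_1f(0,0)u+\partial_2f(0,0)v-f(u,v)\leq M(u+v)^{1+\sigma}$ on $[0,K]^2$, and $\partial_1f(K,K)+\partial_2f(K,K)<0$. (H1) $h\ge0$, even, integrable, $\int_{\mathbb{R}}h=1$. (H2) There is $\lambda_0\in(0,\infty]$ with $\int_0^\infty h(x)e^{\lambda x}dx<\infty$ for all $\lambda<\lambda_0$. Let $G(\lambda)=\int_{\mathbb{R}}h(y)e^{-\lambda y}dy$, $\lambda^+=\lambda_0$ if $\partial_2f(0,0)>0$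 and $\lambda^+=+\infty$ otherwise, $\Delta(c,\lambda)=c\lambda-d[e^{\lambda}+e^{-\lambda}-2]-\partial_1f(0,0)-\partial_2f(0,0)e^{-\lambda c\tau}G(\lambda)$. Let $c^*>0$, $\lambda^*\in(0,\lambda^+)$ be the unique pair with $\Delta(c^*,\lambda^* )=0=\partial_\lambda\Delta(c^*,\lambda^* )$. For $c>c^*$, $\lambda_1(c)$ is the smallest positive zero of $\Delta(c,\cdot)$, and $\lambda_1(c^* ):=\lambda^*$. Notation: $\Delta_1\varphi(\xi)=\varphi(\xi+1)-2\varphi(\xi)+\varphi(\xi-1)$, $(h*\varphi)(\xi)=\int h(y)\varphi(\xi-y)dy$. A solution $(c,\varphi)$: $c>0$ and a differentiable $\varphi:\mathbb{R}\to\mathbb{R}$ with $-c\varphi'+d\Delta_1\varphi+f(\varphi(\xi),(h*\varphi)(\xi-c\tau))=0$ for all $\xi$, $\varphi(-\infty)=0$, $\varphi(+\infty)=K$, $0\le\varphi\le K$. *)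

(* Defs.v *)
From HB Require Import structures.
From mathcomp Require Import all_boot all_order all_algebra.
From mathcomp Require Import all_classical all_reals all_analysis.
Set Implicit Arguments. Unset Strict Implicit. Unset Printing Implicit Defensive.
Import Order.TTheory GRing.Theory Num.Theory.
Import numFieldNormedType.Exports.
Local Open Scope classical_set_scope.
Local Open Scope ring_scope.

Section Defs.
Variable R : realType.
Local Notation mu := (@lebesgue_measure R).

Definition sqK (K : R) : set (R * R) :=
  [set p | 0 <= p.1 <= K /\ 0 <= p.2 <= K].

Definition pderiv1_at (K : R) (f : R -> R -> R) (u v d : R) : Prop :=
  (fun t => (f (u + t) v - f u v) / t)
    @ within [set t | t != 0 /\ 0 <= u + t <= K] (nbhs (0 : R)) --> d.
Definition pderiv2_at (K : R) (f : R -> R -> R) (u v d : R) : Prop :=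
  (fun t => (f u (v + t) - f u v) / t)
    @ within [set t | t != 0 /\ 0 <= v + t <= K] (nbhs (0 : R)) --> d.

Definition conv (h phi : R -> R) (x : R) : R :=
  Rintegral mu setT (fun y => h y * phi (x - y)).

Definition Gext (h : R -> R) (lam : R) : \bar R :=
  (\int[mu]_(y in setT) (h y * expR (- lam * y))%:E)%E.
Definition G (h : R -> R) (lam : R) : R := fine (Gext h lam).

(* lambda_0 read as the abscissa of convergence:
   sup { lambda | \int_0^oo h(x) e^{lambda x} dx < oo } *)
Definition lambda0 (h : R -> R) : \bar R :=
  ereal_sup [set l%:E | l in
    [set l : R | (\int[mu]_(x in [set x : R | (0 <= x)%R]) (h x * expR (l * x))%:E
                   < +oo)%E]].

(* lambda^+ ; b = d_2 f(0,0) *)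
Definition lambda_plus (b : R) (h : R -> R) : \bar R :=
  if 0 < b then lambda0 h else +oo%E.

(* Delta(c,lambda); a = d_1 f(0,0), b = d_2 f(0,0) *)
Definition Delta (d tau a b : R) (h : R -> R) (c lam : R) : R :=
  c * lam - d * (expR lam + expR (- lam) - 2) - a
    - b * expR (- lam * c * tau) * G h lam.

(* lam is a genuine zero of Delta(c,.) : where G(lam) is finite (or irrelevant) *)
Definition Delta_zero (d tau a b : R) (h : R -> R) (c lam : R) : Prop :=
  (b = 0 \/ (Gext h lam < +oo)%E) /\ Delta d tau a b h c lam = 0.

Definition smallest_pos_zero (d tau a b : R) (h : R -> R) (c lam : R) : Prop :=
  0 < lam /\ Delta_zero d tau a b h c lam /\
  forall l, 0 < l -> Delta_zero d tau a b h c l -> lam <= l.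

Definition tw_solution (d tau K : R) (f : R -> R -> R) (h : R -> R)
    (c : R) (phi : R -> R) : Prop :=
  0 < c /\
  (forall x, derivable phi x 1) /\
  (forall xi, - c * derive1 phi xi
              + d * (phi (xi + 1) - 2 * phi xi + phi (xi - 1))
              + f (phi xi) (conv h phi (xi - c * tau)) = 0) /\
  phi x @[x --> -oo] --> 0 /\
  phi x @[x --> +oo] --> K /\
  (forall x, 0 <= phi x <= K).
End Defs.

(* Main.v *)
Require Import Defs.
From HB Require Import structures.
From mathcomp Require Import all_boot all_order all_algebra.
From mathcomp Require Import all_classical all_reals all_analysis.
From mathcomp Require Import measurable_realfun ring lra.
Import Order.TTheory GRing.Theory Num.Theory.
Import numFieldNormedType.Exports.
Local Open Scope classical_set_scope.
Local Open Scope ring_scope.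
Set Implicit Arguments.
Unset Strict Implicit.
Unset Printing Implicit Defensive.

(** The obstacle is nonlocality: [h] may have unbounded support, so the equation at a point sees all
    of [phi], and control on a window says nothing without control of the tails. Every estimate
    therefore carries a weight [expabs k], where [k > lambda_1] is an exponential moment of [h] (any
    such [k] if [b = 0]). Tilting by [exp (lambda_1 .)] spends [lambda_1] of it; the remaining
    [k - lambda_1] pays for the tails of [psi], of its two primitives and of the error terms.
    Besides linearity, positivity and dominated convergence, [S] has an atom at 1, the term [d u(1)]
    of the discrete diffusion. It carries smallness of a nonnegative solution to the right, while
    [c > 0] carries it to the left; this yields a Harnack inequality in both directions. The atom
    also supplies strictness: [S' (x^2) > 0], and a negative characteristic function to the left of
    a double root. Flatness alone would allow limsup and liminf to be two different heights; it is
    the common limit of the first integral that makes them equal. *)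

(**
  Let [phi] be a wave, [a], [b] the partial derivatives of [f] at the origin, and
  [S u = d (u 1 + u (-1)) + b \int h(y) u(- y - c tau) dy], a positive linear
  functional on functions of exponential growth.  The wave equation reads
  [c phi' = S (phi (x + .)) - (2 d - a) phi - q], where [0 <= q = O((phi + S phi)^(1 + sigma))],
  and [Delta (c, l) = c l + 2 d - a - S (exp (l .))] is concave in [l].

  Decay: if [exp (- l x) phi -> 0] with [Delta (c, l) < 0], then [exp (- l x) phi] satisfies
  a linear differential inequality which is inherited by its primitive vanishing at -oo;
  the second primitive is convex, and the inequality becomes [kap U <= B U'], that is,
  exponential decay.  Iterating, [phi = O (exp (l x))] for every [l < lambda_1].

  Sharp rate: put [psi = exp (- lambda_1 x) phi], [Th' = psi] and let [S'] be [S] tilted by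
  [exp (lambda_1 .)].  The linear equation for [psi] has the first integral
  [I = c psi + S' 1 Th - S' (Th (x + .))], with [I' = - exp (- lambda_1 x) q]; it decreases from a positive limit at -oo to 0 at +oo,
  because [q] is integrable against the weight and not identically zero.  A strong maximum
  principle (a nonnegative almost-solution that is small at one point is small on compact
  sets) shows that near points where [psi] almost attains its limsup or liminf at -oo,
  [psi] is almost constant, equal to [A] say; there [I] is close to [A (c - S' id)].
  Hence limsup = liminf = I(-oo) / (c - S' id) when [c > c*].
  When [c = c*] this factor vanishes, and the same argument is applied to [psi / |x|] with a
  primitive of [I], the factor becoming [S' (x^2) / 2].  The same argument at near-maxima of
  [psi exp (eps x)] shows that [psi], resp. [psi / |x|], is bounded in the first place.
*)

(** * Calculus on the line *)

Section Calculus.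
Variable R : realType.

Definition has_deriv (f : R -> R) (x df : R) : Prop := is_derive x (1 : R) f df.

Implicit Types (u v f g : R -> R) (x y z : R).

Lemma has_deriv_continuous f df x : has_deriv f x df -> {for x, continuous f}.
Proof. by move=> [d _]; apply/differentiable_continuous/derivable1_diffP. Qed.

Lemma has_deriv_add f g x df dg :
  has_deriv f x df -> has_deriv g x dg ->
  has_deriv (fun y => f y + g y) x (df + dg).
Proof. exact: is_deriveD. Qed.

Lemma has_deriv_sub f g x df dg :
  has_deriv f x df -> has_deriv g x dg ->
  has_deriv (fun y => f y - g y) x (df - dg).
Proof. exact: is_deriveB. Qed.

Lemma has_deriv_opp f x df :
  has_deriv f x df -> has_deriv (fun y => - f y) x (- df).
Proof. exact: is_deriveN. Qed.

Lemma has_deriv_scale k f x df :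
  has_deriv f x df -> has_deriv (fun y => k * f y) x (k * df).
Proof. exact: is_deriveZ. Qed.

Lemma has_deriv_mul f g x df dg :
  has_deriv f x df -> has_deriv g x dg ->
  has_deriv (fun y => f y * g y) x (df * g x + f x * dg).
Proof.
move=> hf hg; have := @is_deriveM R R f g x 1 df dg hf hg.
by rewrite /GRing.scale /= addrC (mulrC (g x)).
Qed.

Lemma has_deriv_const k x : has_deriv (fun _ : R => k : R) x (0 : R).
Proof. exact: (is_derive_cst (k : R^o) x 1). Qed.

Lemma has_deriv_var x : has_deriv (fun y : R => y) x (1 : R).
Proof. exact: is_derive_id. Qed.

Lemma has_deriv_shift f df z x :
  has_deriv f (z + x) df -> has_deriv (fun y => f (z + y)) x df.
Proof.
move=> h; have hs := has_deriv_add (has_deriv_const z x) (has_deriv_var x).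
have := @is_derive1_comp R f (fun y => z + y) x df (0 + 1) h hs.
by rewrite add0r mulr1.
Qed.

Lemma has_deriv_expR_lin a x :
  has_deriv (fun y => expR (a * y)) x (a * expR (a * x)).
Proof.
have h := has_deriv_scale a (has_deriv_var x).
have := @is_derive1_comp R expR (fun y => a * y) x _ _ (is_derive_expR _) h.
by rewrite mulr1 mulrC.
Qed.

Lemma MVT_all f df a b : (forall x, has_deriv f x (df x)) -> a < b ->
  exists c, [/\ a < c, c < b & f b - f a = df c * (b - a)].
Proof.
move=> fd ab; have [|c] := @MVT R f df a b ab (fun x _ => fd x).
  by apply: continuous_subspaceT => x; exact: has_deriv_continuous (fd x).
by rewrite in_itv /= => /andP[? ?] ?; exists c.
Qed.

Lemma derive_ge0_le f df z x y : (forall x, has_deriv f x (df x)) ->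
  (forall x, x <= z -> 0 <= df x) -> x <= y -> y <= z -> f x <= f y.
Proof.
move=> fd f0; rewrite le_eqVlt => /predU1P[->//|xy] yz.
have [c [xc cy fE]] := MVT_all fd xy.
rewrite -subr_ge0 fE mulr_ge0 ?subr_ge0 ?(ltW xy) //.
by rewrite f0 // (le_trans (ltW cy)).
Qed.

Lemma derive_le0_ge f df z x y : (forall x, has_deriv f x (df x)) ->
  (forall x, x <= z -> df x <= 0) -> x <= y -> y <= z -> f y <= f x.
Proof.
move=> fd f0 xy yz; rewrite -lerN2.
apply: (@derive_ge0_le (fun x => - f x) (fun x => - df x) z) => //.
  by move=> t; exact: has_deriv_opp.
by move=> t /f0; rewrite oppr_ge0.
Qed.

Lemma MVT_norm_le f df z x C : (forall x, has_deriv f x (df x)) ->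
  (forall y, `|y| <= `|x| -> `|df (z + y)| <= C) -> `|f (z + x) - f z| <= `|x| * C.
Proof.
move=> fd dC; have [x0|x0|->] := ltgtP x 0; last first.
- by rewrite addr0 subrr !normr0 mul0r.
- have [c [zc cz ->]] := MVT_all fd (ltac:(by rewrite ltrDl) : z < z + x).
  rewrite (_ : z + x - z = x); last by ring.
  rewrite normrM mulrC ler_wpM2l //.
  rewrite -(subrK z c) addrC dC //.
  by rewrite !ger0_norm; lra.
- have [c [zc cz]] := MVT_all fd (ltac:(by rewrite gtrDl) : z + x < z).
  move=> /(congr1 Num.norm); rewrite distrC => ->.
  rewrite (_ : z - (z + x) = - x); last by ring.
  rewrite normrM normrN mulrC ler_wpM2l //.
  rewrite -(subrK z c) addrC dC //.
  by rewrite !ler0_norm; lra.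
Qed.

Lemma continuous_primitive u : continuous u ->
  exists U, forall x, has_deriv U x (u x).
Proof.
move=> cu.
pose mu := @lebesgue_measure R.
have iu a b : mu.-integrable `[a, b] (EFin \o u).
  apply: continuous_compact_integrable; first exact: segment_compact.
  exact: continuous_subspaceT.
(* [F a] is a primitive only to the right of [a]. The difference [F a x - F a 0] does not depend on
   [a] once [a] lies to the left of both 0 and [x], so the base point [N x], which moves with [x],
   still yields a single primitive on the whole line. *)
pose F a x := \int[mu]_(t in `[a, x]) u t.
have dF a x : a < x -> has_deriv (F a) x (u x).
  move=> ax; have xx1 : x < x + 1 by rewrite ltrDl.
  have [d <-] := @continuous_FTC1_closed R u a x _ xx1 (iu _ _) ax (cu x).
  by rewrite derive1E; split.
pose H a x := F a x - F a 0.
have HE a a' x : a < 0 -> a' < 0 -> a < x -> a' < x -> H a x = H a' x.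
  wlog aa' : a a' / a <= a'.
    by move=> W ? ? ? ?; have [/W->//|/ltW/W->] := leP a a'.
  move=> a0 a'0 ax a'x.
  suff add y : a' < y -> F a y = F a a' + F a' y.
    by rewrite /H (add x) // (add 0) //; ring.
  move=> a'y; suff <- : F a y - F a a' = F a' y by ring.
  rewrite /F (Rintegral_itvB (iu a y)); last 2 first.
  - by rewrite bnd_simp.
  - by rewrite bnd_simp ltW.
  rewrite Rintegral_itv_obnd_cbnd //.
  by apply: integrableS (iu a' y) => //; apply: subset_itvr; rewrite bnd_simp.
pose N x := - (`|x| + 1).
have N0 x : N x < 0 by rewrite /N oppr_lt0 ltr_wpDl.
have Nx x : N x < x by rewrite /N; have := ler_norm (- x); rewrite normrN; lra.
exists (fun x => H (N x) x) => x.
pose a := N x - 1.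
have ax : a < x by have := Nx x; rewrite /a; lra.
have a0 : a < 0 by have := N0 x; rewrite /a; lra.
have dH : has_deriv (H a) x (u x).
  have := has_deriv_sub (dF a x ax) (has_deriv_const (F a 0) x).
  by rewrite subr0.
apply: near_eq_is_derive dH.
near=> y.
apply: HE => //.
by near: y; apply: open_nbhs_nbhs; split; [exact: open_gt | exact: ax].
Unshelve. all: by end_near. Qed.

End Calculus.

(** * Positive functionals on functions of exponential growth *)

Section ExponentialGrowth.
Variable R : realType.
Implicit Types (k a b C x y z : R) (u v : R -> R).

Definition expabs k x : R := expR (k * `|x|).

Lemma expabs_gt0 k x : 0 < expabs k x. Proof. exact: expR_gt0. Qed.
Lemma expabs_ge0 k x : 0 <= expabs k x. Proof. exact: expR_ge0. Qed.

Lemma expabs_ge1 k x : 0 <= k -> 1 <= expabs k x.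
Proof. by move=> k0; rewrite /expabs -expR0 ler_expR mulr_ge0. Qed.

Lemma expabs0 k : expabs k 0 = 1.
Proof. by rewrite /expabs normr0 mulr0 expR0. Qed.

Lemma expabsD k x y : 0 <= k -> expabs k (x + y) <= expabs k x * expabs k y.
Proof.
by move=> k0; rewrite /expabs -expRD ler_expR -mulrDr ler_wpM2l // ler_normD.
Qed.

Lemma expabsM a b x : expabs a x * expabs b x = expabs (a + b) x.
Proof. by rewrite /expabs -expRD mulrDl. Qed.

Lemma ler_expabs a b x : a <= b -> expabs a x <= expabs b x.
Proof. by move=> ab; rewrite /expabs ler_expR ler_wpM2r. Qed.

Lemma ler_expabs_norm k x y : 0 <= k -> `|x| <= `|y| -> expabs k x <= expabs k y.
Proof. by move=> k0 xy; rewrite /expabs ler_expR ler_wpM2l. Qed.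

Lemma norm_le_expabs k x : 0 < k -> `|x| <= k^-1 * expabs k x.
Proof.
move=> k0; rewrite mulrC ler_pdivlMr // mulrC.
by apply: le_trans (expR_ge1Dx _); rewrite lerDr.
Qed.

Lemma continuous_expabs k : continuous (expabs k).
Proof.
move=> x; apply: continuous_comp; last exact: continuous_expR.
by apply: cvgM; [exact: cvg_cst | exact: norm_continuous].
Qed.

Lemma expR_le_expabs a k x : `|a| <= k -> expR (a * x) <= expabs k x.
Proof.
move=> ak; rewrite ler_expR (le_trans (ler_norm _)) // normrM.
by rewrite ler_wpM2r.
Qed.

Definition exp_growth k u : Prop := continuous u /\ exists C, forall x, `|u x| <= C * expabs k x.

Lemma exp_growthW k u : exp_growth k u ->
  exists2 C, 0 <= C & forall x, `|u x| <= C * expabs k x.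
Proof.
move=> [_ [C uC]]; exists `|C| => // x.
by rewrite (le_trans (uC x)) // ler_wpM2r ?expabs_ge0 // ler_norm.
Qed.

Lemma exp_growth_lin k a u v : exp_growth k u -> exp_growth k v ->
  exp_growth k (fun x => a * u x + v x).
Proof.
move=> [cu [C uC]] [cv [C' vC]]; split.
  move=> x; apply: cvgD; last exact: cv.
  by apply: cvgM; [exact: cvg_cst | exact: cu].
exists (`|a| * C + C') => x.
rewrite mulrDl (le_trans (ler_normD _ _)) // lerD // normrM -mulrA.
by rewrite ler_wpM2l.
Qed.

Lemma exp_growthS a b u : a <= b -> exp_growth a u -> exp_growth b u.
Proof.
move=> ab gu; have [C C0 uC] := exp_growthW gu; case: gu => cu _.
split=> //; exists C => x.
by rewrite (le_trans (uC x)) // ler_wpM2l // ler_expabs.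
Qed.

Lemma exp_growth_cst k a : 0 <= k -> exp_growth k (fun _ => a).
Proof.
move=> k0; split; first by move=> x; exact: cvg_cst.
by exists `|a| => x; rewrite ler_peMr // expabs_ge1.
Qed.

Lemma exp_growthZ k a u : 0 <= k -> exp_growth k u -> exp_growth k (fun x => a * u x).
Proof.
move=> k0 gu; have := exp_growth_lin a gu (exp_growth_cst 0 k0).
by rewrite (_ : (fun x => _) = (fun x => a * u x)) //; apply/funext => x; rewrite addr0.
Qed.

Lemma exp_growthD k u v : exp_growth k u -> exp_growth k v ->
  exp_growth k (fun x => u x + v x).
Proof.
move=> gu gv; have := exp_growth_lin 1 gu gv.
by rewrite (_ : (fun x => _) = (fun x => u x + v x)) //; apply/funext => x; rewrite mul1r.
Qed.

Lemma exp_growthB k u v : exp_growth k u -> exp_growth k v ->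
  exp_growth k (fun x => u x - v x).
Proof.
move=> gu gv; have := exp_growth_lin (-1) gv gu.
rewrite (_ : (fun x => _) = (fun x => u x - v x)) //.
by apply/funext => x; rewrite mulN1r addrC.
Qed.

Lemma exp_growthM a b u v : exp_growth a u -> exp_growth b v ->
  exp_growth (a + b) (fun x => u x * v x).
Proof.
move=> gu gv; have [C C0 uC] := exp_growthW gu; have [C' C'0 vC] := exp_growthW gv.
split; first by move=> x; apply: cvgM; [exact: gu.1 | exact: gv.1].
exists (C * C') => x; rewrite normrM -expabsM mulrACA.
by apply: ler_pM.
Qed.

Lemma continuous_shift u z : continuous u -> continuous (fun x => u (z + x)).
Proof.
move=> cu x; apply: (@continuous_comp _ _ _ (fun x => z + x) u); last exact: cu.
by apply: cvgD; [exact: cvg_cst | exact: cvg_id].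
Qed.

Lemma exp_growth_shift k u z : 0 <= k -> exp_growth k u -> exp_growth k (fun x => u (z + x)).
Proof.
move=> k0 gu; have [C C0 uC] := exp_growthW gu; split.
  by apply: continuous_shift; case: gu.
exists (C * expabs k z) => x; rewrite (le_trans (uC _)) // -mulrA.
by rewrite ler_wpM2l // expabsD.
Qed.

Lemma exp_growth_expR a k : `|a| <= k -> exp_growth k (fun x => expR (a * x)).
Proof.
move=> ak; split.
  move=> x; apply: (@continuous_comp _ _ _ (fun x => a * x) expR).
    by apply: cvgM; [exact: cvg_cst | exact: cvg_id].
  exact: continuous_expR.
by exists 1 => x; rewrite mul1r ger0_norm ?expR_ge0 // expR_le_expabs.
Qed.

Lemma exp_growth_expabs a k : a <= k -> exp_growth k (expabs a).
Proof.
move=> ak; split; first exact: continuous_expabs.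
by exists 1 => x; rewrite mul1r ger0_norm ?expabs_ge0 // ler_expabs.
Qed.

Lemma exp_growth_id k : 0 < k -> exp_growth k (fun x => x).
Proof.
move=> k0; split; first by move=> x; exact: cvg_id.
by exists k^-1 => x; rewrite norm_le_expabs.
Qed.

Lemma exp_growth_norm k : 0 < k -> exp_growth k (fun x => `|x|).
Proof.
move=> k0; split; first exact: norm_continuous.
by exists k^-1 => x; rewrite normr_id norm_le_expabs.
Qed.

End ExponentialGrowth.

Section Functional.
Variable R : realType.
Implicit Types (k a b C x y z delta : R) (u v : R -> R) (S : (R -> R) -> R).

(** Stands for integration against a positive measure with an exponential moment of order [k] and an
    atom of mass at least [delta] at 1; [ef_ge] states positivity and the atom at once. In this form
    the class is stable under tilting by an exponential, at the price of a smaller [k]. *)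
Record exp_functional k delta S : Prop := ExpFunctional {
  ef_lin : forall a u v, exp_growth k u -> exp_growth k v ->
    S (fun x => a * u x + v x) = a * S u + S v;
  ef_ge : forall u, exp_growth k u -> (forall x, 0 <= u x) -> delta * u 1 <= S u;
  ef_dct : forall (u_ : nat -> R -> R) u C, (forall n, continuous (u_ n)) ->
    (forall n x, `|u_ n x| <= C * expabs k x) -> exp_growth k u ->
    (forall x, u_ n x @[n --> \oo] --> u x) -> S (u_ n) @[n --> \oo] --> S u
}.

Section Theory.
Variables (k delta : R) (S : (R -> R) -> R).
Hypotheses (k0 : 0 < k) (delta0 : 0 < delta) (HS : exp_functional k delta S).

Let k0' : 0 <= k := ltW k0.

Lemma functional0 : S (fun _ => 0) = 0.
Proof.
have g0 := @exp_growth_cst R k 0 k0'.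
have := ef_lin HS 1 g0 g0.
rewrite (_ : (fun x => _) = (fun _ => 0)); last by apply/funext => x; rewrite addr0 mulr0.
by rewrite mul1r => /eqP; rewrite -subr_eq subrr eq_sym => /eqP.
Qed.

Lemma functionalZ a u : exp_growth k u -> S (fun x => a * u x) = a * S u.
Proof.
move=> gu; have := ef_lin HS a gu (@exp_growth_cst R k 0 k0').
rewrite functional0 addr0 => <-; congr S.
by apply/funext => x; rewrite addr0.
Qed.

Lemma functionalD u v : exp_growth k u -> exp_growth k v ->
  S (fun x => u x + v x) = S u + S v.
Proof.
move=> gu gv; have := ef_lin HS 1 gu gv; rewrite mul1r => <-; congr S.
by apply/funext => x; rewrite mul1r.
Qed.

Lemma functionalB u v : exp_growth k u -> exp_growth k v ->
  S (fun x => u x - v x) = S u - S v.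
Proof.
move=> gu gv; have := ef_lin HS (-1) gv gu; rewrite mulN1r addrC => <-; congr S.
by apply/funext => x; rewrite mulN1r addrC.
Qed.

Lemma functional_ge0 u : exp_growth k u -> (forall x, 0 <= u x) -> 0 <= S u.
Proof.
by move=> gu u0; apply: le_trans (ef_ge HS gu u0); rewrite mulr_ge0 // ltW.
Qed.

Lemma functional_le u v : exp_growth k u -> exp_growth k v ->
  (forall x, u x <= v x) -> S u <= S v.
Proof.
move=> gu gv uv; rewrite -subr_ge0 -functionalB //.
apply: functional_ge0; first exact: exp_growthB.
by move=> x; rewrite subr_ge0.
Qed.

Lemma functional_norm_le u v : exp_growth k u -> exp_growth k v ->
  (forall x, `|u x| <= v x) -> `|S u| <= S v.
Proof.
move=> gu gv uv; rewrite ler_norml -mulN1r -functionalZ //.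
apply/andP; split; apply: functional_le => //.
- exact: exp_growthZ.
- by move=> x; have := uv x; rewrite ler_norml mulN1r => /andP[].
- by move=> x; have := uv x; rewrite ler_norml => /andP[].
Qed.

Lemma functional_cst a : S (fun _ => a) = a * S (fun _ => 1).
Proof.
rewrite -functionalZ; last exact: exp_growth_cst.
by congr S; apply/funext => x; rewrite mulr1.
Qed.

Lemma functional1_ge : delta <= S (fun _ => 1).
Proof.
by rewrite -{1}(mulr1 delta); apply: (ef_ge HS (@exp_growth_cst R k 1 k0')).
Qed.

(* The mean value theorem dominates the difference quotients of [u]. *)
Lemma functional_shift_deriv u du z :
  exp_growth k u -> exp_growth k du -> (forall x, has_deriv u x (du x)) ->
  has_deriv (fun y => S (fun x => u (y + x))) z (S (fun x => du (z + x))).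
Proof.
move=> gu gdu ud.
have [C C0 duC] := exp_growthW gdu.
set g := fun y => S (fun x => u (y + x)).
set l := S (fun x => du (z + x)).
suff key : (fun h => h^-1 *: (g (h + z) - g z)) @ (0:R)^' --> l.
  have key' : (fun h => h^-1 *: ((g \o shift z) (h *: (1:R)) - g z)) @ (0:R)^' --> l.
    apply: cvg_trans key; apply: near_eq_cvg; near=> h.
    by rewrite /= /GRing.scale /= mulr1.
  have dg : derivable g z 1 by apply/cvg_ex; exists l.
  by apply: DeriveDef => //; exact: cvg_lim key'.
apply/cvgr_dnbhsP => t [t0 tc].
have tb : exists2 B, 0 <= B & forall n, `|t n| <= B.
  have /cvg_seq_bounded := (ltac:(by apply/cvg_ex; exists 0) : cvgn t).
  move=> /pinfty_ex_gt0 [B B0 tB]; exists B; first exact: ltW.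
  by move=> n; exact: tB.
have [B B0 tB] := tb.
have E n : (t n)^-1 *: (g (t n + z) - g z) =
           S (fun x => (t n)^-1 * (u (t n + z + x) - u (z + x))).
  rewrite functionalZ; last by apply: exp_growthB; exact: exp_growth_shift.
  by rewrite functionalB //; exact: exp_growth_shift.
under eq_fun do rewrite E.
apply: (ef_dct HS (C := C * expabs k (`|z| + B))).
- move=> n x; apply: cvgM; first exact: cvg_cst.
  by apply: cvgB; apply: continuous_shift; case: gu.
- move=> n x; rewrite normrM normfV mulrC ler_pdivrMr ?normr_gt0 //.
  rewrite mulrC -addrA addrC (addrC (z + x)).
  rewrite (_ : t n + (z + x) = (z + x) + t n); last by ring.
  apply: (@MVT_norm_le R u du) => // y yt.
  rewrite (le_trans (duC _)) // -mulrA ler_wpM2l //.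
  rewrite (_ : z + x + y = (z + y) + x); last by ring.
  rewrite (le_trans (expabsD _ _ k0')) // ler_wpM2r ?expabs_ge0 //.
  apply: ler_expabs_norm => //; rewrite (le_trans (ler_normD _ _)) //.
  rewrite [leRHS]ger0_norm ?addr_ge0 // lerD2l.
  exact: le_trans yt (tB n).
- exact: exp_growth_shift.
- move=> x.
  have [dq dqE] := ud (z + x).
  have : (fun h => h^-1 *: ((u \o shift (z + x)) (h *: (1:R)) - u (z + x))) @ (0:R)^' --> du (z + x).
    by rewrite -dqE; exact: dq.
  move=> /cvgr_dnbhsP /(_ t (conj t0 tc)).
  apply: cvg_trans; apply: near_eq_cvg; near=> n.
  by rewrite /= /GRing.scale /= mulr1 addrA.
Unshelve. all: by end_near. Qed.

End Theory.

Lemma exp_functional_tilt k delta S a : 0 < delta -> 0 <= a -> a < k ->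
  exp_functional k delta S ->
  exp_functional (k - a) (delta * expR a) (fun u => S (fun x => expR (a * x) * u x)).
Proof.
move=> delta0 a0 ak HS.
have tg u : exp_growth (k - a) u -> exp_growth k (fun x => expR (a * x) * u x).
  move=> gu; rewrite -[k](subrKC a).
  by apply: exp_growthM gu; apply: exp_growth_expR; rewrite ger0_norm.
split.
- move=> c u v gu gv; rewrite -(ef_lin HS) //; try exact: tg.
  by congr S; apply/funext => x; ring.
- move=> u gu u0; rewrite -mulrA -{1}[a]mulr1.
  by apply: (ef_ge HS (tg _ gu)) => x; rewrite mulr_ge0 // expR_ge0.
- move=> u_ u C cu uC gu uu.
  apply: (ef_dct HS (C := C)).
  + move=> n x; apply: cvgM; last exact: cu.
    by have [+ _] := @exp_growth_expR R a `|a| (lexx _); apply.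
  + move=> n x; rewrite normrM mulrC.
    rewrite -[X in expabs X](subrKC a) addrC -expabsM mulrA ler_pM //.
    by rewrite ger0_norm ?expR_ge0 // expR_le_expabs // ger0_norm.
  + exact: tg.
  + by move=> x; apply: cvgM; [exact: cvg_cst | exact: uu].
Qed.

End Functional.

(** * Strong maximum principle *)

Section Flatness.
Variable R : realType.
Variables (k delta c : R) (S : (R -> R) -> R).
Hypotheses (k0 : 0 < k) (delta0 : 0 < delta) (HS : exp_functional k delta S) (c0 : 0 < c).
Implicit Types (u du v dv : R -> R) (x y z eps Z : R).

Let k0' : 0 <= k := ltW k0.
Let s := S (fun _ => 1).
Let s0 : 0 < s. Proof. exact: lt_le_trans (functional1_ge k0 HS). Qed.

Let s0' : 0 <= s := ltW s0.
Let c0' : 0 <= c := ltW c0.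
Let delta0' : 0 <= delta := ltW delta0.
Let sc0 : 0 <= s / c. Proof. exact: divr_ge0. Qed.
Let cV0 : 0 <= c^-1. Proof. by rewrite invr_ge0. Qed.
Let sV0 : 0 <= s^-1. Proof. by rewrite invr_ge0. Qed.
Let dV0 : 0 <= delta^-1. Proof. by rewrite invr_ge0. Qed.
Let E_ge0 z : 0 <= expabs k z := expabs_ge0 k z.
Hint Resolve cV0 sV0 dV0 s0' c0' delta0' sc0 k0' E_ge0 expR_ge0 : core.

Definition defect u du x : R := c * du x - S (fun y => u (x + y)) + s * u x.

(** Constants have defect zero. The error is measured against [expabs k], the largest weight that
    [S] accepts, because errors of translated functions are small only relative to such a weight. *)
Definition almost_solution eps u du : Prop := [/\ exp_growth k u,
  forall x, has_deriv u x (du x) & forall x, `|defect u du x| <= eps * expabs k x].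

Let eps_ge0 eps u du : almost_solution eps u du -> 0 <= eps.
Proof.
by move=> [_ _ /(_ 0)]; rewrite expabs0 mulr1; exact: le_trans.
Qed.

(** Since [S] is nonnegative on nonnegative functions, [c u' + s u] is at least minus the error.
    Hence [exp (s x / c) (u + m)] is nondecreasing on [[-Z, Z]], the shift [m] absorbing the
    error. *)
Lemma backward_harnack Z : exists2 B, 1 <= B & forall eps u du,
  almost_solution eps u du -> (forall x, 0 <= u x) ->
  forall x y, - Z <= x -> x <= y -> y <= Z -> u x <= B * (u y + eps).
Proof.
have E0 := expabs_ge0 k Z.
exists (expR (s / c * (2 * `|Z|)) * (1 + expabs k Z / s)).
  rewrite -[leLHS]mulr1; apply: ler_pM => //.
    by rewrite -expR0 ler_expR !mulr_ge0.
  by rewrite lerDl divr_ge0.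
move=> eps u du H u0 x y Zx xy yZ.
have eps0 := eps_ge0 H; have [gu ud Lu] := H.
have EZ z : - Z <= z -> z <= Z -> expabs k z <= expabs k Z.
  move=> a b; apply: ler_expabs_norm => //.
  by rewrite ler_norml; have := ler_norm Z; lra.
set m := eps * expabs k Z / s.
have m0 : 0 <= m by rewrite divr_ge0 ?mulr_ge0.
have step : expR (s / c * x) * (u x + m) <= expR (s / c * y) * (u y + m).
  move: xy; rewrite le_eqVlt => /predU1P[->//|xy].
  have Gd z : has_deriv (fun z => expR (s / c * z) * (u z + m)) z
      (s / c * expR (s / c * z) * (u z + m) + expR (s / c * z) * (du z + 0)).
    apply: has_deriv_mul; first exact: has_deriv_expR_lin.
    by apply: has_deriv_add; [exact: ud | exact: has_deriv_const].
  have [t [xt ty]] := MVT_all Gd xy.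
  move=> E; rewrite -subr_ge0 E mulr_ge0 ?subr_ge0 ?(ltW xy) //.
  rewrite (_ : _ + _ = expR (s / c * t) * ((s * u t + eps * expabs k Z + c * du t) / c)); last first.
    by rewrite /m; field; rewrite !gt_eqF.
  rewrite mulr_ge0 // divr_ge0 //.
  have : 0 <= S (fun y => u (t + y)).
    by apply: (functional_ge0 delta0 HS) => //; exact: exp_growth_shift.
  have := Lu t; rewrite /defect ler_norml => /andP[+ _].
  have : eps * expabs k t <= eps * expabs k Z by rewrite ler_wpM2l // EZ //; lra.
  lra.
have ux : u x <= expR (s / c * (y - x)) * (u y + m).
  rewrite mulrBr expRB mulrAC ler_pdivlMr ?expR_gt0 // mulrC.
  by apply: le_trans step; rewrite ler_wpM2l ?expR_ge0 // lerDl.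
rewrite (le_trans ux) // -[leRHS]mulrA; apply: ler_pM; rewrite ?expR_ge0 ?addr_ge0 //.
  rewrite ler_expR ler_wpM2l //.
  by have := ler_norm Z; lra.
rewrite mulrDl mul1r.
have : 0 <= expabs k Z / s * u y by rewrite mulr_ge0 ?divr_ge0.
rewrite mulrDr (_ : expabs k Z / s * eps = m); last by rewrite /m; ring.
lra.
Qed.

(* A mean value point in [y - 1/2, y] bounds [c u'], hence [S] of the translate
   there, hence [u] one unit further on. *)
Lemma forward_harnack Z : exists2 B, 1 <= B & forall eps u du,
  almost_solution eps u du -> (forall x, 0 <= u x) ->
  forall y, `|y| <= Z -> u (y + 2^-1) <= B * (u y + eps).
Proof.
have [B B1 HB] := backward_harnack (Z + 1).
have B0 : 0 <= B by exact: le_trans B1.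
set EZ := expabs k (Z + 1).
set A := (2 * c + EZ + s * B) / delta.
have A0 : 0 <= A.
  by rewrite divr_ge0 // !addr_ge0 ?mulr_ge0 //; exact: E_ge0.
exists (B * (A + 1)); first by rewrite mulr_ege1 // lerDr.
move=> eps u du H u0 y yZ.
have eps0 := eps_ge0 H; have [gu ud Lu] := H.
move: (yZ); rewrite ler_norml => /andP[Zy yZ'].
have [|t [yt ty E]] := MVT_all ud (_ : y - 2^-1 < y); first by lra.
have Et : expabs k t <= EZ.
  apply: ler_expabs_norm => //; rewrite [leRHS]ger0_norm; last by lra.
  by rewrite ler_norml; lra.
have dut : c * du t <= 2 * c * u y.
  have -> : du t = 2 * (u y - u (y - 2^-1)) by rewrite E; field.
  rewrite mulrCA mulrA ler_wpM2l ?mulr_ge0 ?(ltW c0) //.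
  by rewrite gerDl oppr_le0.
have ut : u t <= B * (u y + eps) by apply: (HB _ _ _ H) => //; lra.
have St : delta * u (t + 1) <= S (fun x => u (t + x)).
  by apply: (ef_ge HS) => //; exact: exp_growth_shift.
have u1 : u (t + 1) <= A * (u y + eps).
  rewrite /A mulrAC ler_pdivlMr // mulrC (le_trans St) //.
  have := Lu t; rewrite /defect ler_norml => /andP[+ _].
  have : eps * expabs k t <= eps * EZ by rewrite ler_wpM2l.
  have : s * u t <= s * (B * (u y + eps)) by rewrite ler_wpM2l.
  have : 0 <= EZ * u y by rewrite mulr_ge0 // expabs_ge0.
  have : 0 <= 2 * c * eps by rewrite !mulr_ge0.
  lra.
have uh : u (y + 2^-1) <= B * (u (t + 1) + eps) by apply: (HB _ _ _ H) => //; lra.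
rewrite (le_trans uh) // -[leRHS]mulrA ler_wpM2l // mulrDl mul1r.
have := u0 y; lra.
Qed.

Lemma harnack_half_integer n : exists2 B, 1 <= B & forall eps u du,
  almost_solution eps u du -> (forall x, 0 <= u x) ->
  u (n%:R / 2) <= B * (u 0 + eps).
Proof.
elim: n => [|n [B B1 IH]].
  exists 1 => // eps u du H u0; rewrite mul0r mul1r lerDl; exact: eps_ge0 H.
have [B' B'1 HB'] := forward_harnack (n%:R / 2).
exists (B' * (B + 1)); first by rewrite mulr_ege1 //; lra.
move=> eps u du H u0; have eps0 := eps_ge0 H.
have -> : n.+1%:R / 2 = n%:R / 2 + 2^-1 :> R by rewrite -natr1; field.
have nn : `|n%:R / 2 : R| <= n%:R / 2 by rewrite ger0_norm // divr_ge0.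
rewrite (le_trans (HB' _ _ _ H u0 _ nn)) // -[leRHS]mulrA ler_wpM2l; [by []|lra|].
have := IH _ _ _ H u0; rewrite mulrDl mul1r; have := u0 0; lra.
Qed.

(** The bound at 0 is carried in half-integer steps to a point [n / 2] beyond [X], and from there
    backward over the whole window at once. *)
Lemma harnack X : exists2 B, 1 <= B & forall eps u du,
  almost_solution eps u du -> (forall x, 0 <= u x) ->
  forall x, `|x| <= X -> u x <= B * (u 0 + eps).
Proof.
pose n := (Num.truncn `|2 * X|).+1.
have nX : X <= n%:R / 2.
  rewrite ler_pdivlMr // mulrC (le_trans (ler_norm _)) //.
  by rewrite ltW // truncnS_gt.
have [B B1 HB] := backward_harnack (n%:R / 2).
have [B' B'1 HB'] := harnack_half_integer n.
exists (B * (B' + 1)); first by rewrite mulr_ege1 //; lra.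
move=> eps u du H u0 x; rewrite ler_norml => /andP[Xx xX].
have eps0 := eps_ge0 H.
have h : u x <= B * (u (n%:R / 2) + eps) by apply: (HB _ _ _ H) => //; lra.
rewrite (le_trans h) // -[leRHS]mulrA ler_wpM2l; [by []|lra|].
have := HB' _ _ _ H u0; rewrite mulrDl mul1r; have := u0 0; lra.
Qed.

(** Adding [eps w], with [w = 2 cosh (k .)] as a differentiable majorant of [expabs k], makes [v]
    nonnegative and enlarges the defect only by a factor. Then [harnack] bounds the sum by its value
    at 0, which is at most [3 eps]; the bound from below is the hypothesis. *)
Lemma flatness X : exists2 B, 0 <= B & forall eps v dv,
  almost_solution eps v dv -> (forall x, - (eps * expabs k x) <= v x) -> v 0 <= eps ->
  forall x, `|x| <= X -> `|v x| <= B * eps.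
Proof.
have [B B1 HB] := harnack X.
set SE := S (expabs k).
have gE : exp_growth k (expabs k) by exact: exp_growth_expabs.
have SE0 : 0 <= SE by apply: (functional_ge0 delta0 HS) => // x; exact: expabs_ge0.
(* Defect of [v + eps w] relative to [eps * expabs k]: 1 from [v], then [2 c k], [2 SE] and [2 s]
   from the terms [c w'], [S w] and [s w]. *)
set C := 1 + 2 * c * k + 2 * SE + 2 * s.
have C1 : 1 <= C.
  by rewrite /C -!addrA lerDl !addr_ge0 ?mulr_ge0.
have BC0 : 0 <= B * (3 + C) by rewrite mulr_ge0 //; lra.
exists (B * (3 + C) + expabs k X); first by rewrite addr_ge0 // expabs_ge0.
move=> eps v dv H vE v0 x xX.
have eps0 := eps_ge0 H; have [gv vd Lv] := H.
pose w y := expR (k * y) + expR (- k * y).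
pose dw y := k * expR (k * y) + - k * expR (- k * y).
have gw : exp_growth k w.
  by apply: exp_growthD; apply: exp_growth_expR; rewrite ?normrN ger0_norm.
have wE y : expabs k y <= w y.
  rewrite /w /expabs; have [y0|y0] := leP 0 y.
    by rewrite ger0_norm // lerDl expR_ge0.
  by rewrite ltr0_norm // mulrN mulNr lerDr expR_ge0.
have w2E y : w y <= 2 * expabs k y.
  by rewrite mulr2n mulrDl mul1r lerD // expR_le_expabs // ?normrN ger0_norm.
have wd y : has_deriv w y (dw y).
  by apply: has_deriv_add; exact: has_deriv_expR_lin.
have dw2E y : `|dw y| <= 2 * k * expabs k y.
  rewrite /dw (_ : _ + _ = k * (expR (k * y) - expR (- k * y))); last by ring.
  rewrite normrM (ger0_norm k0') (_ : 2 * k * _ = k * (2 * expabs k y)); last by ring.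
  rewrite ler_wpM2l // (le_trans (ler_normB _ _)) // !(ger0_norm (expR_ge0 _)).
  exact: w2E.
pose u y := v y + eps * w y.
have u0 y : 0 <= u y.
  have := vE y; have : eps * expabs k y <= eps * w y by rewrite ler_wpM2l.
  by rewrite /u; lra.
have Hu : almost_solution (eps * C) u (fun y => dv y + eps * dw y).
  split.
  - by apply: exp_growthD => //; exact: exp_growthZ.
  - by move=> y; apply: has_deriv_add => //; exact: has_deriv_scale.
  - move=> y; rewrite /defect /u.
    have gvy := exp_growth_shift y k0' gv; have gwy := exp_growth_shift y k0' gw.
    rewrite (functionalD HS) ?(functionalZ k0 HS) //; last exact: exp_growthZ.
    have Swy0 : 0 <= S (fun z => w (y + z)).
      by apply: (functional_ge0 delta0 HS) => // z; apply: le_trans (wE _); exact: expabs_ge0.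
    have Swy : S (fun z => w (y + z)) <= 2 * SE * expabs k y.
      have -> : 2 * SE * expabs k y = S (fun z => (2 * expabs k y) * expabs k z).
        by rewrite (functionalZ k0 HS) // -/SE; ring.
      apply: (functional_le delta0 HS) => //; first exact: exp_growthZ.
      move=> z; rewrite (le_trans (w2E _)) // -[leRHS]mulrA ler_wpM2l //.
      exact: expabsD.
    have -> : c * (dv y + eps * dw y) - (S (fun x0 => v (y + x0)) +
       eps * S (fun z => w (y + z))) + s * (v y + eps * w y) =
       defect v dv y + eps * (c * dw y - S (fun z => w (y + z)) + s * w y).
      by rewrite /defect; ring.
    have := Lv y; rewrite !ler_norml => /andP[L1 L2].
    have := dw2E y; rewrite ler_norml => /andP[d1 d2].
    have := ler_wpM2l (ltW c0) d1; have := ler_wpM2l (ltW c0) d2 => d3 d4.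
    have := ler_wpM2l (ltW s0) (w2E y) => s1.
    have w0 : 0 <= w y by apply: le_trans (wE _); exact: expabs_ge0.
    have s2 : 0 <= s * w y by rewrite mulr_ge0.
    set T := c * dw y - S (fun z => w (y + z)) + s * w y.
    have T1 : T <= (C - 1) * expabs k y by rewrite /T /C; lra.
    have T2 : - ((C - 1) * expabs k y) <= T.
      have : 0 <= s * expabs k y by rewrite mulr_ge0 ?expabs_ge0.
      by rewrite /T /C; lra.
    have T1e := ler_wpM2l eps0 T1; have T2e := ler_wpM2l eps0 T2.
    by apply/andP; split; lra.
have ux := HB _ _ _ Hu u0 x xX.
have wx : 0 <= eps * w x by rewrite mulr_ge0 // (le_trans _ (wE _)) // expabs_ge0.
have w00 : w 0 = 2 by rewrite /w !mulr0 expR0.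
have vx : v x <= B * (3 + C) * eps.
  have : B * (u 0 + eps * C) <= B * ((3 + C) * eps).
    by rewrite ler_wpM2l ?(le_trans _ B1) // /u w00; lra.
  by move: ux; rewrite /u; lra.
have Ex : eps * expabs k x <= expabs k X * eps.
  rewrite mulrC ler_wpM2r // ler_expabs_norm //.
  by rewrite (le_trans xX) // ler_norm.
have := vE x.
have : 0 <= expabs k X * eps by rewrite mulr_ge0 // expabs_ge0.
have : 0 <= B * (3 + C) * eps by rewrite mulr_ge0.
rewrite ler_norml mulrDl; lra.
Qed.

End Flatness.

(** * Exponential decay *)

Section LimitsAtMinusInfinity.
Variable R : realType.
Implicit Types (u : R -> R) (l x y z e : R).

Lemma cvgNyP u l : (u x @[x --> -oo] --> l) <->
  forall e, 0 < e -> exists z, forall y, y <= z -> `|u y - l| <= e.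
Proof.
split=> [/cvgrPdist_le h e e0|h].
  have [z [_ zh]] := h e e0; exists (z - 1) => y yz.
  by rewrite distrC; apply: zh; rewrite /=; lra.
apply/cvgrPdist_le => e e0; have [z zh] := h e e0.
exists z; split; first exact: num_real.
by move=> y /= yz; rewrite distrC; apply: zh; exact: ltW.
Qed.

Lemma cvg_seqNy (t : nat -> R) u l : (t n @[n --> \oo] --> -oo) ->
  (u x @[x --> -oo] --> l) -> u (t n) @[n --> \oo] --> l.
Proof. by move=> h /cvg_ninftyP; apply. Qed.

Lemma cvgNy_shift_seq (t : nat -> R) x : (t n @[n --> \oo] --> -oo) ->
  (t n + x @[n --> \oo] --> -oo).
Proof.
move=> /cvgrNyPle h; apply/cvgrNyPle => A; have := h (A - x).
by apply: filterS => n; lra.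
Qed.

Lemma cvgNy_opp_nat : ((- n%:R : R) @[n --> \oo] --> -oo).
Proof.
have /cvgryPge h := @cvgr_idn R; apply/cvgrNyPle => A; have := h (- A).
by apply: filterS => n; lra.
Qed.

End LimitsAtMinusInfinity.

(** * A nonlocal differential inequality that forces exponential decay at -oo *)

Section DifferentialInequality.
Variable R : realType.
Variables (k delta c kap th xi0 : R) (S : (R -> R) -> R).
Hypotheses (k0 : 0 < k) (delta0 : 0 < delta) (HS : exp_functional k delta S) (c0 : 0 < c).
Hypotheses (kap0 : 0 < kap) (th0 : 0 <= th) (th1 : th <= 1) (xi00 : xi0 <= 0).
Implicit Types (u du U : R -> R) (x y z a b : R).

Let k0' : 0 <= k := ltW k0.
Let s := S (fun _ => 1).
Let s0 : 0 < s. Proof. exact: lt_le_trans (functional1_ge k0 HS). Qed.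

Definition jump u x : R := s * u x - S (fun y => u (x + y)).

(** For a tilted wave, [kap] is half of a lower bound of [- charfun], and [th = 1 - eps] because a
    small multiple of [S] is given up to absorb the nonlinear term. *)
Definition growth_ineq u du : Prop :=
  forall x, x <= xi0 -> kap * u x <= c * du x + th * jump u x.

(** The uniformity in [z <= 0] gives all translates to the left one common dominating function, as
    dominated convergence along [z -> -oo] requires. *)
Definition left_growth a u : Prop :=
  exists C, forall z x, z <= 0 -> `|u (z + x)| <= C * expabs a x.

Lemma left_growth_exp a b u : a <= b -> continuous u -> left_growth a u -> exp_growth b u.
Proof.
move=> ab cu [C uC]; apply: exp_growthS ab _; split=> //.
by exists C => x; rewrite -(add0r x) (le_trans (uC _ _ _)) // add0r.
Qed.

Lemma jumpE u z : exp_growth k u -> jump u z = S (fun x => u z - u (z + x)).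
Proof.
move=> gu; rewrite (functionalB HS); last exact: exp_growth_shift.
  by rewrite (functional_cst k0 HS) mulrC.
exact: exp_growth_cst.
Qed.

Lemma left_growth_primitive_diff a b u U : 0 <= a -> a < b -> left_growth a u ->
  (forall x, has_deriv U x (u x)) ->
  exists2 C, 0 <= C & forall z x, z <= 0 -> `|U (z + x) - U z| <= C * expabs b x.
Proof.
move=> a0 ab [C uC] Ud.
have C0 : 0 <= C.
  by have := uC 0 0 (lexx _); rewrite expabs0 mulr1; exact: le_trans.
have ba : 0 < b - a by rewrite subr_gt0.
exists ((b - a)^-1 * C); first by rewrite mulr_ge0 // invr_ge0 ltW.
move=> z x z0.
have h : `|U (z + x) - U z| <= `|x| * (C * expabs a x).
  apply: (MVT_norm_le Ud) => y yx; rewrite (le_trans (uC _ _ z0)) //.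
  by rewrite ler_wpM2l // ler_expabs_norm.
rewrite (le_trans h) //.
have -> : (b - a)^-1 * C * expabs b x = ((b - a)^-1 * expabs (b - a) x) * (C * expabs a x).
  by rewrite mulrACA expabsM subrK.
by rewrite ler_wpM2r ?norm_le_expabs // mulr_ge0 // expabs_ge0.
Qed.

Lemma jump_deriv u U z : exp_growth k U -> exp_growth k u ->
  (forall x, has_deriv U x (u x)) -> has_deriv (jump U) z (jump u z).
Proof.
move=> gU gu Ud; apply: has_deriv_sub; first exact: has_deriv_scale.
exact: (functional_shift_deriv k0 HS).
Qed.

(** Integrated, the inequality says that [W] below is nondecreasing up to [xi0]. As [jump] ignores
    additive constants, it is bounded on the left half-line for any primitive, and monotonicity of
    [W] bounds the primitive from below. Once the primitive is normalised to vanish at -oo, [W]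
    tends to 0 there, so [W >= 0], which is the inequality one level up. The increase from [a] to
    [b] pays for the factor [|x|] of an integration. *)
Lemma growth_ineq_primitive a b u du : 0 <= a -> a < b -> b <= k ->
  (forall x, has_deriv u x (du x)) -> (forall x, 0 <= u x) -> left_growth a u ->
  (u x @[x --> -oo] --> 0) -> growth_ineq u du ->
  exists U, [/\ forall x, has_deriv U x (u x), forall x, 0 <= U x, left_growth b U,
    (U x @[x --> -oo] --> 0) & growth_ineq U u].
Proof.
move=> a0 ab bk ud u0 lu u_to0 Gu.
have cu : continuous u by move=> x; exact: has_deriv_continuous (ud x).
have gu : exp_growth k u by apply: left_growth_exp lu => //; lra.
have [U0 U0d] := continuous_primitive cu.
have [C C0 UC] := left_growth_primitive_diff a0 ab lu U0d.
have b0 : 0 <= b by lra.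
have gU_of U m : (forall x, U x = U0 x - m) -> exp_growth k U.
  move=> UE; apply: exp_growthS bk _; split.
    rewrite (_ : U = (fun x => U0 x - m)); last exact/funext.
    by move=> x; apply: cvgB; [exact: has_deriv_continuous (U0d x) | exact: cvg_cst].
  exists (C + `|U0 0 - m|) => x; rewrite UE.
  have -> : U0 x - m = (U0 (0 + x) - U0 0) + (U0 0 - m) by rewrite add0r; ring.
  rewrite (le_trans (ler_normD _ _)) // mulrDl lerD ?UC //.
  by rewrite ler_peMr // expabs_ge1.
set SE := S (fun x => C * expabs b x).
have gE : exp_growth k (fun x => C * expabs b x).
  by apply: exp_growthZ => //; exact: exp_growth_expabs.
have jumpU U m z : (forall x, U x = U0 x - m) -> z <= 0 -> `|jump U z| <= SE.
  move=> UE z0; have gU := gU_of _ _ UE; rewrite jumpE //.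
  apply: (functional_norm_le k0 delta0 HS) => //.
    by apply: exp_growthB; [exact: exp_growth_cst | exact: exp_growth_shift].
  move=> x; rewrite !UE distrC.
  by rewrite (_ : _ - _ = U0 (z + x) - U0 z); [exact: UC | ring].
pose W U z := c * u z + th * jump U z - kap * U z.
have W_mono U m x y : (forall x, U x = U0 x - m) -> x <= y -> y <= xi0 -> W U x <= W U y.
  move=> UE; have gU := gU_of _ _ UE.
  have Ud t : has_deriv U t (u t).
    rewrite (_ : U = (fun x => U0 x - m)); last exact/funext.
    by rewrite -[u t]subr0; apply: has_deriv_sub => //; exact: has_deriv_const.
  apply: (@derive_ge0_le R _ (fun t => c * du t + th * jump u t - kap * u t)) => t.
    apply: has_deriv_sub; last exact: has_deriv_scale.
    apply: has_deriv_add; first exact: has_deriv_scale.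
    by apply: has_deriv_scale; exact: jump_deriv.
  by move=> /Gu; rewrite subr_ge0.
have U0_mono x y : x <= y -> U0 x <= U0 y.
  by move=> xy; apply: (derive_ge0_le U0d (z := y)).
have U0_0 x : U0 x = U0 x - 0 by rewrite subr0.
have U0_lb z : z <= xi0 -> - ((W U0 xi0 + SE) / kap) <= U0 z.
  move=> zx; rewrite lerNl ler_pdivlMr // mulrC mulrN.
  have := W_mono _ _ _ _ U0_0 zx (lexx _).
  have z0 : z <= 0 by exact: le_trans xi00.
  have /(_ z z0) := jumpU U0 0 _ U0_0; rewrite ler_norml => /andP[j1 j2].
  have : 0 <= c * u z by rewrite mulr_ge0 // ltW.
  have SE0 : 0 <= SE by lra.
  have : - SE <= th * jump U0 z.
    have := ler_wpM2l th0 j1.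
    have : th * SE <= SE by rewrite ler_piMl.
    lra.
  rewrite [W U0 z]/W; lra.
pose A := range U0.
have hA : has_inf A.
  split; first by exists (U0 0), 0.
  exists (- ((W U0 xi0 + SE) / kap)) => _ [x _ <-].
  have [xx|xx] := leP x xi0; first exact: U0_lb.
  by rewrite (le_trans (U0_lb _ (lexx _))) // U0_mono // ltW.
pose U x := U0 x - inf A.
have UE x : U x = U0 x - inf A by [].
have gU := gU_of _ _ UE.
have U_ge0 x : 0 <= U x.
  by rewrite subr_ge0; apply: ge_inf; [case: hA | exists x].
have Ud x : has_deriv U x (u x).
  by rewrite -[u x]subr0; apply: has_deriv_sub => //; exact: has_deriv_const.
have U_to0 : U x @[x --> -oo] --> 0.
  apply/cvgNyP => e e0.
  have [_ [z _ <-] zE] := inf_adherent e0 hA.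
  exists z => y yz; rewrite subr0 ger0_norm //.
  by have := U0_mono _ _ yz; rewrite /U; lra.
exists U; split => //.
  exists (C + U 0) => z x z0.
  have -> : U (z + x) = (U0 (z + x) - U0 z) + U z by rewrite /U; ring.
  rewrite (le_trans (ler_normD _ _)) // mulrDl lerD ?UC // ger0_norm //.
  apply: (@le_trans _ _ (U 0)); first by rewrite /U lerD2r U0_mono.
  by rewrite ler_peMr // expabs_ge1.
have jump_to0 : jump U (- n%:R) @[n --> \oo] --> 0.
  under eq_fun do rewrite jumpE //.
  rewrite -(functional0 k0 HS).
  apply: (ef_dct HS (C := C)).
  - move=> n x; apply: cvgB; first exact: cvg_cst.
    by apply: continuous_shift => y; exact: has_deriv_continuous (Ud y).
  - move=> n x; rewrite distrC (_ : _ - _ = U0 (- n%:R + x) - U0 (- n%:R)); last by rewrite /U; ring.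
    rewrite (le_trans (UC _ _ _)) ?oppr_le0 // ler_wpM2l // ler_expabs //.
  - exact: exp_growth_cst.
  - move=> x; rewrite -[0](subr0 0); apply: cvgB.
      exact: (@cvg_seqNy R (fun n => - n%:R) U 0 (@cvgNy_opp_nat R) U_to0).
    exact: (@cvg_seqNy R (fun n => - n%:R + x) U 0 (cvgNy_shift_seq x (@cvgNy_opp_nat R)) U_to0).
move=> x xx; rewrite -subr_ge0.
have W_to0 : W U (- n%:R) @[n --> \oo] --> 0.
  rewrite (_ : 0 = c * 0 + th * 0 - kap * 0); last by ring.
  apply: cvgB; last by apply: cvgM; [exact: cvg_cst | exact: (@cvg_seqNy R (fun n => - n%:R) U 0 (@cvgNy_opp_nat R) U_to0)].
  apply: cvgD; last by apply: cvgM; [exact: cvg_cst | exact: jump_to0].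
  by apply: cvgM; [exact: cvg_cst | exact: (@cvg_seqNy R (fun n => - n%:R) u 0 (@cvgNy_opp_nat R) u_to0)].
rewrite -/(W U x) -(cvg_lim _ W_to0) //.
apply: limr_le; first by apply/cvg_ex; exists 0.
have /cvgrNyPle/(_ x) := @cvgNy_opp_nat R.
by apply: filterS => n nx; apply: W_mono UE _ _.
Qed.

(** Convexity makes the nonlocal term local: [U2 x - U2 (x + y)] is at most [|y| U1 x] for [y < 0]
    and nonpositive for [y >= 0], so [jump U2 x <= U1 x * S |.|]. The decay of [U2] passes to [U1]
    and then to [u], each time with a shift by 1, whence [xi0 - 2]. *)
Lemma growth_ineq_decay a u du : 0 < a -> 3 * a <= k ->
  (forall x, has_deriv u x (du x)) -> (forall x, 0 <= u x) -> left_growth a u ->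
  (u x @[x --> -oo] --> 0) -> growth_ineq u du ->
  exists C, forall x, x <= xi0 - 2 ->
    u x <= C * expR (kap / (c + S (fun x => `|x|)) * x).
Proof.
move=> a0 a3 ud u0 lu u_to0 Gu.
have [|||U1 [U1d U10 lU1 U1_to0 G1]] := growth_ineq_primitive (b := 2 * a) _ _ _ ud u0 lu u_to0 Gu.
1-3: by lra.
have [|||U2 [U2d U20 lU2 U2_to0 G2]] := growth_ineq_primitive (b := 3 * a) _ _ _ U1d U10 lU1 U1_to0 G1.
1-3: by lra.
have gn : exp_growth k (fun x : R => `|x|) by exact: exp_growth_norm.
set N := S (fun x => `|x|).
have N0 : 0 <= N by apply: (functional_ge0 delta0 HS).
set B := c + N; have B0 : 0 < B by rewrite ltr_pwDl.
set dl := kap / B; have dl0 : 0 < dl by rewrite divr_gt0.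
have gU2 : exp_growth k U2.
  by apply: left_growth_exp lU2 => // x; exact: has_deriv_continuous (U2d x).
have U1_mono x y : x <= y -> U1 x <= U1 y by move=> xy; apply: (derive_ge0_le U1d (z := y)).
have U2_mono x y : x <= y -> U2 x <= U2 y by move=> xy; apply: (derive_ge0_le U2d (z := y)).
have U2B x : x <= xi0 -> dl * U2 x <= U1 x.
  move=> xx; rewrite /dl mulrAC ler_pdivrMr // (le_trans (G2 _ xx)) //.
  rewrite (_ : U1 x * B = c * U1 x + U1 x * N); last by rewrite /B; ring.
  rewrite lerD2l.
  have j : jump U2 x <= U1 x * N.
    rewrite jumpE // -(functionalZ k0 HS) //.
    apply: (functional_le delta0 HS).
    - by apply: exp_growthB; [exact: exp_growth_cst | exact: exp_growth_shift].
    - exact: exp_growthZ.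
    - move=> y; have [y0|y0] := leP 0 y.
        apply: (@le_trans _ _ 0); last by rewrite mulr_ge0.
        by rewrite subr_le0 U2_mono // lerDl.
      have [|t [_ tx ->]] := MVT_all U2d (_ : x + y < x); first by lra.
      rewrite ltr0_norm // (_ : x - (x + y) = - y); last by ring.
      by rewrite ler_wpM2r ?oppr_ge0 ?(ltW y0) // U1_mono // ltW.
  have := ler_wpM2l th0 j.
  have : th * (U1 x * N) <= U1 x * N by rewrite ler_piMl // mulr_ge0.
  lra.
have U2e x : x <= xi0 -> U2 x <= U2 xi0 * expR (- dl * xi0) * expR (dl * x).
  move=> xx.
  have h : expR (- dl * x) * U2 x <= expR (- dl * xi0) * U2 xi0.
    apply: (@derive_ge0_le R (fun x => expR (- dl * x) * U2 x) (fun x => - dl * expR (- dl * x) * U2 x + expR (- dl * x) * U1 x) xi0) => // t.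
      by apply: has_deriv_mul => //; exact: has_deriv_expR_lin.
    move=> tx; rewrite (_ : _ + _ = expR (- dl * t) * (U1 t - dl * U2 t)); last by ring.
    by rewrite mulr_ge0 ?expR_ge0 // subr_ge0 U2B.
  have := ler_wpM2r (expR_ge0 (dl * x)) h.
  by rewrite mulrAC -expRD mulNr addNr expR0 mul1r (mulrC (expR _) (U2 xi0)).
have U1U2 x : U1 (x - 1) <= U2 x.
  have [|t [xt tx E]] := MVT_all U2d (_ : x - 1 < x); first by lra.
  apply: (@le_trans _ _ (U1 t)); first by rewrite U1_mono // ltW.
  have := U20 (x - 1); move: E; rewrite (_ : x - (x - 1) = 1); last by ring.
  by rewrite mulr1; lra.
(* A mean value point [t] in [(x - 1, x)] has [u t <= U1 x]. The inequality also gives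
   [c u' + s u >= 0], so [u (x - 1)] exceeds [u t] at most by the factor [exp (s / c)]. *)
have uU1 x : x <= xi0 -> u (x - 1) <= expR (s / c) * U1 x.
  move=> xx.
  have [|t [xt tx E]] := MVT_all U1d (_ : x - 1 < x); first by lra.
  have ut : u t <= U1 x.
    have := U10 (x - 1); move: E; rewrite (_ : x - (x - 1) = 1); last by ring.
    by rewrite mulr1; lra.
  have h : expR (s / c * (x - 1)) * u (x - 1) <= expR (s / c * t) * u t.
    apply: (@derive_ge0_le R (fun x => expR (s / c * x) * u x) (fun x => s / c * expR (s / c * x) * u x + expR (s / c * x) * du x) xi0) => //; last 2 first.
    + exact: ltW.
    + exact: le_trans (ltW tx) xx.
    + by move=> y; apply: has_deriv_mul => //; exact: has_deriv_expR_lin.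
    move=> y yx; rewrite (_ : _ + _ = expR (s / c * y) * ((s * u y + c * du y) / c)); last first.
      by field; rewrite gt_eqF.
    rewrite mulr_ge0 ?expR_ge0 // divr_ge0 ?(ltW c0) //.
    have gu : exp_growth k u.
      by apply: left_growth_exp lu => [|z]; [lra | exact: has_deriv_continuous (ud z)].
    have Su : 0 <= S (fun z => u (y + z)).
      by apply: (functional_ge0 delta0 HS) => //; exact: exp_growth_shift.
    have := Gu _ yx; have : 0 <= kap * u y by rewrite mulr_ge0 // ltW.
    have : th * jump u y <= s * u y.
      have : 0 <= th * S (fun z => u (y + z)) by rewrite mulr_ge0.
      have : th * (s * u y) <= s * u y by rewrite ler_piMl // mulr_ge0 // ltW.
      by rewrite /jump; lra.
    lra.
  have h2 : u (x - 1) <= expR (s / c * (t - (x - 1))) * u t.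
    by rewrite mulrBr expRB mulrAC ler_pdivlMr ?expR_gt0 // mulrC.
  rewrite (le_trans h2) // ler_pM ?expR_ge0 // ler_expR -[leRHS]mulr1.
  by rewrite ler_wpM2l ?divr_ge0 ?(ltW s0) ?(ltW c0) //; lra.
exists (expR (s / c) * (U2 xi0 * expR (- dl * xi0) * expR (dl * 2))) => x xx.
have h1 := uU1 (x + 1); have h2 := U1U2 (x + 2); have h3 := U2e (x + 2).
rewrite (_ : x + 1 - 1 = x) in h1; last by ring.
rewrite (_ : x + 2 - 1 = x + 1) in h2; last by ring.
rewrite (le_trans (h1 _)) //; first by lra.
rewrite -[leRHS]mulrA ler_wpM2l ?expR_ge0 // (le_trans h2) // (le_trans (h3 _)) //; first by lra.
by rewrite -[leRHS]mulrA -expRD -mulrDr (addrC 2).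
Qed.

End DifferentialInequality.

(** * Bootstrapping the decay rate of the wave up to the first root *)

Section Decay.
Variable R : realType.
Variables (k delta c e M sigma K l1 : R) (S : (R -> R) -> R) (phi dphi q : R -> R).
Hypotheses (k0 : 0 < k) (delta0 : 0 < delta) (HS : exp_functional k delta S) (c0 : 0 < c).
Hypotheses (M0 : 0 < M) (sigma0 : 0 < sigma) (l10 : 0 < l1) (l1k : l1 < k).
Hypotheses (phid : forall x, has_deriv phi x (dphi x)) (phi0 : forall x, 0 < phi x)
  (phiK : forall x, phi x <= K) (phi_to0 : phi x @[x --> -oo] --> 0).
Hypothesis phi_eq : forall x,
  c * dphi x = S (fun y => phi (x + y)) - e * phi x - q x.
Hypothesis q_ge0 : forall x, 0 <= q x.
Hypothesis q_le : forall x,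
  q x <= M * (phi x + S (fun y => phi (x + y))) `^ (1 + sigma).

Definition charfun l : R := c * l + e - S (fun x => expR (l * x)).

Hypotheses (charfun_l1 : charfun l1 = 0) (charfun_lt0 : forall l : R, 0 <= l < l1 -> charfun l < 0).
Implicit Types (l lb x y z : R).

Let k0' : 0 <= k := ltW k0.
Let K0 : 0 < K. Proof. exact: lt_le_trans (phi0 0) (phiK 0). Qed.

Let cphi : continuous phi.
Proof. by move=> x; exact: has_deriv_continuous (phid x). Qed.

Let gphi z : exp_growth k (fun x => phi (z + x)).
Proof.
apply: exp_growth_shift => //; split => //; exists K => x.
rewrite ger0_norm ?(ltW (phi0 _)) // (le_trans (phiK x)) //.
by rewrite ler_peMr ?expabs_ge1 // ltW.
Qed.

Let gexp l : 0 <= l -> l <= l1 -> exp_growth k (fun x => expR (l * x)).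
Proof. by move=> l0 ll; apply: exp_growth_expR; rewrite ger0_norm //; move: (l1k) (ll); lra. Qed.

(** Concavity in tangent form, obtained by applying [S] to [exp t >= 1 + t] with [t = (l - l') x],
    weighted by [exp (l' x)]; no differentiation under [S] is involved. *)
Lemma charfun_tangent l l' : 0 <= l -> l <= l1 -> 0 <= l' -> l' < k ->
  charfun l <= charfun l' + (l - l') * (c - S (fun x => x * expR (l' * x))).
Proof.
move=> l0 ll l'0 l'k.
have ge' : exp_growth k (fun x => expR (l' * x)).
  by apply: exp_growth_expR; rewrite ger0_norm // ltW.
have gx : exp_growth k (fun x => x * expR (l' * x)).
  have -> : k = (k - l') + l' by ring.
  apply: exp_growthM; first by apply: exp_growth_id; lra.
  by apply: exp_growth_expR; rewrite ger0_norm.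
have h : S (fun x => (l - l') * (x * expR (l' * x)) + expR (l' * x)) <= S (fun x => expR (l * x)).
  apply: (functional_le delta0 HS); [exact: exp_growth_lin | exact: gexp |].
  move=> x; have -> : expR (l * x) = expR ((l - l') * x) * expR (l' * x).
    by rewrite -expRD; congr expR; ring.
  rewrite (_ : _ + _ = (1 + (l - l') * x) * expR (l' * x)); last by ring.
  by rewrite ler_wpM2r ?expR_ge0 // expR_ge1Dx.
by move: h; rewrite (ef_lin HS) // /charfun; lra.
Qed.

(** The tangent at [lb] starts from a negative value and lies above [charfun l1 = 0] at [l1], so its
    slope is positive. *)
Lemma charfun_le l lb : 0 <= l -> l <= lb -> lb < l1 -> charfun l <= charfun lb.
Proof.
move=> l0 llb lbl1; have l10_ := l10; have l1k_ := l1k; set T := S (fun x => x * expR (lb * x)).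
have lb0 : charfun lb < 0 by apply: charfun_lt0; lra.
have := charfun_tangent (l := l) (l' := lb) l0; have := charfun_tangent (l := l1) (l' := lb) (ltW l10).
rewrite charfun_l1 -/T => h1 h2.
have {}h1 : 0 <= charfun lb + (l1 - lb) * (c - T) by apply: h1; lra.
have {}h2 : charfun l <= charfun lb + (l - lb) * (c - T) by apply: h2; lra.
have T0 : 0 < c - T.
  rewrite -(pmulr_rgt0 _ (_ : 0 < l1 - lb)); lra.
have : (l - lb) * (c - T) <= 0 by apply: mulr_le0_ge0; lra.
lra.
Qed.

Lemma Sphi_to0 : S (fun y => phi (x + y)) @[x --> -oo] --> 0.
Proof.
apply/cvg_ninftyP => t tN; rewrite -(functional0 k0 HS).
apply: (ef_dct HS (C := K)).
- by move=> n; case: (gphi (t n)).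
- move=> n x; rewrite ger0_norm ?(ltW (phi0 _)) // (le_trans (phiK _)) //.
  by rewrite ler_peMr ?expabs_ge1 // ltW.
- exact: exp_growth_cst.
- by move=> x; exact: (@cvg_seqNy R (fun n => t n + x) phi 0 (cvgNy_shift_seq x tN) phi_to0).
Qed.

Lemma Sphi_ge0 x : 0 <= S (fun y => phi (x + y)).
Proof. by apply: (functional_ge0 delta0 HS) => // y; exact: ltW. Qed.

Lemma q_small eps : 0 < eps -> exists z, z <= 0 /\ forall x, x <= z ->
  q x <= eps * (phi x + S (fun y => phi (x + y))).
Proof.
move=> eps0.
have h : phi x + S (fun y => phi (x + y)) @[x --> -oo] --> 0.
  by rewrite -[0]addr0; apply: cvgD; [exact: phi_to0 | exact: Sphi_to0].
(* Chosen so that [v <= t] gives [M v ^ sigma <= eps]. *)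
set t := (eps / M) `^ sigma^-1.
have t0 : 0 < t by rewrite powR_gt0 // divr_gt0.
have /cvgNyP/(_ _ t0)[z zh] := h.
exists (Num.min z 0); split; first by rewrite ge_min lexx orbT.
move=> x; rewrite le_min => /andP[xz _].
set v := phi x + _.
have v0 : 0 < v by rewrite ltr_pwDl // Sphi_ge0.
have vt : v <= t by have := zh x xz; rewrite subr0 ger0_norm // ltW.
rewrite (le_trans (q_le x)) // -/v powRD; last by rewrite gt_eqF ?addr_gt0.
rewrite powRr1 ?(ltW v0) // mulrCA mulrC ler_wpM2r ?(ltW v0) //.
rewrite mulrC -ler_pdivlMr //.
have -> : eps / M = t `^ sigma by rewrite -powRrM mulVf ?gt_eqF // powRr1 // ltW // divr_gt0.
by rewrite ge0_ler_powR // ?nnegrE ltW.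
Qed.

Definition tilted l x : R := expR (- l * x) * phi x.
Definition dtilted l x : R := - l * expR (- l * x) * phi x + expR (- l * x) * dphi x.
Definition tiltS l (u : R -> R) : R := S (fun x => expR (l * x) * u x).

Lemma tilted_deriv l x : has_deriv (tilted l) x (dtilted l x).
Proof. by apply: has_deriv_mul => //; exact: has_deriv_expR_lin. Qed.

Lemma tilted_gt0 l x : 0 < tilted l x.
Proof. by rewrite mulr_gt0 // expR_gt0. Qed.

Lemma tiltS_functional l : 0 <= l -> l < k ->
  exp_functional (k - l) (delta * expR l) (tiltS l).
Proof. by move=> l0 lk; exact: exp_functional_tilt. Qed.

Lemma tiltS_tilted l x :
  tiltS l (fun y => tilted l (x + y)) = expR (- l * x) * S (fun y => phi (x + y)).
Proof.
rewrite -(functionalZ k0 HS) //; congr S; apply/funext => y.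
rewrite /tilted mulrA -expRD; congr (expR _ * _); ring.
Qed.

Lemma tiltS1 l : tiltS l (fun _ => 1) = S (fun x => expR (l * x)).
Proof. by congr S; apply/funext => x; rewrite mulr1. Qed.

Lemma tilted_eq l x : c * dtilted l x = tiltS l (fun y => tilted l (x + y))
  - tiltS l (fun _ => 1) * tilted l x - charfun l * tilted l x - expR (- l * x) * q x.
Proof.
rewrite tiltS_tilted tiltS1 /dtilted /charfun /tilted.
rewrite mulrDr (mulrCA c (expR _) (dphi x)) phi_eq; ring.
Qed.

Lemma tilted_bounded l : 0 <= l -> (tilted l x @[x --> -oo] --> 0) ->
  exists2 C, 0 <= C & forall x, tilted l x <= C.
Proof.
move=> l0 /cvgNyP/(_ 1 ltr01)[z zh].
have e1 := expR_ge0 (`|l * z|).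
exists (1 + K * expR (`|l * z|)); first by rewrite addr_ge0 // mulr_ge0 // ltW.
move=> x; have [xz|zx] := leP x z.
  have := zh x xz; rewrite subr0 ger0_norm ?(ltW (tilted_gt0 _ _)) //.
  by have : 0 <= K * expR (`|l * z|) by [rewrite mulr_ge0 // ltW|]; lra.
have : tilted l x <= K * expR `|l * z|.
  rewrite /tilted mulrC ler_pM ?expR_ge0 ?(ltW (phi0 _)) // ler_expR.
  rewrite mulNr; have := ler_norm (- (l * z)); rewrite normrN.
  have : l * z <= l * x by rewrite ler_wpM2l // ltW.
  lra.
lra.
Qed.

(* The gain [dl] is uniform in [l], so finitely many steps reach [lb]. *)
Lemma decay_step lb : 0 <= lb -> lb < l1 -> exists2 dl, 0 < dl & forall l l',
  0 <= l -> l <= lb -> l' <= l + dl -> (tilted l x @[x --> -oo] --> 0) ->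
  tilted l' x @[x --> -oo] --> 0.
Proof.
move=> lb0 lbl1.
set kap := - charfun lb.
have kap0 : 0 < kap by rewrite oppr_gt0 charfun_lt0 // lb0.
pose a := (k - l1) / 3.
have a0 : 0 < a by rewrite divr_gt0 // subr_gt0.
have gE : exp_growth k (expabs l1) by apply: exp_growth_expabs; exact: ltW.
have gnE : exp_growth k (fun x : R => `|x| * expabs l1 x).
  have -> : k = (k - l1) + l1 by ring.
  by apply: exp_growthM; [apply: exp_growth_norm; rewrite subr_gt0 | exact: exp_growth_expabs].
set sm := S (expabs l1).
have sm0 : 0 <= sm by apply: (functional_ge0 delta0 HS) => // x; exact: expabs_ge0.
set nm := S (fun x : R => `|x| * expabs l1 x).
have nm0 : 0 <= nm.
  by apply: (functional_ge0 delta0 HS) => // x; rewrite mulr_ge0 // expabs_ge0.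
(* Absorbing [q] costs [eps (1 + s)], at most half of [kap]. Here [sm] and [nm] bound the mass and
   the first absolute moment of the tilted functionals for all [l <= lb] simultaneously. *)
pose eps := Num.min 1 (kap / 2 / (1 + sm)).
have eps0 : 0 < eps by rewrite lt_min ltr01 !divr_gt0 // ltr_pwDl.
have eps1 : eps <= 1 by rewrite ge_min lexx.
have epsk : eps * (1 + sm) <= kap / 2 by rewrite -ler_pdivlMr ?ltr_pwDl // ge_min lexx orbT.
have [xi0 [xi00 qx]] := q_small eps0.
(* At most half of the rate supplied by [growth_ineq_decay]; the other half makes the further tilted
   function tend to 0 and not merely stay bounded. *)
exists (kap / 2 / (c + nm) / 2); first by rewrite !divr_gt0 // ltr_pwDl.
move=> l l' l0 llb ll' tl0; have l1k_ := l1k; have l10_ := l10.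
have lk : l < k by lra.
have HT := tiltS_functional l0 lk.
have kl0 : 0 < k - l by rewrite subr_gt0.
have dT0 : 0 < delta * expR l by rewrite mulr_gt0 // expR_gt0.
have El x : expR (l * x) <= expabs l1 x by rewrite expR_le_expabs // ger0_norm //; lra.
have s_le : tiltS l (fun _ => 1) <= sm.
  by rewrite tiltS1; apply: (functional_le delta0 HS) => //; apply: gexp => //; lra.
have N_le : tiltS l (fun x => `|x|) <= nm.
  apply: (functional_le delta0 HS) => //.
    have -> : k = l1 + (k - l1) by ring.
    apply: exp_growthM; last by apply: exp_growth_norm; rewrite subr_gt0.
    by apply: exp_growth_expR; rewrite ger0_norm //; lra.
  by move=> x; rewrite mulrC ler_wpM2l.
have N_ge0 : 0 <= tiltS l (fun x => `|x|).
  by apply: (functional_ge0 dT0 HT) => //; exact: exp_growth_norm.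
have [C C0 tC] := tilted_bounded l0 tl0.
have lg : left_growth a (tilted l).
  exists C => z x _; rewrite ger0_norm ?(ltW (tilted_gt0 _ _)) // (le_trans (tC _)) //.
  by rewrite ler_peMr // expabs_ge1 // ltW.
have G : growth_ineq c (kap / 2) (1 - eps) xi0 (tiltS l) (tilted l) (dtilted l).
  move=> x xx; rewrite tilted_eq /jump.
  set T := tiltS l (fun y => tilted l (x + y)).
  have T0 : 0 <= T by rewrite /T tiltS_tilted mulr_ge0 ?expR_ge0 // Sphi_ge0.
  have r_le : expR (- l * x) * q x <= eps * (tilted l x + T).
    rewrite /T tiltS_tilted /tilted -mulrDr mulrCA ler_wpM2l ?expR_ge0 //.
    exact: qx.
  have t0 := ltW (tilted_gt0 l x).
  have D : kap * tilted l x <= - charfun l * tilted l x.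
    by rewrite ler_wpM2r // lerN2 charfun_le.
  have h1 := ler_wpM2r t0 epsk.
  have h2 : eps * tiltS l (fun _ => 1) * tilted l x <= eps * sm * tilted l x.
    by rewrite ler_wpM2r // ler_wpM2l // ltW.
  lra.
have [|||||C' C'h] := growth_ineq_decay kl0 dT0 HT c0 _ _ _ xi00 a0 _ (@tilted_deriv l) _ lg tl0 G.
- by rewrite divr_gt0.
- by rewrite subr_ge0.
- by rewrite gerDl oppr_le0 ltW.
- by rewrite /a; lra.
- by move=> x; exact: ltW (tilted_gt0 _ _).
set dl := kap / 2 / (c + nm) / 2 in ll' *.
have dl0 : 0 < dl by rewrite !divr_gt0 // ltr_pwDl.
set dl' := kap / 2 / (c + tiltS l (fun x => `|x|)) in C'h.
have dl'dl : 2 * dl <= dl'.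
  rewrite /dl /dl' (_ : 2 * _ = kap / 2 / (c + nm)); last by field; rewrite gt_eqF // ltr_pwDl.
  rewrite ler_wpM2l ?divr_ge0 ?(ltW kap0) // lef_pV2 ?posrE ?ltr_pwDl //.
  by rewrite lerD2l.
apply/cvgNyP => e' e'0.
have C'0 : 0 < C'.
  have := C'h (xi0 - 2) (lexx _); have := tilted_gt0 l (xi0 - 2) => h1 h2.
  by rewrite -(pmulr_lgt0 _ (expR_gt0 (dl' * (xi0 - 2)))); exact: lt_le_trans h1 h2.
exists (Num.min (xi0 - 2) (ln (e' / C') / dl)) => x.
rewrite le_min => /andP[xx xl]; rewrite subr0 ger0_norm ?(ltW (tilted_gt0 _ _)) //.
have x0 : x <= 0 by lra.
have h : tilted l' x <= expR (- dl * x) * tilted l x.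
  rewrite /tilted mulrA -expRD ler_wpM2r ?(ltW (phi0 _)) // ler_expR.
  rewrite -mulrDl ler_wnM2r //; lra.
rewrite (le_trans h) //.
have h2 : expR (- dl * x) * tilted l x <= C' * expR (dl * x).
  have -> : C' * expR (dl * x) = expR (- dl * x) * (C' * expR (2 * dl * x)).
    rewrite mulrCA -expRD; congr (_ * expR _); ring.
  rewrite ler_wpM2l ?expR_ge0 // (le_trans (C'h x xx)) // ler_wpM2l ?(ltW C'0) //.
  by rewrite ler_expR ler_wnM2r.
rewrite (le_trans h2) // mulrC -ler_pdivlMr // -[leRHS]lnK ?posrE ?divr_gt0 //.
by rewrite ler_expR mulrC -ler_pdivlMr.
Qed.

Lemma tilted_to0 lb : 0 <= lb -> lb < l1 -> tilted lb x @[x --> -oo] --> 0.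
Proof.
move=> lb0 lbl1; have [dl dl0 step] := decay_step lb0 lbl1.
have ind n : tilted (Num.min (n%:R * dl) lb) x @[x --> -oo] --> 0.
  elim: n => [|n IH].
    rewrite mul0r (min_l lb0).
    rewrite (_ : (fun x => tilted 0 x) = phi) //.
    by apply/funext => x; rewrite /tilted oppr0 mul0r expR0 mul1r.
  apply: step IH.
  - by rewrite le_min lb0 mulr_ge0 // ltW.
  - by rewrite ge_min lexx orbT.
  - rewrite -natr1 mulrDl mul1r ge_min; have [_|_] := leP (n%:R * dl) lb.
      by rewrite lexx.
    by rewrite lerDl (ltW dl0) orbT.
have := ind (Num.truncn (lb / dl)).+1; rewrite min_r //.
by rewrite -ler_pdivrMr // ltW // truncnS_gt.
Qed.

Lemma phi_decay lb : 0 <= lb -> lb < l1 ->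
  exists2 C, 0 <= C & forall x, phi x <= C * expR (lb * x).
Proof.
move=> lb0 lbl1; have [C C0 h] := tilted_bounded lb0 (tilted_to0 lb0 lbl1).
exists C => // x; have := ler_wpM2r (expR_ge0 (lb * x)) (h x).
by rewrite /tilted mulrAC -expRD mulNr addNr expR0 mul1r.
Qed.

End Decay.

(** * First integrals and sharp asymptotics *)

Section SharpAsymptotics.
Variable R : realType.
Variables (k delta c eta Cr l1 : R) (S : (R -> R) -> R) (psi dpsi r : R -> R).
Hypotheses (k0 : 0 < k) (delta0 : 0 < delta) (HS : exp_functional k delta S) (c0 : 0 < c).
Hypotheses (psid : forall x, has_deriv psi x (dpsi x)) (psi0 : forall x, 0 < psi x).
Hypothesis psi_eq : forall x,
  c * dpsi x = S (fun y => psi (x + y)) - S (fun _ => 1) * psi x - r x.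
Hypotheses (eta0 : 0 < eta) (etak : eta <= k) (r_ge0 : forall x, 0 <= r x)
  (r_le : forall x, r x <= Cr * expR (eta * x)) (r_neq0 : exists x, r x != 0).
Hypothesis l10 : 0 < l1.
Hypothesis psi_growth : forall eps : R, 0 < eps -> eps <= l1 ->
  exists C, forall x, psi x <= C * expR (- eps * x).
Implicit Types (x y z : R).

Let k0' : 0 <= k := ltW k0.
Let s := S (fun _ => 1).
Let s0 : 0 < s. Proof. exact: lt_le_trans (functional1_ge k0 HS). Qed.
Let Cr0 : 0 <= Cr.
Proof. by rewrite -(pmulr_lge0 _ (expR_gt0 (eta * 0))); exact: le_trans (r_ge0 0) (r_le 0). Qed.
Let cpsi : continuous psi.
Proof. by move=> x; exact: has_deriv_continuous (psid x). Qed.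

(** [psi], [Th] and [Th2] receive the growth exponents [b], [2 b] and [3 b], all below [k]: every
    integration brings a factor [|x|], paid for by one more [b]. *)
Let b : R := k / 4.
Let b0 : 0 < b. Proof. by rewrite divr_gt0. Qed.
Let b0' : 0 <= b := ltW b0.
Let bk a : a <= 4 -> a * b <= k.
Proof. by move=> a4; rewrite /b mulrCA -[leRHS]mulr1 ler_wpM2l // ler_pdivrMr // mul1r. Qed.
Let bk1 : b <= k. Proof. by rewrite -[b]mul1r bk // ler1n. Qed.

(** A single positive exponent serves both ends: it gives decay as [z -> +oo] and limits the growth
    as [z -> -oo]. *)
Lemma psi_left_bound : exists2 C, 0 <= C & forall z x,
  psi (z + x) <= C * expR (- Num.min l1 b * z) * expabs b x.
Proof.
set e := Num.min l1 b.
have e0 : 0 < e by rewrite lt_min l10.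
have el : e <= l1 by rewrite ge_min lexx.
have eb : e <= b by rewrite ge_min lexx orbT.
have [C psiC] := psi_growth e0 el.
have C0 : 0 <= C.
  by rewrite -(pmulr_lge0 _ (expR_gt0 (- e * 0))); exact: le_trans (ltW (psi0 0)) (psiC 0).
exists C => // z x; rewrite (le_trans (psiC _)) // mulrDr expRD mulrA.
rewrite ler_wpM2l ?mulr_ge0 ?expR_ge0 // (expR_le_expabs _ _) //.
by rewrite normrN ger0_norm // ltW.
Qed.

Lemma psi_exp_growth : exp_growth b psi.
Proof.
have [C C0 psiC] := psi_left_bound; split=> //; exists C => x.
rewrite ger0_norm ?(ltW (psi0 _)) //; have := psiC 0 x.
by rewrite mulr0 expR0 mulr1 add0r.
Qed.

Lemma primitive_exp_growth a a' u U : 0 <= a -> a < a' -> exp_growth a u ->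
  (forall x, has_deriv U x (u x)) -> exp_growth a' U.
Proof.
move=> a0 aa' gu Ud; have [C C0 uC] := exp_growthW gu; split.
  by move=> x; exact: has_deriv_continuous (Ud x).
have ba : 0 < a' - a by rewrite subr_gt0.
exists ((a' - a)^-1 * C + `|U 0|) => x.
have h : `|U (0 + x) - U 0| <= `|x| * (C * expabs a x).
  apply: (MVT_norm_le Ud) => y yx; rewrite add0r (le_trans (uC _)) //.
  by rewrite ler_wpM2l // ler_expabs_norm.
rewrite add0r in h; rewrite -(subrK (U 0) (U x)) (le_trans (ler_normD _ _)) //.
rewrite mulrDl lerD //; last by rewrite ler_peMr // expabs_ge1 //; exact: le_trans (ltW aa').
rewrite (le_trans h) //.
have -> : (a' - a)^-1 * C * expabs a' x = ((a' - a)^-1 * expabs (a' - a) x) * (C * expabs a x).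
  by rewrite mulrACA expabsM subrK.
by rewrite ler_wpM2r ?norm_le_expabs // mulr_ge0 // expabs_ge0.
Qed.

Variables (Th Th2 : R -> R).
Hypotheses (Thd : forall x, has_deriv Th x (psi x)) (Th2d : forall x, has_deriv Th2 x (Th x)).

Let gpsi : exp_growth k psi. Proof. exact: exp_growthS psi_exp_growth. Qed.
Let gTh : exp_growth k Th.
Proof.
apply: (@exp_growthS R (2 * b)); first by rewrite bk // ler_nat.
by apply: primitive_exp_growth psi_exp_growth Thd => //; rewrite mulr2n mulrDl mul1r ltrDl.
Qed.
Let gTh2 : exp_growth k Th2.
Proof.
apply: (@exp_growthS R (3 * b)); first by rewrite bk // ler_nat.
apply: (@primitive_exp_growth (2 * b) (3 * b) Th) => //.
- by rewrite mulr_ge0.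
- by rewrite ltr_pM2r // ltr_nat.
by apply: primitive_exp_growth psi_exp_growth Thd => //; rewrite mulr2n mulrDl mul1r ltrDl.
Qed.
Let gx : exp_growth k (fun x : R => x). Proof. exact: exp_growth_id. Qed.
Let gx2 : exp_growth k (fun x : R => x ^+ 2).
Proof.
have h : exp_growth (k / 2) (fun x : R => x) by apply: exp_growth_id; rewrite divr_gt0.
by rewrite [k]splitr; exact: (exp_growthM h h).
Qed.

(* First integrals of the linearized equation: on a constant [psi = A] the first one is
   [A (c - S id)]; if [S id = c], the second one is [- A / 2 * S (x ^ 2)]. *)
Definition energy x : R := c * psi x + jump S Th x.
Definition energy2 x : R := S (fun y => y) * Th x + jump S Th2 x.

Lemma energy_deriv x : has_deriv energy x (- r x).
Proof.
rewrite (_ : - r x = c * dpsi x + jump S psi x); last by rewrite psi_eq /jump; ring.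
by apply: has_deriv_add; [exact: has_deriv_scale | exact: (jump_deriv k0 HS)].
Qed.

Lemma energy2_deriv x : S (fun y => y) = c -> has_deriv energy2 x (energy x).
Proof.
move=> m1; rewrite /energy /energy2 m1.
by apply: has_deriv_add; [exact: has_deriv_scale | exact: (jump_deriv k0 HS)].
Qed.

Lemma energy_noninc x y : x <= y -> energy y <= energy x.
Proof.
by move=> xy; apply: (derive_le0_ge energy_deriv (z := y)) => // t _; rewrite oppr_le0.
Qed.

Lemma Th_diff_le : exists2 C, 0 <= C & forall z x,
  `|Th (z + x) - Th z| <= C * expR (- Num.min l1 b * z) * expabs (2 * b) x.
Proof.
have [C C0 psiC] := psi_left_bound; exists (b^-1 * C) => [|z x].
  by rewrite mulr_ge0 // invr_ge0.
set ez := expR _.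
have ez0 : 0 <= ez by exact: expR_ge0.
have h : `|Th (z + x) - Th z| <= `|x| * (C * ez * expabs b x).
  apply: (MVT_norm_le Thd) => y yx; rewrite ger0_norm ?(ltW (psi0 _)) //.
  rewrite (le_trans (psiC _ _)) // ler_wpM2l ?mulr_ge0 //.
  by rewrite ler_expabs_norm.
rewrite (le_trans h) //.
have -> : b^-1 * C * ez * expabs (2 * b) x = (b^-1 * expabs b x) * (C * ez * expabs b x).
  by rewrite mulr2n mulrDl mul1r -expabsM; ring.
by rewrite ler_wpM2r ?norm_le_expabs // !mulr_ge0 // expabs_ge0.
Qed.

Lemma energy_cvg0 : energy n%:R @[n --> \oo] --> 0.
Proof.
have [C C0 ThC] := Th_diff_le; have [C' C'0 psiC] := psi_left_bound.
set e := Num.min l1 b in ThC psiC.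
have e0 : 0 < e by rewrite lt_min l10.
have en0 : expR (- e * n%:R) @[n --> \oo] --> 0.
  (* From [exp t >= 1 + t] at [t = e (n + 1)]. *)
  apply: (@squeeze_cvgr _ _ _ _ (fun _ => 0) (fun n => (e * n.+1%:R)^-1 * expR e)).
  - apply: nearW => n; rewrite expR_ge0 /=.
    have -> : - e * n%:R = - (e * n.+1%:R) + e by rewrite -natr1; ring.
    rewrite expRD ler_wpM2r ?expR_ge0 // expRN lef_pV2 ?posrE ?expR_gt0 ?mulr_gt0 //.
    by rewrite (le_trans _ (expR_ge1Dx _)) // lerDr.
  - exact: cvg_cst.
  - rewrite -[0](mul0r (expR e)); apply: cvgM; last exact: cvg_cst.
    under eq_fun do rewrite invfM.
    rewrite -[0](mulr0 e^-1); apply: cvgM; first exact: cvg_cst.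
    exact: cvg_harmonic.
rewrite (_ : 0 = c * 0 + 0); last by ring.
apply: cvgD.
  apply: cvgM; first exact: cvg_cst.
  apply: (@squeeze_cvgr _ _ _ _ (fun _ => 0) (fun n => C' * expR (- e * n%:R))).
  - apply: nearW => n; rewrite (ltW (psi0 _)) /=.
    by have := psiC n%:R 0; rewrite addr0 expabs0 mulr1.
  - exact: cvg_cst.
  - by rewrite -[0](mulr0 C'); apply: cvgM; [exact: cvg_cst | exact: en0].
under eq_fun do rewrite (jumpE k0 HS) //.
rewrite -(functional0 k0 HS).
apply: (ef_dct HS (C := C)).
- move=> n x; apply: cvgB; first exact: cvg_cst.
  by apply: continuous_shift; case: gTh.
- move=> n x; rewrite distrC (le_trans (ThC _ _)) // -mulrA ler_wpM2l //.
  rewrite -[leRHS]mul1r ler_pM ?expR_ge0 ?expabs_ge0 //.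
    by rewrite -expR0 ler_expR mulNr oppr_le0 mulr_ge0 // ltW.
  by rewrite ler_expabs // bk // ler_nat.
- exact: exp_growth_cst.
- move=> x; apply/norm_cvg0P.
  apply: (@squeeze_cvgr _ _ _ _ (fun _ => 0) (fun n => C * expR (- e * n%:R) * expabs (2 * b) x)).
  + by apply: nearW => n; rewrite normr_ge0 /= distrC ThC.
  + exact: cvg_cst.
  + rewrite -[0](mul0r (expabs (2 * b) x)); apply: cvgM; last exact: cvg_cst.
    by rewrite -[0](mulr0 C); apply: cvgM; [exact: cvg_cst | exact: en0].
Qed.

Lemma energy_ge0 x : 0 <= energy x.
Proof.
rewrite -(cvg_lim _ energy_cvg0) //.
apply: limr_le; first by apply/cvg_ex; exists 0; exact: energy_cvg0.
have /cvgryPge/(_ x) := @cvgr_idn R.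
by apply: filterS => n nx; exact: energy_noninc.
Qed.

(** [energy + Cr / eta * exp (eta x)] has derivative [Cr * exp (eta x) - r >= 0], which bounds
    [energy] from above at -oo; by monotonicity its supremum is the limit. A zero supremum would
    make [energy], hence its derivative [- r], vanish identically. *)
Lemma energy_limit : exists2 l : R, 0 < l & energy x @[x --> -oo] --> l.
Proof.
pose A := range energy.
have up x : x <= 0 -> energy x <= energy 0 + Cr / eta.
  move=> x0.
  have h : energy x + Cr / eta * expR (eta * x) <= energy 0 + Cr / eta * expR (eta * 0).
    apply: (@derive_ge0_le R (fun x => energy x + Cr / eta * expR (eta * x))
      (fun x => - r x + Cr / eta * (eta * expR (eta * x))) 0) => //.
      move=> t; apply: has_deriv_add; first exact: energy_deriv.
      by apply: has_deriv_scale; exact: has_deriv_expR_lin.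
    move=> t _; have -> : Cr / eta * (eta * expR (eta * t)) = Cr * expR (eta * t).
      by field; rewrite gt_eqF.
    by rewrite addrC subr_ge0.
  move: h; rewrite mulr0 expR0 mulr1; apply: le_trans.
  by rewrite lerDl mulr_ge0 ?expR_ge0 // divr_ge0 // ltW.
have hA : has_sup A.
  split; first by exists (energy 0), 0.
  exists (energy 0 + Cr / eta) => _ [x _ <-].
  have [x0|x0] := leP x 0; first exact: up.
  by rewrite (le_trans (energy_noninc (ltW x0))) // lerDl divr_ge0 // ltW.
have A_ub x : energy x <= sup A by apply: ub_le_sup; [case: hA | exists x].
exists (sup A).
  rewrite lt_neqAle (le_trans (energy_ge0 0) (A_ub 0)) andbT eq_sym; apply/negP => /eqP E.
  have [x0 /eqP] := r_neq0; apply.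
  have I0 x : energy x = 0.
    by apply/eqP; rewrite eq_le energy_ge0 andbT -E A_ub.
  have [_ E'] := energy_deriv x0; apply: oppr_inj; rewrite -E' oppr0.
  rewrite (_ : energy = cst 0); first exact: derive_cst.
  exact/funext.
apply/cvgNyP => e e0; have [_ [z _ <-] zE] := sup_adherent e0 hA.
exists z => y yz; have := energy_noninc yz; have := A_ub y.
by rewrite ler_norml; lra.
Qed.

(* [psi], seen from [xi n] and rescaled by [P n], is close to [A] at the origin and lies on
   one side of [A] up to an error vanishing with [n]: below it if [sg = 1], above it if [sg = -1]. *)
Definition key_seq (xi P : nat -> R) (A : R) : Prop :=
  [/\ xi n @[n --> \oo] --> -oo, forall n, 1 <= P n &
   exists (sg : R) (eps : nat -> R) (C : R), [/\ sg = 1 \/ sg = -1, eps n @[n --> \oo] --> 0,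
    forall n x, - (eps n * expabs b x) <= sg * (A - psi (xi n + x) / P n),
    forall n x, psi (xi n + x) / P n <= C * expabs b x &
    forall n, `|A - psi (xi n) / P n| <= eps n]].

Section KeySequence.
Variables (xi P : nat -> R) (A : R).
Hypothesis key : key_seq xi P A.

Let w n x := psi (xi n + x) / P n.
Let P0 n : 0 < P n. Proof. by case: key => _ P1 _; exact: lt_le_trans (P1 n). Qed.

(** [flatness] applies to [sg (A - w n)], the sign reducing near-minima to near-maxima. Its defect
    is [sg * r (xi n + x) / P n]; as [P n >= 1], this is at most [Cr * exp (eta * xi n)] times an
    admissible weight, and the prefactor vanishes as [xi n -> -oo]. *)
Lemma key_seq_flat : exists2 eps : nat -> R, eps n @[n --> \oo] --> 0 &
  forall X, exists2 B, 0 <= B & forall n x, `|x| <= X -> `|w n x - A| <= B * eps n.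
Proof.
have [xiN P1 [sg [eps [C [sgE eps_to0 lb _ at0]]]]] := key.
pose e n := eps n + Cr * expR (eta * xi n).
have eps0 n : 0 <= eps n by exact: le_trans (at0 n).
have sg1 : `|sg| = 1 by case: sgE => ->; rewrite ?normrN normr1.
exists e.
  rewrite -[0]addr0; apply: cvgD => //.
  rewrite -[0](mulr0 Cr); apply: cvgM; first exact: cvg_cst.
  apply: (@cvg_seqNy R xi (fun x => expR (eta * x))) => //.
  apply/cvgNyP => e' e'0; exists (ln e' / eta) => y.
  rewrite ler_pdivlMr // mulrC => h; rewrite subr0 ger0_norm ?expR_ge0 //.
  by rewrite -[leRHS]lnK ?posrE // ler_expR.
move=> X; have [B B0 HB] := flatness k0 delta0 HS c0 X.
exists B => // n x xX.
pose v x := sg * (A - w n x).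
pose dv x := sg * (0 - dpsi (xi n + x) / P n).
have e_ge n' : eps n' <= e n' by rewrite lerDl mulr_ge0 // expR_ge0.
have gw : exp_growth k (w n).
  rewrite (_ : w n = fun x => (P n)^-1 * psi (xi n + x)).
    by apply: exp_growthZ => //; exact: exp_growth_shift.
  by apply/funext => y; rewrite mulrC.
have gAw : exp_growth k (fun x => A - w n x).
  by apply: exp_growthB => //; exact: exp_growth_cst.
have H : almost_solution k c S (e n) v dv.
  split.
  - exact: exp_growthZ.
  - move=> y; have d1 := has_deriv_scale (P n)^-1 (has_deriv_shift (psid (xi n + y))).
    have d2 : has_deriv (w n) y (dpsi (xi n + y) / P n).
      rewrite mulrC (_ : w n = fun x => (P n)^-1 * psi (xi n + x)) //.
      by apply/funext => t; rewrite mulrC.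
    exact: (has_deriv_scale sg (has_deriv_sub (has_deriv_const A y) d2)).
  - move=> y.
    have -> : defect c S v dv y = sg * (r (xi n + y) / P n).
      rewrite /defect /v (functionalZ k0 HS); last exact: (exp_growth_shift y k0' gAw).
      rewrite (functionalB HS); last 2 first.
      + exact: exp_growth_cst.
      + exact: (exp_growth_shift y k0' gw).
      rewrite (functional_cst k0 HS).
      have -> : S (fun y0 => w n (y + y0)) = S (fun z => psi (xi n + y + z)) / P n.
        rewrite mulrC -(functionalZ k0 HS); last exact: (exp_growth_shift _ k0' gpsi).
        by congr S; apply/funext => z; rewrite /w addrA mulrC.
      have E := psi_eq (xi n + y).
      rewrite (_ : r _ = S (fun z => psi (xi n + y + z)) - s * psi (xi n + y) - c * dpsi (xi n + y)).
        by rewrite /dv /w -/s; ring.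
      by rewrite E -/s; ring.
    rewrite normrM sg1 mul1r ger0_norm ?divr_ge0 ?(ltW (P0 n)) //.
    rewrite ler_pdivrMr // (le_trans (r_le _)) //.
    rewrite mulrDr expRD mulrA.
    apply: (@le_trans _ _ (e n * expabs k y)).
      apply: ler_pM; rewrite ?mulr_ge0 ?expR_ge0 //.
        by rewrite lerDr.
      by rewrite expR_le_expabs // ger0_norm // ltW.
    rewrite ler_peMr // ?P1 // mulr_ge0 ?expabs_ge0 //.
    exact: le_trans (e_ge n).
have vlb y : - (e n * expabs k y) <= v y.
  rewrite (le_trans _ (lb n y)) // lerN2 ler_pM ?expabs_ge0 //.
  exact: ler_expabs.
have v0 : v 0 <= e n.
  rewrite (le_trans (ler_norm _)) // normrM sg1 mul1r /w addr0.
  exact: le_trans (at0 n) (e_ge n).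
have := HB _ _ _ H vlb v0 x xX.
by rewrite /v normrM sg1 mul1r distrC.
Qed.

Lemma key_seq_cvg x : w n x @[n --> \oo] --> A.
Proof.
have [eps eps0 h] := key_seq_flat; have [B B0 hB] := h `|x|.
apply/subr_cvg0/norm_cvg0P.
apply: (@squeeze_cvgr _ _ _ _ (fun _ => 0) (fun n => B * eps n)).
- by apply: nearW => n; rewrite normr_ge0 /= hB.
- exact: cvg_cst.
- by rewrite -[0](mulr0 B); apply: cvgM; [exact: cvg_cst | exact: eps0].
Qed.

Let key_bound : exists2 C, 0 <= C & forall n x, `|w n x| <= C * expabs b x.
Proof.
have [_ _ [sg [eps [C [_ _ _ ub _]]]]] := key; exists C.
  have := ub 0%N 0; rewrite expabs0 mulr1; apply: le_trans.
  by rewrite divr_ge0 ?(ltW (psi0 _)) ?(ltW (P0 _)).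
move=> n x; rewrite /w ger0_norm; first exact: ub.
by rewrite divr_ge0 ?(ltW (psi0 _)) ?(ltW (P0 _)).
Qed.

(** The iterated primitives of [w n] that vanish at 0. Locally uniform convergence of [w n] to [A]
    integrates to [A x] and [A x^2 / 2], and the growth bounds are uniform in [n], so [S] passes to
    the limit. *)
Let wTh n x := (Th (xi n + x) - Th (xi n)) / P n.
Let wTh2 n x := (Th2 (xi n + x) - Th2 (xi n) - x * Th (xi n)) / P n.

Let wTh_deriv n x : has_deriv (wTh n) x (w n x).
Proof.
have := has_deriv_scale (P n)^-1 (has_deriv_sub (has_deriv_shift (Thd (xi n + x))) (has_deriv_const (Th (xi n)) x)).
rewrite subr0 mulrC (_ : (fun y => _) = wTh n) //.
by apply/funext => t; rewrite mulrC.
Qed.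

Let wTh2_deriv n x : has_deriv (wTh2 n) x (wTh n x).
Proof.
have := has_deriv_scale (P n)^-1 (has_deriv_sub (has_deriv_sub (has_deriv_shift (Th2d (xi n + x)))
  (has_deriv_const (Th2 (xi n)) x)) (has_deriv_mul (has_deriv_var x) (has_deriv_const (Th (xi n)) x))).
rewrite (_ : (fun y => _) = wTh2 n); last by apply/funext => t; rewrite mulrC.
by rewrite subr0 mul1r mulr0 addr0 mulrC.
Qed.

Let wTh_0 n : wTh n 0 = 0. Proof. by rewrite /wTh addr0 subrr mul0r. Qed.
Let wTh2_0 n : wTh2 n 0 = 0. Proof. by rewrite /wTh2 addr0 subrr mul0r subrr mul0r. Qed.

Let key_Th : exists2 eps : nat -> R, eps n @[n --> \oo] --> 0 &
  forall X, exists2 B, 0 <= B & forall n x, `|x| <= X ->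
   `|wTh n x - A * x| <= B * eps n /\ `|wTh2 n x - A * (x ^+ 2 / 2)| <= B * eps n.
Proof.
have [eps eps0 h] := key_seq_flat; exists eps => // X.
have [B B0 hB] := h X; exists (`|X| * B + `|X| * (`|X| * B)).
  by rewrite addr_ge0 // !mulr_ge0.
have h1 n x : `|x| <= X -> `|wTh n x - A * x| <= `|X| * (B * eps n).
  move=> xX.
  have d t : has_deriv (fun x => wTh n x - A * x) t (w n t - A).
    rewrite -[A in _ - A]mulr1; apply: has_deriv_sub; first exact: wTh_deriv.
    by apply: has_deriv_scale; exact: has_deriv_var.
  have := @MVT_norm_le R _ _ 0 x (B * eps n) d; rewrite add0r wTh_0 mulr0 !subr0 => H.
  have Be0 : 0 <= B * eps n by exact: le_trans (hB n x xX).
  rewrite (le_trans (H _)) //.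
    by move=> y yx; rewrite add0r hB // (le_trans yx).
  by rewrite ler_wpM2r // (le_trans xX) // ler_norm.
move=> n x xX; have XB0 : 0 <= B * eps n by exact: le_trans (hB n x xX).
split.
  rewrite (le_trans (h1 _ _ xX)) // mulrDl -mulrA lerDl.
  by rewrite -!mulrA mulr_ge0 // mulr_ge0.
have d t : has_deriv (fun x => wTh2 n x - A * (x ^+ 2 / 2)) t (wTh n t - A * t).
  apply: has_deriv_sub; first exact: wTh2_deriv.
  apply: has_deriv_scale.
  have := has_deriv_scale 2^-1 (has_deriv_mul (has_deriv_var t) (has_deriv_var t)).
  rewrite (_ : (fun y => _) = (fun x => x ^+ 2 / 2)); last by apply/funext => y; rewrite mulrC.
  by rewrite mulr1 mul1r (_ : 2^-1 * (t + t) = t) //; field.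
have := @MVT_norm_le R _ _ 0 x (`|X| * (B * eps n)) d.
rewrite add0r wTh2_0 expr0n /= mul0r mulr0 !subr0 => H.
rewrite (le_trans (H _)) //.
  by move=> y yx; rewrite add0r h1 // (le_trans yx).
rewrite mulrDl -!mulrA -[leLHS]add0r lerD //; first by rewrite mulr_ge0.
rewrite ler_wpM2r //; first by rewrite mulr_ge0.
by rewrite (le_trans xX) // ler_norm.
Qed.

Let wTh_bound : exists2 C, 0 <= C & forall n x,
  `|wTh n x| <= C * expabs k x /\ `|wTh2 n x| <= C * expabs k x.
Proof.
have [C C0 wC] := key_bound.
have h1 n x : `|wTh n x| <= b^-1 * C * expabs (2 * b) x.
  have := @MVT_norm_le R _ _ 0 x (C * expabs b x) (wTh_deriv n).
  rewrite add0r wTh_0 subr0 => H; rewrite (le_trans (H _)) //.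
    by move=> y yx; rewrite add0r (le_trans (wC _ _)) // ler_wpM2l // ler_expabs_norm.
  have -> : b^-1 * C * expabs (2 * b) x = (b^-1 * expabs b x) * (C * expabs b x).
    by rewrite mulr2n mulrDl mul1r -expabsM; ring.
  by rewrite ler_wpM2r ?norm_le_expabs // mulr_ge0 // expabs_ge0.
have C'0 : 0 <= b^-1 * C by rewrite mulr_ge0 // invr_ge0.
have h2 n x : `|wTh2 n x| <= b^-1 * (b^-1 * C) * expabs (3 * b) x.
  have := @MVT_norm_le R _ _ 0 x (b^-1 * C * expabs (2 * b) x) (wTh2_deriv n).
  rewrite add0r wTh2_0 subr0 => H; rewrite (le_trans (H _)) //.
    move=> y yx; rewrite add0r (le_trans (h1 _ _)) // ler_wpM2l // ler_expabs_norm //.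
    by rewrite mulr_ge0.
  have -> : b^-1 * (b^-1 * C) * expabs (3 * b) x = (b^-1 * expabs b x) * (b^-1 * C * expabs (2 * b) x).
    by rewrite (_ : 3 * b = b + 2 * b) -?expabsM; ring.
  by rewrite ler_wpM2r ?norm_le_expabs // mulr_ge0 // expabs_ge0.
exists (b^-1 * C + b^-1 * (b^-1 * C)); first by rewrite addr_ge0 // mulr_ge0 // invr_ge0.
move=> n x; have D0 : 0 <= b^-1 * (b^-1 * C) by rewrite mulr_ge0 // invr_ge0.
split.
  rewrite (le_trans (h1 _ _)) // ler_pM ?expabs_ge0 ?lerDl //.
  by rewrite ler_expabs // bk // ler_nat.
rewrite (le_trans (h2 _ _)) // ler_pM ?expabs_ge0 ?lerDr //.
by rewrite ler_expabs // bk // ler_nat.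
Qed.

Let cTh : continuous Th. Proof. by case: gTh. Qed.

(** [jump] ignores constants, so [jump S Th (xi n) = - P n * S (wTh n)]. *)
Lemma key_seq_energy : energy (xi n) / P n @[n --> \oo] --> A * (c - S (fun x => x)).
Proof.
have [eps eps0 h] := key_Th; have [C C0 hC] := wTh_bound.
have -> : A * (c - S (fun x => x)) = c * A - S (fun x => A * x).
  by rewrite (functionalZ k0 HS) //; ring.
have E n : energy (xi n) / P n = c * w n 0 - S (wTh n).
  have -> : S (wTh n) = (S (fun x => Th (xi n + x)) - S (fun _ => Th (xi n))) / P n.
    rewrite -(functionalB HS); last 2 first.
    - exact: exp_growth_shift.
    - exact: exp_growth_cst.
    rewrite mulrC -(functionalZ k0 HS).
      by congr S; apply/funext => x; rewrite mulrC.
    by apply: exp_growthB; [exact: exp_growth_shift | exact: exp_growth_cst].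
  by rewrite (functional_cst k0 HS) /energy /jump /w addr0; ring.
under eq_fun do rewrite E.
apply: cvgB; first by apply: cvgM; [exact: cvg_cst | exact: key_seq_cvg].
apply: (ef_dct HS (C := C)).
- by move=> n x; exact: has_deriv_continuous (wTh_deriv n x).
- by move=> n x; case: (hC n x).
- exact: exp_growthZ.
- move=> x; have [B B0 hB] := h `|x|.
  apply/subr_cvg0/norm_cvg0P.
  apply: (@squeeze_cvgr _ _ _ _ (fun _ => 0) (fun n => B * eps n)).
  + by apply: nearW => n; rewrite normr_ge0 /=; case: (hB n x (lexx _)).
  + exact: cvg_cst.
  + by rewrite -[0](mulr0 B); apply: cvgM; [exact: cvg_cst | exact: eps0].
Qed.

(** The term [S id * Th] of [energy2] is exactly what [S] makes of the linear part subtracted in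
    [wTh2], whence [- energy2 (xi n) / P n = S (wTh2 n)]. *)
Lemma key_seq_energy2 :
  - energy2 (xi n) / P n @[n --> \oo] --> A * (S (fun x => x ^+ 2) / 2).
Proof.
have [eps eps0 h] := key_Th; have [C C0 hC] := wTh_bound.
have g2 : exp_growth k (fun x : R => x ^+ 2 / 2).
  rewrite (_ : (fun x => _) = (fun x => 2^-1 * x ^+ 2)); first exact: exp_growthZ.
  by apply/funext => x; rewrite mulrC.
have -> : A * (S (fun x => x ^+ 2) / 2) = S (fun x => A * (x ^+ 2 / 2)).
  have -> : S (fun x => A * (x ^+ 2 / 2)) = S (fun x => A / 2 * x ^+ 2).
    by congr S; apply/funext => x; ring.
  by rewrite (functionalZ k0 HS) //; ring.
have E n : - energy2 (xi n) / P n = S (wTh2 n).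
  have gxT : exp_growth k (fun x => Th (xi n) * x) by exact: exp_growthZ.
  have gd : exp_growth k (fun x => Th2 (xi n + x) - Th2 (xi n)).
    by apply: exp_growthB; [exact: exp_growth_shift | exact: exp_growth_cst].
  have -> : S (wTh2 n) = (S (fun x => Th2 (xi n + x)) - S (fun _ => Th2 (xi n)) - Th (xi n) * S (fun x => x)) / P n.
    rewrite -(functionalB HS); last 2 first.
    - exact: exp_growth_shift.
    - exact: exp_growth_cst.
    rewrite -(functionalZ k0 HS) // -(functionalB HS) //.
    rewrite mulrC -(functionalZ k0 HS).
      by congr S; apply/funext => x; rewrite /wTh2; ring.
    exact: exp_growthB.
  by rewrite (functional_cst k0 HS) /energy2 /jump; ring.
under eq_fun do rewrite E.
apply: (ef_dct HS (C := C)).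
- by move=> n x; exact: has_deriv_continuous (wTh2_deriv n x).
- by move=> n x; case: (hC n x).
- exact: exp_growthZ.
- move=> x; have [B B0 hB] := h `|x|.
  apply/subr_cvg0/norm_cvg0P.
  apply: (@squeeze_cvgr _ _ _ _ (fun _ => 0) (fun n => B * eps n)).
  + by apply: nearW => n; rewrite normr_ge0 /=; case: (hB n x (lexx _)).
  + exact: cvg_cst.
  + by rewrite -[0](mulr0 B); apply: cvgM; [exact: cvg_cst | exact: eps0].
Qed.

End KeySequence.

End SharpAsymptotics.

(* [p] is 1 for a simple root of the characteristic function and [T + |x|] for a double
   one; [F] is the corresponding first integral. *)
Section WeightedLimit.
Variable R : realType.
Variables (k l1 mu Finf : R) (psi p theta F : R -> R).
Hypotheses (k0 : 0 < k) (l10 : 0 < l1) (mu0 : 0 < mu) (Finf0 : 0 < Finf).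
Hypotheses (psi0 : forall x, 0 < psi x).
Hypothesis psi_growth : forall eps : R, 0 < eps -> eps <= l1 ->
  exists C, forall x, psi x <= C * expR (- eps * x).
Hypotheses (p_ge1 : forall x, 1 <= p x) (theta_ge0 : forall x, 0 <= theta x)
  (theta_le : forall x, theta x <= k / 16) (theta_to0 : theta x @[x --> -oo] --> 0)
  (p_slow : forall x y, `|p (x + y) - p x| <= theta x * p x * `|y|).
Hypothesis F_lim : F x / p x @[x --> -oo] --> Finf.
Hypothesis F_key : forall xi P A, key_seq k psi xi P A -> F (xi n) / P n @[n --> \oo] --> A * mu.
Implicit Types (x y z : R).

Let b : R := k / 4.
Let b0 : 0 < b. Proof. by rewrite divr_gt0. Qed.
Let p0 x : 0 < p x. Proof. exact: lt_le_trans (p_ge1 x). Qed.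
Let h (n : nat) : R := n.+1%:R^-1.
Let h0 n : 0 < h n. Proof. by rewrite invr_gt0. Qed.
Let h1 n : h n <= 1. Proof. by rewrite invf_le1 // ler1n. Qed.
Let h_to0 : h n @[n --> \oo] --> 0. Proof. exact: cvg_harmonic. Qed.

Let p_ratio_le x y : p (x + y) <= p x * (1 + theta x * `|y|).
Proof. by have := p_slow x y; rewrite ler_norml => /andP[_]; lra. Qed.

Let p_ratio_ge x y : p x * (1 - theta x * `|y|) <= p (x + y).
Proof. by have := p_slow x y; rewrite ler_norml => /andP[+ _]; lra. Qed.

Let lin_le_expabs a y : 0 <= a -> 1 + a * `|y| <= expabs a y.
Proof. by move=> a0; exact: expR_ge1Dx. Qed.

Let norm_le y : `|y| <= b^-1 * expabs b y.
Proof. exact: norm_le_expabs. Qed.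

Let expabs_sub1 a y : 0 <= a -> a <= b / 2 -> expabs a y - 1 <= 2 * a / b * expabs b y.
Proof.
move=> a0 ab.
have j1 : expabs a y - 1 <= a * `|y| * expabs a y.
  have e0 := expabs_gt0 a y; have := expR_ge1Dx (- (a * `|y|)).
  rewrite expRN -/(expabs a y) => le1.
  have := ler_wpM2r (ltW e0) le1; rewrite mulVf ?gt_eqF //; lra.
have b2 : 0 < b / 2 by rewrite divr_gt0.
have j2 : `|y| * expabs a y <= (b / 2)^-1 * expabs b y.
  have -> : (b / 2)^-1 * expabs b y = ((b / 2)^-1 * expabs (b / 2) y) * expabs (b / 2) y.
    by rewrite -mulrA expabsM -splitr.
  by rewrite ler_pM ?expabs_ge0 ?norm_le_expabs // ler_expabs.
have := ler_wpM2l a0 j2.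
rewrite (_ : a * ((b / 2)^-1 * expabs b y) = 2 * a / b * expabs b y); last by field; rewrite gt_eqF.
lra.
Qed.

(** By [psi_growth] the factor [exp (eps x)] makes the ratio bounded, so near-maxima exist. Keeping
    [eps (1 + |x0|) <= 1 / 2] preserves half of the large ratio at [x0], hence a near-maximum of at
    least [D]. *)
Let near_max : (forall C, exists x, C * p x < psi x) -> forall (n : nat) D, exists eps xi,
  [/\ 0 < eps, eps <= h n, eps <= b / 4 /\ eps <= l1, D <= psi xi * expR (eps * xi) / p xi &
   forall x, psi x * expR (eps * x) / p x <= (1 + h n) * (psi xi * expR (eps * xi) / p xi)].
Proof.
move=> unb n D.
have [x0 x0P] := unb (2 * `|D| + 2).
pose e0 := (1 + `|x0|)^-1 / 2.
have nx0 : 0 < 1 + `|x0| by rewrite ltr_pwDl.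
have e00 : 0 < e0 by rewrite divr_gt0 // invr_gt0.
pose eps := Num.min (Num.min e0 (h n)) (Num.min (b / 4) l1).
have eps0 : 0 < eps by rewrite !lt_min e00 h0 l10 divr_gt0.
have epsl1 : eps <= l1 by rewrite !ge_min lexx !orbT.
have [C psiC] := psi_growth eps0 epsl1.
pose g x := psi x * expR (eps * x) / p x.
have g0 x : 0 < g x by rewrite divr_gt0 // mulr_gt0 // expR_gt0.
have gC x : g x <= C.
  rewrite ler_pdivrMr //.
  have psiC' : psi x * expR (eps * x) <= C.
    have := ler_wpM2r (expR_ge0 (eps * x)) (psiC x).
    by rewrite -mulrA -expRD mulNr addNr expR0 mulr1.
  rewrite (le_trans psiC') // ler_peMr //.
  by rewrite (le_trans _ psiC') // mulr_ge0 ?expR_ge0 // ltW.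
pose A := range g.
have hA : has_sup A by split; [exists (g 0), 0 | exists C => _ [x _ <-]].
have A_ub x : g x <= sup A by apply: ub_le_sup; [case: hA | exists x].
have gx0 : `|D| + 1 <= g x0.
  have e2 : 2^-1 <= expR (eps * x0).
    apply: le_trans (expR_ge1Dx _).
    have : - 2^-1 <= eps * x0.
      have := ler_norm (- x0); rewrite normrN => nx.
      have : eps * (1 + `|x0|) <= 2^-1.
        rewrite -ler_pdivlMr // mulrC -/e0.
        by rewrite !ge_min lexx.
      have : eps * - x0 <= eps * (1 + `|x0|) by rewrite ler_wpM2l ?(ltW eps0) //; lra.
      lra.
    lra.
  rewrite ler_pdivlMr //.
  have : (2 * `|D| + 2) * p x0 * 2^-1 <= psi x0 * expR (eps * x0).
    by rewrite ler_pM ?invr_ge0 ?(ltW x0P) // mulr_ge0 ?(ltW (p0 _)) // addr_ge0 // mulr_ge0.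
  lra.
have sA0 : 0 < sup A by exact: lt_le_trans (g0 0) (A_ub 0).
(* The first entry gives near-maximality up to the factor [1 + h n]; the second loses at most 1 from
   the lower bound [|D| + 1]. *)
pose m := Num.min (sup A * h n / (1 + h n)) 1.
have h1n : 0 < 1 + h n by rewrite addr_gt0.
have m0 : 0 < m by rewrite lt_min ltr01 andbT divr_gt0 // mulr_gt0.
have [_ [xi _ <-] xiP] := sup_adherent m0 hA.
exists eps, xi; split => //.
- by rewrite !ge_min lexx !orbT.
- by rewrite !ge_min !lexx !orbT.
- rewrite -/(g xi); have := A_ub x0; have := ler_norm D.
  have : m <= 1 by rewrite ge_min lexx orbT.
  lra.
- move=> x; rewrite -/(g x) -/(g xi) (le_trans (A_ub x)) //.
  rewrite mulrC -ler_pdivrMr //.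
  apply: le_trans (ltW xiP).
  have m1 : m <= sup A * h n / (1 + h n) by rewrite ge_min lexx.
  have -> : sup A / (1 + h n) = sup A - sup A * h n / (1 + h n).
    by field; rewrite gt_eqF.
  by rewrite lerD2l lerN2.
Qed.

Let cvg_cM (u : nat -> R) a : (u n @[n --> \oo] --> 0) -> (a * u n @[n --> \oo] --> 0).
Proof. by move=> u0; rewrite -[0](mulr0 a); apply: cvgM; [exact: cvg_cst | exact: u0]. Qed.

(** If [psi / p] were unbounded, near-maxima rescaled by [P n = psi (xi n)] would form a key
    sequence with [A = 1], so [F / P] would tend to [mu > 0]. But [F / p] converges while [p / P]
    tends to 0 along the sequence. *)
Lemma psi_le_weight : exists2 C, 0 <= C & forall x, psi x <= C * p x.
Proof.
suff [C hC] : exists C, forall x, psi x <= C * p x.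
  exists C => //; rewrite -(pmulr_lge0 _ (p0 0)).
  exact: le_trans (ltW (psi0 0)) (hC 0).
apply: contrapT => nex.
have unb C : exists x, C * p x < psi x.
  apply: contrapT => nx; apply: nex; exists C => x.
  by rewrite leNgt; apply/negP => lx; apply: nx; exists x.
have [C psiC] := psi_growth l10 (lexx l1).
have C0 : 0 < C.
  by rewrite -(pmulr_lgt0 _ (expR_gt0 (- l1 * 0))); exact: lt_le_trans (psi0 0) (psiC 0).
have /choice[ex exP] : forall n : nat, exists ex : R * R,
  [/\ 0 < ex.1, ex.1 <= h n, ex.1 <= b / 4 /\ ex.1 <= l1,
    n%:R + 1 + C <= psi ex.2 * expR (ex.1 * ex.2) / p ex.2 &
   forall x, psi x * expR (ex.1 * x) / p x <= (1 + h n) * (psi ex.2 * expR (ex.1 * ex.2) / p ex.2)].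
  by move=> n; have [e [xi H]] := near_max unb n (n%:R + 1 + C); exists (e, xi).
pose eps n := (ex n).1; pose xi n := (ex n).2; pose P n := psi (xi n).
have eps0 n : 0 < eps n by case: (exP n).
have epsh n : eps n <= h n by case: (exP n).
have epsb n : eps n <= b / 4 by case: (exP n) => _ _ [].
have epsl n : eps n <= l1 by case: (exP n) => _ _ [].
have gbig n : n%:R + 1 + C <= psi (xi n) * expR (eps n * xi n) / p (xi n) by case: (exP n).
have gmax n x : psi x * expR (eps n * x) / p x <=
   (1 + h n) * (psi (xi n) * expR (eps n * xi n) / p (xi n)) by case: (exP n).
have g_le n : psi (xi n) * expR (eps n * xi n) / p (xi n) <= C * expR ((eps n - l1) * xi n).
  rewrite ler_pdivrMr //; apply: (@le_trans _ _ (C * expR ((eps n - l1) * xi n))).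
    rewrite mulrBl addrC -mulNr expRD mulrA ler_wpM2r ?expR_ge0 //.
  by rewrite ler_peMr // mulr_ge0 ?expR_ge0 // ltW.
(* The tempered ratio is at most [C exp ((eps n - l1) x)], hence bounded on [x >= - X]; a large
   near-maximum must lie further to the left. *)
have xi_bd n X : 0 <= X -> C * expR (l1 * X) < n%:R + 1 + C -> xi n < - X.
  move=> X0 nX; rewrite ltNge; apply/negP => Xxi.
  have : C * expR ((eps n - l1) * xi n) <= C * expR (l1 * X).
    rewrite ler_wpM2l ?(ltW C0) // ler_expR.
    have e1 := epsl n; have e2 := eps0 n.
    have : (l1 - eps n) * (- xi n) <= (l1 - eps n) * X by rewrite ler_wpM2l //; lra.
    have : (l1 - eps n) * X <= l1 * X by rewrite ler_wpM2r //; lra.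
    lra.
  have := g_le n; have := gbig n; lra.
have xi_neg n : xi n < 0.
  by rewrite -oppr0; apply: xi_bd => //; rewrite mulr0 expR0 mulr1 ltr_pwDl // ltr_wpDl.
have xiN : xi n @[n --> \oo] --> -oo.
  apply/cvgrNyPle => X.
  have /cvgryPge/(_ (C * expR (l1 * `|X|))) := @cvgr_idn R.
  apply: filterS => n nX.
  have : xi n < - `|X| by apply: xi_bd => //; have := C0; lra.
  by have := ler_norm (- X); rewrite normrN; lra.
have P_ge n : n%:R + 1 <= P n / p (xi n).
  have e1 : expR (eps n * xi n) <= 1.
    by rewrite -expR0 ler_expR mulr_ge0_le0 // ltW.
  have : psi (xi n) * expR (eps n * xi n) / p (xi n) <= P n / p (xi n).
    by rewrite ler_wpM2r ?invr_ge0 ?(ltW (p0 _)) // ler_piMr // ltW.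
  have := gbig n; have := C0; lra.
have P1 n : 1 <= P n.
  have : 1 <= P n / p (xi n) by apply: le_trans (P_ge n); rewrite lerDr.
  rewrite ler_pdivlMr // mul1r; exact: le_trans.
have P0 n : 0 < P n by exact: lt_le_trans (P1 n).
(* The factor [exp (eps x)] contributes [eps n] to the growth rate and the weight [p] contributes
   [theta]. Each is at most [b / 4 = k / 16], so [expabs_sub1] applies to their sum. *)
pose a n := eps n + theta (xi n).
have a0 n : 0 <= a n by rewrite addr_ge0 // ltW.
have ab n : a n <= b / 2.
  by have := epsb n; have := theta_le (xi n); have := k0; rewrite /a /b; lra.
have w_le n x : psi (xi n + x) / P n <= (1 + h n) * expabs (a n) x.
  have ep := expR_gt0 (eps n * (xi n + x)).
  have G := gmax n (xi n + x).
  rewrite ler_pdivrMr // in G; rewrite ler_pdivrMr //.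
  rewrite -(ler_pM2r ep) (le_trans G) //.
  rewrite -![(1 + h n) * _ * _]mulrA ler_wpM2l ?addr_ge0 ?(ltW (h0 _)) //.
  rewrite -/(P n) mulrDr expRD.
  have -> : P n * expR (eps n * xi n) / p (xi n) * p (xi n + x) =
    (P n * expR (eps n * xi n)) * (p (xi n + x) / p (xi n)) by ring.
  have -> : expabs (a n) x * P n * (expR (eps n * xi n) * expR (eps n * x)) =
    (P n * expR (eps n * xi n)) * (expabs (a n) x * expR (eps n * x)) by ring.
  rewrite ler_wpM2l ?mulr_ge0 ?expR_ge0 ?(ltW (P0 _)) //.
  apply: (@le_trans _ _ (expabs (theta (xi n)) x)).
    rewrite ler_pdivrMr // mulrC (le_trans (p_ratio_le _ _)) //.
    by rewrite ler_wpM2l ?(ltW (p0 _)) // lin_le_expabs.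
  rewrite /a addrC -expabsM -mulrA ler_peMr ?expabs_ge0 //.
  rewrite /expabs -expRD -expR0 ler_expR -mulrDr mulr_ge0 ?(ltW (eps0 _)) //.
  by have := ler_norm (- x); rewrite normrN; lra.
have key : key_seq k psi xi P 1.
  split=> //; exists 1, (fun n => h n + 2 / b * a n), 2; split => //.
  - by left.
  - rewrite -[0]addr0; apply: cvgD => //; apply: cvg_cM.
    rewrite -[0]addr0; apply: cvgD; last exact: (cvg_seqNy xiN theta_to0).
    apply: (@squeeze_cvgr _ _ _ _ (fun _ => 0) h) => //; last exact: cvg_cst.
    by apply: nearW => n; rewrite epsh ltW ?eps0.
  - move=> n x; rewrite mul1r -/b.
    have := w_le n x; have := expabs_sub1 x (a0 n) (ab n).
    rewrite (_ : 2 * a n / b = 2 / b * a n); last by ring.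
    have : h n * expabs (a n) x <= h n * expabs b x.
      rewrite ler_wpM2l ?(ltW (h0 _)) // ler_expabs //.
      by have := ab n; have := b0; lra.
    lra.
  - move=> n x; rewrite (le_trans (w_le n x)) // ler_pM ?expabs_ge0 //.
    + by rewrite addr_ge0 // ltW.
    + by have := h1 n; lra.
    + by rewrite ler_expabs // -/b; have := ab n; have := b0; lra.
  - move=> n; rewrite /P divff ?gt_eqF // subrr normr0 addr_ge0 ?(ltW (h0 _)) //.
    by rewrite mulr_ge0 // divr_ge0 // ltW.
have L1 := F_key key.
have L2 : F (xi n) / P n @[n --> \oo] --> 0.
  rewrite (_ : (fun n => F (xi n) / P n) = (fun n => F (xi n) / p (xi n) * (p (xi n) / P n))); last first.
    by apply/funext => n; field; rewrite !gt_eqF.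
  rewrite -[0](mulr0 Finf); apply: cvgM.
    exact: (@cvg_seqNy R xi (fun x => F x / p x) Finf xiN F_lim).
  apply: (@squeeze_cvgr _ _ _ _ (fun _ => 0) h) => //; last exact: cvg_cst.
  apply: nearW => n; rewrite divr_ge0 ?(ltW (p0 _)) ?(ltW (P0 _)) //=.
  rewrite -[leLHS]invrK invf_div lef_pV2 ?posrE ?divr_gt0 //.
  by rewrite -natr1.
have := cvg_unique _ L1 L2 => /(_ (@norm_hausdorff _ _)).
by rewrite mul1r => E; move: mu0; rewrite E ltxx.
Qed.

Let bounded_limsup (g : R -> R) C : (forall x, `|g x| <= C) -> exists L, forall e, 0 < e ->
  (exists X, forall x, x <= X -> g x <= L + e) /\ (forall X, exists2 x, x <= X & L - e <= g x).
Proof.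
move=> gC; pose B := [set y | exists X, forall x, x <= X -> g x <= y].
have hB : has_inf B.
  split; first by exists C, 0 => x _; rewrite (le_trans (ler_norm _)).
  exists (- C) => y [X Xy]; apply: le_trans (Xy X (lexx _)).
  by have := gC X; rewrite ler_norml => /andP[].
exists (inf B) => e e0; split.
  have [y [X Xy] yB] := inf_adherent e0 hB.
  by exists X => x xX; rewrite (le_trans (Xy x xX)) // ltW.
move=> X; apply: contrapT => nx.
have : B (inf B - e).
  exists X => x xX; rewrite leNgt; apply/negP => lx; apply: nx.
  by exists x => //; exact: ltW.
move=> Be; have : inf B <= inf B - e by apply: ge_inf => //; case: hB.
by have := e0; lra.
Qed.

Let g x := psi x / p x.
Let g0 x : 0 < g x. Proof. by rewrite divr_gt0. Qed.

(** [L] is the limsup of [g] if [sg = 1] and its liminf if [sg = -1]. The points [xi n] almost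
    attain it, and are so far to the left that [sg * g] exceeds it by at most [h n] everywhere up to
    [xi n + n + 1]. With [P n = p (xi n)] they form a key sequence, and [F_key] and [F_lim] compute
    the same limit. *)
Let extremal_limit sg L C : sg = 1 \/ sg = -1 -> 0 <= C -> (forall x, g x <= C) ->
  (forall e, 0 < e ->
    (exists X, forall x, x <= X -> sg * g x <= sg * L + e) /\
    (forall X, exists2 x, x <= X & sg * L - e <= sg * g x)) -> L * mu = Finf.
Proof.
move=> sgE C0 gC HL.
have L0 : 0 <= L.
  rewrite leNgt; apply/negP => Ln.
  have Ln2 : 0 < - L / 2 by rewrite divr_gt0 // oppr_gt0.
  have [[X HX] HX'] := HL _ Ln2.
  case: sgE => sgE; move: HX HX'; rewrite sgE.
    move=> /(_ X (lexx _)) + _; rewrite !mul1r; have := g0 X; lra.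
  move=> _ /(_ 0)[x _]; rewrite !mulN1r; have := g0 x; lra.
have LC : L <= C + 1.
  have [[X HX] HX'] := HL _ (ltr01).
  case: sgE => sgE; move: HX HX'; rewrite sgE.
    by move=> _ /(_ 0)[x _]; rewrite !mul1r; have := gC x; lra.
  move=> /(_ X (lexx _)) + _; rewrite !mulN1r; have := gC X; lra.
have /choice[xi xiP] : forall n : nat, exists xi : R,
    [/\ xi <= - n%:R, sg * L - h n <= sg * g xi &
     forall x, x <= n.+1%:R -> sg * g (xi + x) <= sg * L + h n].
  move=> n; have [[X HX] HX'] := HL _ (h0 n).
  have [x xX gx] := HX' (Num.min (- n%:R) (X - n.+1%:R)).
  move: xX; rewrite le_min => /andP[x1 x2]; exists x; split => //.
  by move=> y yn; apply: HX; lra.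
have xiN : xi n @[n --> \oo] --> -oo.
  apply/cvgrNyPle => X.
  have /cvgryPge/(_ (- X)) := @cvgr_idn R.
  by apply: filterS => n nX; case: (xiP n) => + _ _; lra.
pose P n := p (xi n).
have Pn0 n : 0 < P n by exact: p0.
pose th n := theta (xi n).
have th0 n : 0 <= th n by exact: theta_ge0.
have thb n : th n <= b / 2 by have := theta_le (xi n); have := k0; rewrite /th /b; lra.
have b2 : 0 < b / 2 by rewrite divr_gt0.
have wE n x : psi (xi n + x) / P n = g (xi n + x) * (p (xi n + x) / P n).
  by rewrite /g; field; rewrite !gt_eqF.
have ratio_le n x : p (xi n + x) / P n <= 1 + th n * `|x|.
  by rewrite ler_pdivrMr // mulrC p_ratio_le.
have ratio_ge n x : 1 - th n * `|x| <= p (xi n + x) / P n.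
  by rewrite ler_pdivlMr // mulrC p_ratio_ge.
have ratio0 n x : 0 <= p (xi n + x) / P n by rewrite divr_ge0 // ltW.
have E0 x : 0 <= expabs b x by exact: expabs_ge0.
have E1 x : 1 <= expabs b x by rewrite expabs_ge1 // ltW.
have ratio_exp n x : p (xi n + x) / P n <= expabs (b / 2) x.
  rewrite (le_trans (ratio_le _ _)) // (le_trans (lin_le_expabs _ (th0 n))) //.
  exact: ler_expabs.
have thx n x : th n * `|x| <= th n / b * expabs b x.
  by rewrite -mulrA ler_wpM2l.
(* The multiple of [h n] covers the near-extremality and, beyond [n + 1], the crude bounds by [C];
   the multiple of [th n] covers the variation of the weight. *)
pose eps n := (1 + 2 * (C + 1) / b) * h n + (C + 2) / b * th n.
have eps_ge n : h n <= eps n.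
  have : 0 <= 2 * (C + 1) / b * h n by rewrite mulr_ge0 ?(ltW (h0 _)) // divr_ge0 ?(ltW b0) // mulr_ge0 // addr_ge0.
  have : 0 <= (C + 2) / b * th n by rewrite mulr_ge0 // divr_ge0 ?(ltW b0) // addr_ge0.
  by rewrite /eps; lra.
have sg1 : `|sg| = 1 by case: sgE => ->; rewrite ?normrN normr1.
have key : key_seq k psi xi P L.
  split=> //; first by move=> n; exact: p_ge1.
  exists sg, eps, C; split => //.
  - rewrite -[0]addr0; apply: cvgD; apply: cvg_cM => //.
    exact: (cvg_seqNy xiN theta_to0).
  - move=> n x; rewrite -/b wE.
    have hn0 := ltW (h0 n).
    have tb0 : 0 <= th n / b by rewrite divr_ge0 // ltW.
    have tE := thx n x.
    have hE : h n <= h n * expabs b x by rewrite ler_peMr.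
    have [_ _ +] := xiP n; case: sgE => ->; last first.
      rewrite !mulN1r opprB => small.
      have LtE : L * (th n * `|x|) <= (C + 1) * (th n / b * expabs b x).
        by rewrite ler_pM // mulr_ge0.
      have tbE : 0 <= th n / b * expabs b x by rewrite mulr_ge0.
      have hE0 : 0 <= h n * expabs b x by rewrite mulr_ge0.
      have CtE : 0 <= (C + 1) * (th n / b * expabs b x) by rewrite mulr_ge0 // addr_ge0.
      have Cb0 : 0 <= (C + 1) / b by rewrite divr_ge0 ?(ltW b0) // addr_ge0.
      have epsE : h n * expabs b x + (C + 1) / b * (h n * expabs b x)
           + (C + 1) * (th n / b * expabs b x) <= eps n * expabs b x.
        have : 0 <= (C + 1) / b * (h n * expabs b x) by rewrite mulr_ge0.
        rewrite /eps; lra.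
      have CbhE : 0 <= (C + 1) / b * (h n * expabs b x) by rewrite mulr_ge0.
      have [xn|nx] := leP x n.+1%:R.
        have gx : L - h n <= g (xi n + x) by have := small x xn; rewrite !mulN1r; lra.
        have [t1|t1] := leP 0 (1 - th n * `|x|).
          have : (L - h n) * (1 - th n * `|x|) <= g (xi n + x) * (p (xi n + x) / P n).
            apply: (@le_trans _ _ (g (xi n + x) * (1 - th n * `|x|))).
              by rewrite ler_wpM2r.
            by rewrite ler_wpM2l // ltW.
          have : 0 <= h n * (th n * `|x|) by rewrite !mulr_ge0.
          lra.
        have : 0 <= g (xi n + x) * (p (xi n + x) / P n) by rewrite mulr_ge0 // ltW.
        have : L * (1 - th n * `|x|) <= 0 by rewrite mulr_ge0_le0 // ltW.
        lra.
      (* Beyond [n + 1] no closeness to [L] is known, but there [1 <= h n * |x|], so a bounded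
         quantity is already an error of the form [h n * expabs b x] up to a constant. *)
      have x1 : 1 <= h n * `|x|.
        by rewrite /h ler_pdivlMl ?ltr0n // mulr1 (le_trans (ltW nx)) // ler_norm.
      have : L <= (C + 1) / b * (h n * expabs b x).
        rewrite -mulrA -[leLHS]mulr1 ler_pM // (le_trans x1) // mulrCA ler_wpM2l //.
      have : 0 <= g (xi n + x) * (p (xi n + x) / P n) by rewrite mulr_ge0 // ltW.
      lra.
    rewrite !mul1r => small.
    have tbE : 0 <= th n / b * expabs b x by rewrite mulr_ge0.
    have hE0 : 0 <= h n * expabs b x by rewrite mulr_ge0.
    have [xn|nx] := leP x n.+1%:R.
      have gx : g (xi n + x) <= L + h n by have := small x xn; rewrite !mul1r.
      have : g (xi n + x) * (p (xi n + x) / P n) <= (L + h n) * (1 + th n * `|x|).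
        by rewrite ler_pM // ltW.
      have : (L + h n) * (th n * `|x|) <= (C + 2) * (th n / b * expabs b x).
        rewrite ler_pM ?mulr_ge0 ?addr_ge0 //.
        by have := h1 n; lra.
      have : 0 <= 2 * (C + 1) / b * (h n * expabs b x).
        by rewrite mulr_ge0 // divr_ge0 ?(ltW b0) // mulr_ge0 // addr_ge0.
      rewrite /eps; lra.
    have x1 : 1 <= h n * `|x|.
      by rewrite /h ler_pdivlMl ?ltr0n // mulr1 (le_trans (ltW nx)) // ler_norm.
    have E2 : expabs (b / 2) x <= 2 / b * (h n * expabs b x).
      have E2h : 1 <= h n * ((b / 2)^-1 * expabs (b / 2) x).
        by rewrite (le_trans x1) // ler_wpM2l // norm_le_expabs.
      have -> : expabs b x = expabs (b / 2) x * expabs (b / 2) x by rewrite expabsM -splitr.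
      have := ler_wpM2r (expabs_ge0 (b / 2) x) E2h.
      by rewrite mul1r invf_div; lra.
    have : g (xi n + x) * (p (xi n + x) / P n) <= C * (2 / b * (h n * expabs b x)).
      by rewrite ler_pM ?(ltW (g0 _)) // (le_trans (ratio_exp _ _)).
    have : 0 <= 2 / b * (h n * expabs b x) by rewrite mulr_ge0 // divr_ge0 // ltW.
    have : 0 <= (C + 2) / b * (th n * expabs b x).
      by apply: mulr_ge0; [rewrite divr_ge0 ?(ltW b0) // addr_ge0 | rewrite mulr_ge0].
    rewrite /eps; lra.
  - move=> n x; rewrite wE ler_pM ?(ltW (g0 _)) //.
    rewrite (le_trans (ratio_exp _ _)) // ler_expabs // -/b; have := b0; lra.
  - move=> n; rewrite -/(g (xi n)).
    have [_ lo /(_ 0 (ler0n _ _))] := xiP n; rewrite addr0 => up.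
    rewrite -[leLHS]mul1r -sg1 -normrM (le_trans _ (eps_ge n)) //.
    by rewrite ler_norml; lra.
have L1 := F_key key.
have L2 : F (xi n) / P n @[n --> \oo] --> Finf.
  exact: (@cvg_seqNy R xi (fun x => F x / p x) Finf xiN F_lim).
exact: cvg_unique _ L1 L2.
Qed.

Lemma weighted_limit : psi x / p x @[x --> -oo] --> Finf / mu.
Proof.
have [C C0 psiC] := psi_le_weight.
have gC x : g x <= C by rewrite ler_pdivrMr.
have gC' x : `|g x| <= C by rewrite ger0_norm // ltW.
have [L HL] := bounded_limsup gC'.
have [L' HL'] := bounded_limsup (fun x => (ltac:(by rewrite normrN) : `|- g x| <= C)).
have LE : L * mu = Finf.
  apply: (extremal_limit (or_introl erefl) C0 gC) => e e0.
  have [[X HX] HX'] := HL e e0; rewrite mul1r; split.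
    by exists X => x xX; rewrite mul1r HX.
  by move=> X'; have [x xX gx] := HX' X'; exists x => //; rewrite mul1r.
have L'E : - L' * mu = Finf.
  apply: (extremal_limit (or_intror erefl) C0 gC) => e e0.
  have [[X HX] HX'] := HL' e e0; rewrite mulrNN mul1r; split.
    by exists X => x xX; rewrite mulN1r HX.
  by move=> X'; have [x xX gx] := HX' X'; exists x => //; rewrite mulN1r.
have LF : L = Finf / mu by rewrite -LE mulfK // gt_eqF.
have L'F : - L' = Finf / mu by rewrite -L'E mulfK // gt_eqF.
apply/cvgNyP => e e0.
have [[X HX] _] := HL e e0; have [[X' HX'] _] := HL' e e0.
exists (Num.min X X') => y; rewrite le_min => /andP[yX yX'].
have := HX y yX; have := HX' y yX'; rewrite -/(g y) ler_norml; lra.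
Qed.

Variables (delta c eta Cr : R) (S : (R -> R) -> R) (dpsi r : R -> R).
Hypotheses (HS : exp_functional k delta S) (c0 : 0 < c).
Hypotheses (eta0 : 0 < eta) (r_ge0 : forall x, 0 <= r x) (r_le : forall x, r x <= Cr * expR (eta * x)).
Hypotheses (cpsi : continuous psi) (gpsi : exp_growth k psi).
Hypothesis psi_eq : forall x,
  c * dpsi x = S (fun y => psi (x + y)) - S (fun _ => 1) * psi x - r x.

(** The equation writes [c psi' / p] as [S] of the increments of [psi] divided by [p], minus
    [r / p]. The increments vanish in the limit because [psi / p] converges and [p] varies
    slowly. *)
Lemma log_derivative_limit : dpsi x / psi x @[x --> -oo] --> 0.
Proof.
have [C C0 psiC] := psi_le_weight.
have gC x : g x <= C by rewrite ler_pdivrMr.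
have k0' := ltW k0.
set A := Finf / mu.
have A0 : 0 < A by rewrite divr_gt0.
have gA : g x @[x --> -oo] --> A by exact: weighted_limit.
suff H : dpsi x / p x @[x --> -oo] --> 0.
  rewrite (_ : (fun x => dpsi x / psi x) = (fun x => dpsi x / p x / g x)); last first.
    by apply/funext => x; rewrite /g; field; rewrite !gt_eqF.
  rewrite -[0](mul0r A^-1); apply: cvgM => //.
  by apply: cvgV => //; rewrite gt_eqF.
apply/cvg_ninftyP => t tN.
pose v n x := (psi (t n + x) - psi (t n)) / p (t n).
have gsh n : exp_growth k (fun x => psi (t n + x)) by exact: exp_growth_shift.
have E n : dpsi (t n) / p (t n) = c^-1 * (S (v n) - r (t n) / p (t n)).
  have -> : S (v n) = (S (fun y => psi (t n + y)) - S (fun _ => 1) * psi (t n)) / p (t n).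
    rewrite (mulrC (S _) (psi _)) -(functional_cst k0 HS) -(functionalB HS) //; last exact: exp_growth_cst.
    rewrite mulrC -(functionalZ k0 HS).
      by congr S; apply/funext => x; rewrite mulrC.
    by apply: exp_growthB => //; exact: exp_growth_cst.
  rewrite -mulrBl -psi_eq; field; rewrite !gt_eqF //.
under eq_fun do rewrite E.
apply: cvg_cM; rewrite -[0]subr0; apply: cvgB.
  rewrite -(functional0 k0 HS).
  apply: (ef_dct HS (C := 2 * C)).
  - move=> n x; apply: cvgM; last exact: cvg_cst.
    by apply: cvgB; [exact: continuous_shift | exact: cvg_cst].
  - move=> n x.
    have th1 : 1 + theta (t n) * `|x| <= expabs k x.
      rewrite (le_trans (lin_le_expabs _ (theta_ge0 _))) // ler_expabs //.
      by have := theta_le (t n); have := k0; lra.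
    have e1 : 1 <= expabs k x by rewrite expabs_ge1.
    have a1 : psi (t n) / p (t n) <= C * expabs k x.
      by rewrite (le_trans (gC _)) // ler_peMr.
    have a2 : psi (t n + x) / p (t n) <= C * expabs k x.
      rewrite ler_pdivrMr // (le_trans (psiC _)) // -mulrA ler_wpM2l //.
      rewrite (le_trans (p_ratio_le _ _)) // mulrC ler_wpM2r //.
      exact: ltW.
    have a3 : 0 <= psi (t n) / p (t n) by exact: ltW (g0 _).
    have a4 : 0 <= psi (t n + x) / p (t n) by rewrite divr_ge0 // ltW.
    by rewrite /v mulrBl ler_norml; lra.
  - exact: exp_growth_cst.
  - move=> x.
    have -> : (fun n => v n x) = (fun n => g (t n + x) * (p (t n + x) / p (t n)) - g (t n)).
      by apply/funext => n; rewrite /v /g; field; rewrite !gt_eqF.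
    rewrite (_ : 0 = A * 1 - A); last by rewrite mulr1 subrr.
    apply: cvgB; last exact: (cvg_seqNy tN gA).
    apply: cvgM; first exact: (@cvg_seqNy R (fun n => t n + x) g A (cvgNy_shift_seq x tN) gA).
    apply/subr_cvg0/norm_cvg0P.
    apply: (@squeeze_cvgr _ _ _ _ (fun _ => 0) (fun n => `|x| * theta (t n))).
    + apply: nearW => n; rewrite normr_ge0 /=.
      have -> : p (t n + x) / p (t n) - 1 = (p (t n + x) - p (t n)) / p (t n).
        by field; rewrite gt_eqF.
      rewrite normrM normfV (ger0_norm (ltW (p0 _))) ler_pdivrMr //.
      by rewrite (le_trans (p_slow _ _)) //; lra.
    + exact: cvg_cst.
    + by apply: cvg_cM; exact: (cvg_seqNy tN theta_to0).
apply: (@squeeze_cvgr _ _ _ _ (fun _ => 0) (fun n => Cr * expR (eta * t n))).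
- apply: nearW => n; rewrite divr_ge0 ?(ltW (p0 _)) //=.
  rewrite ler_pdivrMr // (le_trans (r_le _)) // ler_peMr //.
  exact: le_trans (r_ge0 _) (r_le _).
- exact: cvg_cst.
- apply: cvg_cM; apply: (@cvg_seqNy R t (fun x => expR (eta * x))) => //.
  apply/cvgNyP => e' e'0; exists (ln e' / eta) => y.
  rewrite ler_pdivlMr // mulrC => hy; rewrite subr0 ger0_norm ?expR_ge0 //.
  by rewrite -[leRHS]lnK ?posrE // ler_expR.
Qed.

End WeightedLimit.

Section LinearAverage.
Variable R : realType.
Implicit Types (x y z : R).

(** To the left of [z] the mean slope of [U] is within [e / 2] of [l]; everything else is bounded by
    [D] and is absorbed by the growing denominator. *)
Lemma primitive_over_linear (u U : R -> R) (l T : R) : 0 < T ->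
  (forall x, has_deriv U x (u x)) -> (u x @[x --> -oo] --> l) ->
  - U x / (T + `|x|) @[x --> -oo] --> l.
Proof.
move=> T0 Ud /cvgNyP ul; apply/cvgNyP => e e0.
have e2 : 0 < e / 2 by rewrite divr_gt0.
have [z zh] := ul _ e2.
pose D := `|U z| + `|l * (z - T)| + e / 2 * `|z|.
have D0 : 0 <= D by rewrite !addr_ge0 // mulr_ge0 // ltW.
exists (Num.min (Num.min z 0 - 1) (- (2 * D / e))) => x.
rewrite !le_min => /andP[xz xD].
have [xz' x0] : x <= z - 1 /\ x <= - 1.
  have := ge_min z z 0; have := ge_min 0 z 0; rewrite !lexx orbT /= => h1 h2.
  by split; lra.
have px : `|x| = - x by rewrite ler0_norm //; lra.
have pp : 0 < T + `|x| by rewrite ltr_pwDl.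
have [|t [xt tz E]] := MVT_all Ud (_ : x < z); first by lra.
have ut := zh t (ltW tz).
rewrite px in pp *.
have -> : - U x / (T - x) - l = (- U z + (u t - l) * (z - x) + l * (z - T)) / (T - x).
  by rewrite -[U z](subrK (U x)) E; field; rewrite gt_eqF.
rewrite normrM normfV (gtr0_norm pp) ler_pdivrMr //.
have h1 : `|(u t - l) * (z - x)| <= e / 2 * (z - x).
  by rewrite normrM (@ger0_norm _ (z - x)) ?ler_wpM2r //; lra.
rewrite (le_trans (ler_normD _ _)) // (le_trans (lerD (ler_normD _ _) (lexx _))) // normrN.
have xD' : 2 * D <= - x * e by rewrite -ler_pdivrMr //; lra.
have := ler_wpM2l (ltW e2) (ler_norm z).
have := mulr_gt0 e0 T0; rewrite /D in xD'; lra.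
Qed.

End LinearAverage.

(** * Asymptotics at a simple and at a double root *)

Section WaveAsymptotics.
Variable R : realType.
Variables (k delta c e M sigma K l1 : R) (S : (R -> R) -> R) (phi dphi q : R -> R).
Hypotheses (k0 : 0 < k) (delta0 : 0 < delta) (HS : exp_functional k delta S) (c0 : 0 < c).
Hypotheses (M0 : 0 < M) (sigma0 : 0 < sigma) (l10 : 0 < l1) (l1k : l1 < k).
Hypotheses (phid : forall x, has_deriv phi x (dphi x)) (phi0 : forall x, 0 < phi x)
  (phiK : forall x, phi x <= K) (phi_to0 : phi x @[x --> -oo] --> 0).
Hypothesis phi_eq : forall x,
  c * dphi x = S (fun y => phi (x + y)) - e * phi x - q x.
Hypotheses (q_ge0 : forall x, 0 <= q x) (q_neq0 : exists x, q x != 0).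
Hypothesis q_le : forall x,
  q x <= M * (phi x + S (fun y => phi (x + y))) `^ (1 + sigma).
Hypotheses (charfun_l1 : charfun c e S l1 = 0)
  (charfun_lt0 : forall l : R, 0 <= l < l1 -> charfun c e S l < 0).
Implicit Types (x y z : R).

Let k' := k - l1.
Let k'0 : 0 < k'. Proof. by rewrite subr_gt0. Qed.
Let k'0' : 0 <= k' := ltW k'0.
Let S' := tiltS S l1.
Let delta' := delta * expR l1.
Let delta'0 : 0 < delta'. Proof. by rewrite mulr_gt0 // expR_gt0. Qed.
Let HS' : exp_functional k' delta' S'.
Proof. by apply: tiltS_functional => //; exact: ltW. Qed.
Let psi := tilted phi l1.
Let dpsi := dtilted phi dphi l1.
Let r x := expR (- l1 * x) * q x.

Let psid x : has_deriv psi x (dpsi x). Proof. exact: tilted_deriv. Qed.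
Let psi0 x : 0 < psi x. Proof. exact: tilted_gt0. Qed.

Let psi_eq x : c * dpsi x = S' (fun y => psi (x + y)) - S' (fun _ => 1) * psi x - r x.
Proof.
rewrite /dpsi /S' /psi /r (tilted_eq k0 HS phid phi0 phiK phi_eq).
by rewrite charfun_l1 mul0r subr0.
Qed.

Let decay (lb : R) : 0 <= lb -> lb < l1 -> exists2 C, 0 <= C & forall x, phi x <= C * expR (lb * x).
Proof.
exact: (phi_decay k0 delta0 HS c0 M0 sigma0 l10 l1k phid phi0 phiK phi_to0 phi_eq q_le
  charfun_l1 charfun_lt0).
Qed.

Let psi_growth (eps : R) : 0 < eps -> eps <= l1 ->
  exists C, forall x, psi x <= C * expR (- eps * x).
Proof.
move=> eps0 epsl; have [||C C0 hC] := decay (_ : 0 <= l1 - eps); [by lra | by lra |].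
exists C => x; have := ler_wpM2l (expR_ge0 (- l1 * x)) (hC x).
rewrite mulrCA -expRD (_ : - l1 * x + (l1 - eps) * x = - eps * x) //; ring.
Qed.

(** The superlinear bound on [q] gains any rate below [l1 * sigma] over [exp (l1 x)]; the cap [k']
    keeps [exp (eta x)] within the growth that the tilted functional accepts. *)
Let eta := Num.min (l1 * sigma / 2) k'.
Let eta0 : 0 < eta. Proof. by rewrite lt_min k'0 divr_gt0 // mulr_gt0. Qed.
Let etak : eta <= k'. Proof. by rewrite ge_min lexx orbT. Qed.

Let r_ge0 x : 0 <= r x. Proof. by rewrite mulr_ge0 ?expR_ge0. Qed.
Let r_neq0 : exists x, r x != 0.
Proof. by have [x qx] := q_neq0; exists x; rewrite mulf_neq0 // gt_eqF // expR_gt0. Qed.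

Let r_bound : exists Cr, forall x, r x <= Cr * expR (eta * x).
Proof.
(* Solves [lb * (1 + sigma) - l1 = eta]; it lies below [l1] because [eta < l1 * sigma]. *)
pose lb := (l1 + eta) / (1 + sigma).
have s1 : 0 < 1 + sigma by rewrite addr_gt0.
have lb0 : 0 <= lb by rewrite divr_ge0 ?addr_ge0 // ltW.
have lbl : lb < l1.
  rewrite ltr_pdivrMr // mulrDr mulr1 ltrD2l.
  apply: (@le_lt_trans _ _ (l1 * sigma / 2)); first by rewrite ge_min lexx.
  by rewrite ltr_pdivrMr // ltr_pMr ?mulr_gt0 // ltr1n.
have [C C0 hC] := decay lb0 lbl.
have ge : exp_growth k (fun x => expR (lb * x)).
  by apply: exp_growth_expR; rewrite ger0_norm // ltW // (lt_trans lbl).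
pose N := S (fun x => expR (lb * x)).
have N0 : 0 <= N by apply: (functional_ge0 delta0 HS) => // x; exact: expR_ge0.
have SphiC x : S (fun y => phi (x + y)) <= C * N * expR (lb * x).
  have -> : C * N * expR (lb * x) = S (fun y => (C * expR (lb * x)) * expR (lb * y)).
    by rewrite (functionalZ k0 HS) // -/N; ring.
  apply: (functional_le delta0 HS) => //.
  - apply: exp_growth_shift; first exact: ltW.
    split; first by move=> y; exact: has_deriv_continuous (phid y).
    exists K => y; rewrite ger0_norm ?(ltW (phi0 _)) // (le_trans (phiK y)) //.
    by rewrite ler_peMr ?expabs_ge1 // ?ltW // (lt_le_trans (phi0 0)).
  - by apply: exp_growthZ => //; exact: ltW.
  - by move=> y; rewrite (le_trans (hC _)) // mulrDr expRD mulrA.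
pose D := C + C * N.
have D0 : 0 <= D by rewrite addr_ge0 // mulr_ge0.
exists (M * D `^ (1 + sigma)) => x.
have v0 : 0 <= phi x + S (fun y => phi (x + y)).
  rewrite addr_ge0 ?(ltW (phi0 _)) //.
  exact: (Sphi_ge0 k0 delta0 HS phid phi0 phiK).
have vD : phi x + S (fun y => phi (x + y)) <= D * expR (lb * x).
  by rewrite mulrDl lerD // ?hC ?SphiC.
have qD : q x <= M * (D `^ (1 + sigma) * expR (lb * x * (1 + sigma))).
  rewrite (le_trans (q_le x)) // ler_wpM2l ?(ltW M0) //.
  rewrite expRM -powRM ?expR_ge0 //.
  by rewrite ge0_ler_powR ?nnegrE ?(ltW s1) // (le_trans v0).
have := ler_wpM2l (expR_ge0 (- l1 * x)) qD.
rewrite (_ : expR (- l1 * x) * (M * _) = M * D `^ (1 + sigma) *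
   (expR (- l1 * x) * expR (lb * x * (1 + sigma)))); last by ring.
rewrite -expRD (_ : - l1 * x + lb * x * (1 + sigma) = eta * x) //.
by rewrite /lb; field; rewrite gt_eqF.
Qed.

Let log_der (A : R) (psi_lim : dpsi x / psi x @[x --> -oo] --> 0) :
  dphi x / phi x @[x --> -oo] --> l1.
Proof.
rewrite (_ : (fun x => dphi x / phi x) = (fun x => dpsi x / psi x + l1)).
  by rewrite -[X in _ --> X]add0r; apply: cvgD; [exact: psi_lim | exact: cvg_cst].
apply/funext => x; rewrite /dpsi /psi /dtilted /tilted; field.
by rewrite !gt_eqF // expR_gt0.
Qed.

Let m1 := S (fun x => x * expR (l1 * x)).
Let m1E : S' (fun x => x) = m1.
Proof. by congr S; apply/funext => x; rewrite mulrC. Qed.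

Let cpsi : continuous psi. Proof. by move=> x; exact: has_deriv_continuous (psid x). Qed.
Let gpsi : exp_growth k' psi.
Proof.
apply: exp_growthS (psi_exp_growth k'0 psid psi0 l10 psi_growth).
by rewrite ler_pdivrMr // ler_peMr // ler1n.
Qed.

Lemma wave_asymptotics_simple : m1 < c ->
  (exists2 A : R, 0 < A & phi x / expR (l1 * x) @[x --> -oo] --> A) /\
  (dphi x / phi x @[x --> -oo] --> l1).
Proof.
move=> m1c; have [Cr r_le] := r_bound.
have [Th Thd] := continuous_primitive cpsi.
have cTh : continuous Th by move=> x; exact: has_deriv_continuous (Thd x).
have [Th2 Th2d] := continuous_primitive cTh.
have [l l0 El] := energy_limit k'0 HS' psid psi0 psi_eq eta0 r_ge0 r_le r_neq0 l10 psi_growth Thd.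
have mu0 : 0 < c - m1 by rewrite subr_gt0.
have key xi P A : key_seq k' psi xi P A ->
    energy c S' psi Th (xi n) / P n @[n --> \oo] --> A * (c - m1).
  rewrite -m1E; exact: (key_seq_energy k'0 delta'0 HS' c0 psid psi0 psi_eq eta0 etak r_ge0 r_le l10 psi_growth Thd Th2d).
have F_lim : energy c S' psi Th x / 1 @[x --> -oo] --> l.
  by under eq_fun do rewrite divr1.
have p1 (x : R) : 1 <= (fun _ : R => 1 : R) x by [].
have t0 (x : R) : 0 <= (fun _ : R => 0 : R) x by [].
have tk (x : R) : (fun _ : R => 0 : R) x <= k' / 16 by rewrite divr_ge0 // ltW.
have tto0 : (fun _ : R => 0 : R) x @[x --> -oo] --> 0 by exact: cvg_cst.
have slow (x y : R) : `|(fun _ : R => 1 : R) (x + y) - (fun _ : R => 1 : R) x| <=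
    (fun _ : R => 0 : R) x * (fun _ : R => 1 : R) x * `|y|.
  by rewrite subrr normr0 !mul0r.
split.
  exists (l / (c - m1)); first by rewrite divr_gt0.
  have := weighted_limit k'0 l10 mu0 psi0 psi_growth p1 t0 tk tto0 slow F_lim key.
  rewrite (_ : (fun x => psi x / 1) = (fun x => phi x / expR (l1 * x))) //.
  by apply/funext => x; rewrite /psi /tilted divr1 mulNr expRN mulrC.
apply: (log_der 0).
exact: (log_derivative_limit k'0 l10 mu0 l0 psi0 psi_growth p1 t0 tk tto0 slow F_lim key
  HS' c0 eta0 r_ge0 r_le cpsi gpsi psi_eq).
Qed.

(** The factor [c - m1] of the first integral is 0, so [- energy2], which grows like [l |x|] at -oo,
    takes its place; its own factor [mu] is positive thanks to the atom at 1. *)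
Lemma wave_asymptotics_double : m1 = c ->
  (exists2 A : R, 0 < A & phi x / (- x * expR (l1 * x)) @[x --> -oo] --> A) /\
  (dphi x / phi x @[x --> -oo] --> l1).
Proof.
move=> m1c; have [Cr r_le] := r_bound.
have [Th Thd] := continuous_primitive cpsi.
have cTh : continuous Th by move=> x; exact: has_deriv_continuous (Thd x).
have [Th2 Th2d] := continuous_primitive cTh.
have [l l0 El] := energy_limit k'0 HS' psid psi0 psi_eq eta0 r_ge0 r_le r_neq0 l10 psi_growth Thd.
have gx2 : exp_growth k' (fun x : R => x ^+ 2).
  have h : exp_growth (k' / 2) (fun x : R => x) by apply: exp_growth_id; rewrite divr_gt0.
  by rewrite [k']splitr; exact: (exp_growthM h h).
pose mu := S' (fun x => x ^+ 2) / 2.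
have mu0 : 0 < mu.
  rewrite divr_gt0 //; have := ef_ge HS' gx2 (fun x => sqr_ge0 x).
  by rewrite expr1n mulr1; exact: lt_le_trans.
have key xi P A : key_seq k' psi xi P A ->
    - energy2 S' Th Th2 (xi n) / P n @[n --> \oo] --> A * mu.
  exact: (key_seq_energy2 k'0 delta'0 HS' c0 psid psi0 psi_eq eta0 etak r_ge0 r_le l10 psi_growth Thd Th2d).
(* Large enough for [th = 1 / p] to stay below [k' / 16]. *)
pose T := 1 + 16 / k'.
have T1 : 1 <= T by rewrite lerDl divr_ge0.
have T0 : 0 < T by exact: lt_le_trans T1.
pose p (x : R) := T + `|x|.
have p1 x : 1 <= p x by rewrite (le_trans T1) // lerDl.
have p0 x : 0 < p x by exact: lt_le_trans (p1 x).
pose th (x : R) := (p x)^-1.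
have F_lim : - energy2 S' Th Th2 x / p x @[x --> -oo] --> l.
  apply: primitive_over_linear El => // x.
  by apply: (energy2_deriv k'0 HS' psid psi0 l10 psi_growth Thd Th2d); rewrite m1E.
have t0 x : 0 <= th x by rewrite invr_ge0 ltW.
have tk x : th x <= k' / 16.
  rewrite -[leRHS]invrK invf_div lef_pV2 ?posrE ?divr_gt0 //.
  by rewrite /p /T addrAC lerDr addr_ge0.
have tto0 : th x @[x --> -oo] --> 0.
  apply/cvgNyP => e0 e00; exists (- e0^-1) => x xe.
  rewrite subr0 ger0_norm // -[leRHS]invrK lef_pV2 ?posrE ?invr_gt0 //.
  have := ler_norm (- x); rewrite normrN /p; have := T0; lra.
have slow x y : `|p (x + y) - p x| <= th x * p x * `|y|.
  rewrite /th mulVf ?gt_eqF // mul1r /p (_ : _ - _ = `|x + y| - `|x|); last by ring.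
  by rewrite (le_trans (ler_dist_dist _ _)) // addrAC subrr add0r.
split.
  exists (l / mu); first by rewrite divr_gt0.
  have := weighted_limit k'0 l10 mu0 psi0 psi_growth p1 t0 tk tto0 slow F_lim key.
  set A := l / mu => L.
  have px : p x / (- x) @[x --> -oo] --> (1 : R).
    apply/cvgNyP => e0 e00; exists (Num.min (- 1) (- (T / e0))) => x.
    rewrite le_min => /andP[x1 xe].
    rewrite /p (@ler0_norm _ x); last by lra.
    rewrite (_ : (T - x) / - x - 1 = T / - x); last by field; lra.
    rewrite ger0_norm; last by rewrite divr_ge0 ?(ltW T0) //; lra.
    rewrite ler_pdivrMr; last by lra.
    by rewrite mulrC -ler_pdivrMr //; lra.
  have LL : psi x / p x * (p x / - x) @[x --> -oo] --> A * 1 by exact: cvgM L px.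
  rewrite mulr1 in LL; apply: cvg_trans LL; apply: near_eq_cvg.
  exists 0; split; first exact: num_real.
  move=> x x0 /=; rewrite /psi /tilted mulNr expRN; field.
  by rewrite (lt_eqF x0) (gt_eqF (p0 x)) ?(gt_eqF (expR_gt0 _)).
apply: (log_der 0).
exact: (log_derivative_limit k'0 l10 mu0 l0 psi0 psi_growth p1 t0 tk tto0 slow F_lim key
  HS' c0 eta0 r_ge0 r_le cpsi gpsi psi_eq).
Qed.

End WaveAsymptotics.

(** * The functional of the wave equation *)

Section Kernel.
Variable R : realType.
Local Notation mu := (@lebesgue_measure R).
Variable h : R -> R.
Hypotheses (h_ge0 : forall x, 0 <= h x) (h_even : forall x, h (- x) = h x)
  (h_int : mu.-integrable setT (fun x => (h x)%:E)).
Implicit Types (k l x y ct : R) (u v : R -> R).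

Let mh : measurable_fun setT h.
Proof. by apply/measurable_EFinP; exact: measurable_int h_int. Qed.

Definition exp_moment k : Prop :=
  mu.-integrable setT (fun y => (h y * expabs k y)%:E).

(** The substitution [y -> - y] and the evenness of [h] reduce the negative half-line to the
    positive one. *)
Lemma exp_moment_half_line l : 0 <= l ->
  (\int[mu]_(x in [set x : R | (0 <= x)%R]) (h x * expR (l * x))%:E < +oo)%E ->
  exp_moment l.
Proof.
move=> l0 hl; set F := fun y => (h y * expabs l y)%:E.
have mF : measurable_fun setT F.
  apply/measurable_EFinP; apply: measurable_funM => //.
  by apply: continuous_measurable_fun; exact: continuous_expabs.
have F0 x : (0 <= F x)%E by rewrite lee_fin mulr_ge0 // expabs_ge0.
have Fpos : (\int[mu]_(r in `[0%R, +oo[) F r < +oo)%E.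
  apply: le_lt_trans hl; rewrite set_itvcy le_eqVlt; apply/orP; left; apply/eqP.
  by apply: eq_integral => x; rewrite inE /= => x0; rewrite /F /expabs ger0_norm.
have Fneg : (\int[mu]_(r in `]-oo, 0%R]) F r < +oo)%E.
  apply: le_lt_trans Fpos; rewrite ge0_integration_by_substitution0 //.
  rewrite le_eqVlt; apply/orP; left; apply/eqP.
  by apply: eq_integral => x _; rewrite /F h_even /expabs normrN.
apply/integrableP; split => //.
have -> : (\int[mu]_x `|(h x * expabs l x)%:E| = \int[mu]_x F x)%E.
  by apply: eq_integral => x _; rewrite gee0_abs //; exact: F0.
have -> : [set: R] = `]-oo, 0%R] `|` `]0%R, +oo[.
  by apply/seteqP; split => // x _ /=; rewrite !in_itv /= andbT; case: (leP x 0); [left|right].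
rewrite ge0_integral_setU //=.
- apply: lte_add_pinfty => //; apply: le_lt_trans Fpos.
  apply: ge0_subset_integral => //.
    exact: measurable_funTS.
  by apply: subset_itvr; rewrite bnd_simp.
- exact: measurable_funTS.
- apply/disj_setPS => x [/=]; rewrite !in_itv /= andbT => x0 /lt_le_trans /(_ x0).
  by rewrite ltxx.
Qed.

Lemma kernel_growth_bound k ct u C x : 0 <= k -> 0 <= C ->
  (forall x, `|u x| <= C * expabs k x) ->
  `|h x * u (- x - ct)| <= C * expabs k ct * (h x * expabs k x).
Proof.
move=> k0 C0 uC; rewrite normrM ger0_norm // [leRHS]mulrCA ler_wpM2l //.
rewrite (le_trans (uC _)) // -mulrA ler_wpM2l //.
rewrite (le_trans (expabsD _ _ k0)) // mulrC /expabs !normrN //.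
Qed.

Lemma continuous_reflect u ct : continuous u -> continuous (fun y => u (- y - ct)).
Proof.
move=> cu x; apply: (@continuous_comp _ _ _ (fun y => - y - ct) u); last exact: cu.
by apply: cvgB; [apply: cvgN; exact: cvg_id | exact: cvg_cst].
Qed.

Let measurable_kernel u ct : continuous u ->
  measurable_fun setT (fun y => h y * u (- y - ct)).
Proof.
move=> cu; apply: measurable_funM => //.
by apply: continuous_measurable_fun; exact: continuous_reflect.
Qed.

Lemma kernel_integrable k ct u : 0 <= k -> exp_moment k -> exp_growth k u ->
  mu.-integrable setT (EFin \o (fun y => h y * u (- y - ct))).
Proof.
move=> k0 hk gu; have [C C0 uC] := exp_growthW gu.
apply: (@le_integrable _ _ _ mu setT measurableT _
  (fun y => (C * expabs k ct * (h y * expabs k y))%:E)).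
- by apply/measurable_EFinP; apply: measurable_kernel; case: gu.
- move=> y _; rewrite /= lee_fin [leRHS]ger0_norm.
    exact: kernel_growth_bound.
  by rewrite !mulr_ge0 ?expabs_ge0.
- by under eq_fun do rewrite EFinM; exact: integrableZl.
Qed.

(* When [b = 0] the integral may be a junk value on functions of exponential growth; the
   factor [b] then removes it, and no exponential moment of [h] is needed. *)
Definition kernel_functional (d b ct : R) (u : R -> R) : R :=
  d * (u 1 + u (- 1)) + b * \int[mu]_y (h y * u (- y - ct)).

Lemma kernel_exp_functional k d b ct : 0 < k -> 0 < d -> 0 <= b ->
  b = 0 \/ exp_moment k -> exp_functional k d (kernel_functional d b ct).
Proof.
move=> k0 d0 b0 bh; have k0' := ltW k0.
split.
- move=> a u v gu gv; rewrite /kernel_functional.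
  case: bh => [->|hk]; first by ring.
  have iu := kernel_integrable ct k0' hk gu; have iv := kernel_integrable ct k0' hk gv.
  have -> : \int[mu]_y (h y * (a * u (- y - ct) + v (- y - ct))) =
     a * \int[mu]_y (h y * u (- y - ct)) + \int[mu]_y (h y * v (- y - ct)).
    rewrite -RintegralZl // -RintegralD //; last first.
      by rewrite (_ : EFin \o _ = (fun y => a%:E * (h y * u (- y - ct))%:E)%E) //; exact: integrableZl.
    by apply: eq_Rintegral => y _; ring.
  ring.
- move=> u gu u0; rewrite /kernel_functional -[leLHS]addr0 lerD //.
    by rewrite ler_wpM2l ?(ltW d0) // lerDl.
  by rewrite mulr_ge0 // Rintegral_ge0 // => y _; rewrite mulr_ge0.
- move=> u_ u C cu_ uC gu uu.
  rewrite /kernel_functional; apply: cvgD.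
    by apply: cvgM; [exact: cvg_cst | apply: cvgD; exact: uu].
  case: bh => [->|hk].
    by rewrite mul0r; under eq_fun do rewrite mul0r; exact: cvg_cst.
  apply: cvgM; first exact: cvg_cst.
  have C0 : 0 <= C by have := uC 0%N 0; rewrite expabs0 mulr1; exact: le_trans.
  have iu := kernel_integrable ct k0' hk gu.
  apply: fine_cvg; rewrite fineK; last exact: integrable_fin_num.
  have [//| | | | |_ _ H] := @dominated_convergence _ _ _ mu setT measurableT
    (fun n y => (h y * u_ n (- y - ct))%:E) (fun y => (h y * u (- y - ct))%:E)
    (fun y => (C * expabs k ct * (h y * expabs k y))%:E).
  + by move=> n; apply/measurable_EFinP; exact: measurable_kernel.
  + by apply/measurable_EFinP; apply: measurable_kernel; case: gu.
  + apply: aeW => y _; apply/cvg_EFin; first exact: nearW.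
    by apply: cvgM; [exact: cvg_cst | exact: uu].
  + by under eq_fun do rewrite EFinM; exact: integrableZl.
  + by apply: aeW => y n _; rewrite /= lee_fin; exact: kernel_growth_bound.
  + exact: H.
Qed.

End Kernel.

(** * Monotonicity of [f] in its nonlocal argument *)

Section MonotoneSecondArgument.
Variable R : realType.
Implicit Types (K u v w t e : R) (f : R -> R -> R).

Lemma pderiv2_at_approx K f u v dd : pderiv2_at K f u v dd -> forall e, 0 < e ->
  exists2 del, 0 < del & forall t, t != 0 -> `|t| < del -> 0 <= v + t <= K ->
    `|(f u (v + t) - f u v) / t - dd| <= e.
Proof.
move=> /cvgrPdist_le h e e0.
have := h e e0; rewrite near_withinE /= => -[del del0 H].
exists del => // t t0 tdel vt; rewrite distrC; apply: H => //.
by rewrite /= /ball /= sub0r normrN.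
Qed.

Lemma pderiv2_at_continuous K f u v dd : pderiv2_at K f u v dd -> forall e, 0 < e ->
  exists2 del, 0 < del & forall t, `|t| < del -> 0 <= v + t <= K -> `|f u (v + t) - f u v| <= e.
Proof.
move=> h e e0; have [del del0 H] := pderiv2_at_approx h (@ltr01 R).
have d1 : 0 < `|dd| + 1 by rewrite ltr_wpDl.
exists (Num.min del (e / (`|dd| + 1))); first by rewrite lt_min del0 divr_gt0.
move=> t; rewrite lt_min => /andP[t1 t2] vt.
have [->|t0] := eqVneq t 0; first by rewrite addr0 subrr normr0 ltW.
have := H t t0 t1 vt => Ht.
have E : f u (v + t) - f u v = ((f u (v + t) - f u v) / t - dd + dd) * t.
  by rewrite subrK divfK.
rewrite E normrM; move: t2; rewrite ltr_pdivlMr // => /ltW; apply: le_trans.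
rewrite mulrC ler_wpM2l // (le_trans (ler_normD _ _)) // addrC lerD2l //.
Qed.

(** Inside [(0, K)] the restricted difference quotient is the ordinary one; at the two ends the
    one-sided quotient still gives continuity, which is all that is asked there. *)
Lemma pderiv2_ge0_monotone K f d2f : 0 < K ->
  (forall u v, sqK K (u, v) -> pderiv2_at K f u v (d2f u v)) ->
  (forall u v, sqK K (u, v) -> 0 <= d2f u v) ->
  forall u v w, 0 <= u <= K -> 0 <= v -> v <= w -> w <= K -> f u v <= f u w.
Proof.
move=> K0 fd d0 u v w uK v0 vw wK.
have inK t : 0 <= t <= K -> sqK K (u, t) by move=> tK; split.
have der t : t \in `]0, K[ -> has_deriv (f u) t (d2f u t).
  rewrite in_itv /= => /andP[t0 tK].
  have tKK : 0 <= t <= K by rewrite !ltW.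
  have h := fd u t (inK _ tKK).
  suff lim : (fun h => h^-1 *: ((f u \o shift t) (h *: (1:R)) - f u t)) @ (0:R)^' --> d2f u t.
    have dg : derivable (f u) t 1 by apply/cvg_ex; exists (d2f u t).
    by apply: DeriveDef => //; exact: cvg_lim lim.
  apply/cvgrPdist_le => e e0; have [del del0 H] := pderiv2_at_approx h e0.
  pose del' := Num.min del (Num.min t (K - t)).
  have del'0 : 0 < del' by rewrite !lt_min del0 t0 subr_gt0.
  exists del' => // y; rewrite /= /ball /= sub0r normrN !lt_min => /andP[y1 /andP[y2 y3]] yn0.
  rewrite distrC /GRing.scale /= mulr1 (addrC y) mulrC; apply: H => //.
  by move: y2 y3; rewrite !ltr_norml => /andP[? ?] /andP[? ?]; lra.
have dle (t : R) : t \in `]0, K[ -> 0 <= derive1 (f u) t.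
  move=> tK; have [_ dE] := der t tK; rewrite derive1E dE; apply/d0/inK.
  by move: tK; rewrite in_itv /= => /andP[? ?]; rewrite !ltW.
apply: (@ger0_derive1_ndecr R (f u) 0 K) => //.
- by move=> t /der [].
- apply/continuous_within_itvP => //; split.
  + by move=> t /der ht; exact: has_deriv_continuous ht.
  + apply/cvgrPdist_le => e e0.
    have [|del del0 H] := pderiv2_at_continuous (fd u 0 (inK _ _)) e0.
      by rewrite lexx ltW.
    near=> y; rewrite distrC -[y]add0r; apply: H.
      rewrite ger0_norm; last by near: y; exact: nbhs_right_ge.
      by near: y; exact: nbhs_right_lt.
    rewrite add0r; apply/andP; split; first by near: y; exact: nbhs_right_ge.
    by near: y; exact: nbhs_right_le.
  + apply/cvgrPdist_le => e e0.
    have [|del del0 H] := pderiv2_at_continuous (fd u K (inK _ _)) e0.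
      by rewrite lexx ltW.
    near=> y; rewrite distrC.
    have yK : y <= K by near: y; exact: nbhs_left_le.
    have y0 : 0 <= y by near: y; exact: nbhs_left_ge.
    have yd : K - del < y by near: y; apply: nbhs_left_gt; rewrite gtrBl.
    have := H (y - K); rewrite subrKC; apply; last by rewrite y0.
    by rewrite ler0_norm ?subr_le0 //; lra.
Unshelve. all: by end_near. Qed.

End MonotoneSecondArgument.

Lemma clamp_lipschitz (R : realType) (m l l' : R) :
  `|Num.max 0 (Num.min l m) - Num.max 0 (Num.min l' m)| <= `|l - l'|.
Proof.
wlog ll' : l l' / l' <= l.
  by move=> W; have [/W //|/ltW/W] := leP l' l; rewrite distrC (distrC l').
have min_le : Num.min l m <= Num.min l' m + (l - l').
  have [l'm|ml'] := leP l' m; first by rewrite addrC subrK ge_min lexx.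
  by rewrite ge_min; apply/orP; right; lra.
have mono : Num.max 0 (Num.min l' m) <= Num.max 0 (Num.min l m).
  by rewrite ge_max !le_max lexx /= le_min !ge_min ll' lexx !orbT.
have up : Num.max 0 (Num.min l m) <= Num.max 0 (Num.min l' m) + (l - l').
  rewrite ge_max; apply/andP; split.
    by rewrite addr_ge0 ?subr_ge0 // le_max lexx.
  by rewrite (le_trans min_le) // lerD2r le_max lexx orbT.
by rewrite !ger0_norm ?subr_ge0 // lerBlDr addrC.
Qed.

(** [D] is controlled on [[0, m]] only. Composed with the clamp onto [[0, m]] it becomes continuous
    on the line with the same end values, and the intermediate value theorem applies. *)
Lemma lipschitz_zero (R : realType) (m L : R) (D : R -> R) : 0 < m -> 0 <= L ->
  (forall l l', 0 <= l <= m -> 0 <= l' <= m -> `|D l - D l'| <= L * `|l - l'|) ->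
  D 0 < 0 -> 0 < D m -> exists2 l : R, 0 < l < m & D l = 0.
Proof.
move=> m0 L0 hL D0 Dm.
pose clip l := Num.max 0 (Num.min l m).
have clipP l : 0 <= clip l <= m.
  by rewrite /clip le_max lexx /= ge_max (ltW m0) ge_min lexx orbT.
pose g l := D (clip l).
have cg : continuous g.
  move=> x; apply/cvgrPdist_le => e e0.
  have L1 : 0 < L + 1 by rewrite ltr_wpDl.
  exists (e / (L + 1)); first by rewrite /= divr_gt0.
  move=> y; rewrite /= /ball /= => xy.
  rewrite (le_trans (hL _ _ (clipP _) (clipP _))) //.
  apply: (@le_trans _ _ ((L + 1) * `|x - y|)); last by rewrite mulrC -ler_pdivlMr // ltW.
  by apply: ler_pM => //; [rewrite lerDl | exact: clamp_lipschitz].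
have g0 : g 0 = D 0 by rewrite /g /clip min_l ?(ltW m0) // maxxx.
have gm : g m = D m by rewrite /g /clip minxx max_r // ltW.
have [||l] := @IVT R g 0 m 0 (ltW m0).
- exact: continuous_subspaceT.
- by rewrite g0 gm ge_min le_max (ltW D0) (ltW Dm) orbT.
rewrite in_itv /= => /andP[l0 lm] gl.
have cl : clip l = l by rewrite /clip min_l // max_r.
move: gl; rewrite /g cl => Dl; exists l => //.
rewrite !lt_neqAle l0 lm !andbT; apply/andP; split; apply/eqP => E.
  by rewrite -E in Dl; move: D0; rewrite Dl ltxx.
by move: Dm; rewrite -E Dl ltxx.
Qed.

(** * Roots of the characteristic function *)

Section CharacteristicFunction.
Variable R : realType.
Local Notation mu := (@lebesgue_measure R).
Variables (d tau a b : R) (h : R -> R).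
Hypotheses (d0 : 0 < d) (tau0 : 0 <= tau) (b0 : 0 <= b).
Hypotheses (h_ge0 : forall x, 0 <= h x) (h_int : mu.-integrable setT (fun x => (h x)%:E)).
Implicit Types (c k l m e t x : R).

Let SS c := kernel_functional h d b (c * tau).
Let D c l := charfun c (2 * d - a) (SS c) l.

(** The two sides differ in where [exp (- l c tau)] stands. If [b = 0], both integrals are
    multiplied by 0, whatever default value they take. *)
Lemma charfun_Delta c k l : 0 < k -> b = 0 \/ exp_moment h k -> `|l| <= k ->
  D c l = Delta d tau a b h c l.
Proof.
move=> k0 hk lk; rewrite /D /charfun /SS /kernel_functional /Delta mulrN1 mulr1.
suff -> : b * \int[mu]_y (h y * expR (l * (- y - c * tau))) = b * expR (- l * c * tau) * G h l by ring.
case: hk => [->|hk]; first by rewrite !mul0r.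
rewrite -mulrA; congr (_ * _).
have gl : exp_growth k (fun x => expR (l * x)) by exact: exp_growth_expR.
have il := kernel_integrable h_ge0 h_int 0 (ltW k0) hk gl.
have GE : G h l = \int[mu]_y (h y * expR (l * (- y - 0))).
  by rewrite /G /Gext /Rintegral; congr fine; apply: eq_integral => y _; rewrite subr0 mulrN mulNr.
rewrite GE -RintegralZl //; apply: eq_Rintegral => y _.
rewrite mulrCA -expRD; congr (_ * expR _); ring.
Qed.

Lemma Gext_lty k l : 0 < k -> exp_moment h k -> `|l| <= k -> (Gext h l < +oo)%E.
Proof.
move=> k0 hk lk.
have gl : exp_growth k (fun x => expR (l * x)) by exact: exp_growth_expR.
have il := kernel_integrable h_ge0 h_int 0 (ltW k0) hk gl.
apply: le_lt_trans (integrable_lty measurableT il).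
rewrite le_eqVlt; apply/orP; left; apply/eqP.
by apply: eq_integral => y _; rewrite /= subr0 mulrN mulNr.
Qed.

(** Turns the zero at [lamstar] for the critical speed into a positive value for larger speeds. *)
Lemma Delta_increasing c c' l : c < c' -> 0 < l ->
  Delta d tau a b h c l < Delta d tau a b h c' l.
Proof.
move=> cc' l0; rewrite /Delta.
have G0 : 0 <= G h l.
  by apply: fine_ge0; apply: integral_ge0 => y _; rewrite lee_fin mulr_ge0 // expR_ge0.
have e1 : expR (- l * c' * tau) <= expR (- l * c * tau).
  rewrite ler_expR ler_wpM2r // ler_wnM2l ?oppr_le0 ?ltW //.
have := ler_wpM2r G0 (ler_wpM2l b0 e1).
have : c * l < c' * l by rewrite ltr_pM2r.
lra.
Qed.

Variable k : R.
Hypotheses (k0 : 0 < k) (hk : b = 0 \/ exp_moment h k).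
Let HS c : exp_functional k d (SS c). Proof. exact: kernel_exp_functional. Qed.

Let tangent c l l' : 0 <= l -> l < k -> 0 <= l' -> l' < k ->
  D c l <= D c l' + (l - l') * (c - SS c (fun x => x * expR (l' * x))).
Proof. by move=> l0 lk l'0 l'k; exact: (charfun_tangent c _ d0 (HS c) lk). Qed.

(** Tangents at both points bound the difference from both sides, and their slopes are at most [|c|]
    plus a first absolute moment. *)
Let D_lipschitz c m : 0 <= m -> m < k -> exists2 L, 0 <= L & forall l l',
  0 <= l <= m -> 0 <= l' <= m -> `|D c l - D c l'| <= L * `|l - l'|.
Proof.
move=> m0 mk; pose T l := SS c (fun x => x * expR (l * x)).
have gE : exp_growth k (fun x : R => `|x| * expabs m x).
  have -> : k = (k - m) + m by ring.
  by apply: exp_growthM; [apply: exp_growth_norm; rewrite subr_gt0 | exact: exp_growth_expabs].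
pose N := SS c (fun x => `|x| * expabs m x).
have N0 : 0 <= N.
  by apply: (functional_ge0 d0 (HS c)) => // x; rewrite mulr_ge0 // expabs_ge0.
have TN l : 0 <= l <= m -> `|T l| <= N.
  move=> /andP[l0 lm]; apply: (functional_norm_le k0 d0 (HS c)) => //.
    have -> : k = (k - m) + m by ring.
    apply: exp_growthM; first by apply: exp_growth_id; rewrite subr_gt0.
    by apply: exp_growth_expR; rewrite ger0_norm.
  move=> x; rewrite normrM (ger0_norm (expR_ge0 _)) ler_wpM2l //.
  by rewrite expR_le_expabs // ger0_norm.
have one l l' : 0 <= l <= m -> 0 <= l' <= m -> D c l - D c l' <= (`|c| + N) * `|l - l'|.
  move=> lm l'm; have := TN _ l'm.
  move: (lm) (l'm) => /andP[l0 l1] /andP[l'0 l'1] TN'.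
  have := tangent c l0 (le_lt_trans l1 mk) l'0 (le_lt_trans l'1 mk).
  rewrite -/(T l') => H.
  have : (l - l') * (c - T l') <= `|l - l'| * (`|c| + N).
    rewrite (le_trans (ler_norm _)) // normrM ler_wpM2l //.
    by rewrite (le_trans (ler_normB _ _)) // lerD2l.
  by move=> H'; rewrite lerBlDl (le_trans H) // lerD2l [leRHS]mulrC.
exists (`|c| + N); first by rewrite addr_ge0.
move=> l l' lm l'm; rewrite ler_norml one // andbT lerNl opprB (distrC l).
exact: one.
Qed.

Lemma charfun_zero c m : 0 < m -> m < k -> D c 0 < 0 -> 0 < D c m ->
  exists2 l, 0 < l < m & D c l = 0.
Proof.
move=> m0 mk D0 Dm.
have [L L0 hL] := D_lipschitz c (ltW m0) mk.
exact: lipschitz_zero m0 L0 hL D0 Dm.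
Qed.

(** The tangent at [l] must lie above the positive value at [m], so its slope [c - S (x exp (l x))]
    is positive; to the left of [l] it is negative and bounds [D] from above. *)
Lemma charfun_simple_zero c l m : 0 < l -> l < m -> m < k -> D c l = 0 -> 0 < D c m ->
  SS c (fun x => x * expR (l * x)) < c /\ (forall l', 0 <= l' < l -> D c l' < 0).
Proof.
move=> l0 lm mk Dl Dm.
have lk : l < k by exact: lt_trans mk.
have m0 : 0 <= m by exact: ltW (lt_trans l0 lm).
have := tangent c m0 mk (ltW l0) lk; rewrite Dl add0r => H.
have Tc : 0 < c - SS c (fun x => x * expR (l * x)).
  by rewrite -(pmulr_rgt0 _ (_ : 0 < m - l)) ?subr_gt0 //; exact: lt_le_trans H.
split; first by rewrite -subr_gt0.
move=> l' /andP[l'0 l'l].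
have := tangent c l'0 (lt_trans l'l lk) (ltW l0) lk; rewrite Dl add0r => H'.
by rewrite (le_lt_trans H') // nmulr_rlt0 // subr_lt0.
Qed.

(** The bound [D (l + t) <= t (c - T)] holds for both signs of [t], and a zero derivative at [l] is
    compatible with it only if [T = c]. The tangent is then horizontal, and strict negativity on the
    left comes from strict convexity of [exp] tested at the atom 1. *)
Lemma charfun_double_zero c l : 0 < l -> l < k -> D c l = 0 ->
  is_derive l (1 : R) (Delta d tau a b h c) 0 ->
  SS c (fun x => x * expR (l * x)) = c /\ (forall l', 0 <= l' < l -> D c l' < 0).
Proof.
move=> l0 lk Dl [Dd Dv].
set T := SS c (fun x => x * expR (l * x)).
have quot t : t != 0 -> 0 <= l + t < k -> D c (l + t) <= t * (c - T).
  move=> t0 /andP[lt1 lt2].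
  have := tangent c lt1 lt2 (ltW l0) lk.
  by rewrite Dl add0r -/T (_ : l + t - l = t) //; ring.
have DE t : 0 <= l + t < k -> D c (l + t) = Delta d tau a b h c (l + t).
  by move=> /andP[t1 t2]; apply: charfun_Delta hk _ => //; rewrite ger0_norm // ltW.
have lim : (fun t => t^-1 *: ((Delta d tau a b h c \o shift l) (t *: (1:R)) - Delta d tau a b h c l)) @ (0:R)^' --> 'D_1 (Delta d tau a b h c) l.
  exact: Dd.
rewrite Dv in lim.
have Dl0 : Delta d tau a b h c l = 0.
  by rewrite -[l]addr0 -DE ?addr0 ?Dl // ltW.
have small e : 0 < e -> exists2 del, 0 < del & forall t, t != 0 -> `|t| < del ->
    `|Delta d tau a b h c (l + t) / t| <= e.
  move=> e0; have /cvgrPdist_le/(_ e e0)[del del0 H] := lim.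
  exists del => // t t0 tdel; have := H t; rewrite /= /ball /= !sub0r !normrN => /(_ tdel t0).
  by rewrite Dl0 subr0 /GRing.scale /= mulr1 (addrC t) mulrC.
have Tc : T = c.
  apply: contrapT => /eqP Tnc.
  pose e := `|c - T| / 2.
  have cT : 0 < `|c - T| by rewrite normr_gt0 subr_eq0 eq_sym.
  have e0 : 0 < e by rewrite divr_gt0.
  have [del del0 H] := small e e0.
  pose t0 := Num.min (del / 2) (Num.min l ((k - l) / 2)).
  have t00 : 0 < t0 by rewrite !lt_min l0 !divr_gt0 // subr_gt0.
  have t0d : t0 < del.
    have : t0 <= del / 2 by rewrite ge_min lexx.
    by lra.
  have t0l : t0 <= l by rewrite !ge_min lexx orbT.
  have t0k : t0 <= (k - l) / 2 by rewrite !ge_min lexx !orbT.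
  have [cT0|cT0] := ltP 0 (c - T).
    have tn : - t0 != 0 by rewrite oppr_eq0 gt_eqF.
    have lt' : 0 <= l - t0 < k by lra.
    have h1 := quot _ tn lt'; rewrite DE // in h1.
    have h2 := H _ tn; rewrite normrN (ger0_norm (ltW t00)) in h2.
    have {}h2 := h2 t0d.
    have h3 : c - T <= Delta d tau a b h c (l - t0) / - t0.
      by rewrite ler_ndivlMr ?oppr_lt0 // mulrC.
    have := le_trans h3 (le_trans (ler_norm _) h2).
    by rewrite /e gtr0_norm // leNgt ltr_pdivrMr // ltr_pMr // ltr1n.
  have tn : t0 != 0 by rewrite gt_eqF.
  have lt' : 0 <= l + t0 < k by lra.
  have h1 := quot _ tn lt'; rewrite DE // in h1.
  have h2 := H _ tn; rewrite (ger0_norm (ltW t00)) in h2.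
  have {}h2 := h2 t0d.
  have h3 : Delta d tau a b h c (l + t0) / t0 <= c - T.
    by rewrite ler_pdivrMr // mulrC.
  move: h2 cT h3; rewrite ler_norml /e (@ler0_norm _ (c - T)) // => /andP[h4 _].
  by move: (_ / t0) (c - T) h4 => x y h4; lra.
split=> // l' /andP[l'0 l'l].
have tn : l' - l != 0 by rewrite subr_eq0 lt_eqF.
have ge : exp_growth k (fun x => expR (l * x)).
  by apply: exp_growth_expR; rewrite ger0_norm // ltW.
have ge' : exp_growth k (fun x => expR (l' * x)).
  by apply: exp_growth_expR; rewrite ger0_norm // ltW // (lt_trans l'l).
have gx : exp_growth k (fun x => x * expR (l * x)).
  have -> : k = (k - l) + l by ring.
  apply: exp_growthM; first by apply: exp_growth_id; rewrite subr_gt0.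
  by apply: exp_growth_expR; rewrite ger0_norm // ltW.
have gt : exp_growth k (fun x => (l' - l) * (x * expR (l * x)) + expR (l * x)).
  exact: exp_growth_lin.
pose w x := expR (l' * x) - ((l' - l) * (x * expR (l * x)) + expR (l * x)).
have wE x : w x = expR (l * x) * (expR ((l' - l) * x) - (1 + (l' - l) * x)).
  rewrite mulrBr -expRD -mulrDl subrKC /w; ring.
have w0 x : 0 <= w x by rewrite wE mulr_ge0 ?expR_ge0 // subr_ge0 expR_ge1Dx.
have w1 : 0 < w 1.
  by rewrite wE mulr_gt0 ?expR_gt0 // subr_gt0 expR_gt1Dx // mulr1.
have Sw : 0 < SS c w.
  apply: lt_le_trans (ef_ge (HS c) _ w0); first by rewrite mulr_gt0.
  exact: exp_growthB.
have SwE : SS c w = SS c (fun x => expR (l' * x)) - ((l' - l) * T + SS c (fun x => expR (l * x))).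
  by rewrite /w (functionalB (HS c)) // (ef_lin (HS c)).
move: Dl Sw; rewrite SwE Tc /D /charfun.
by move: (SS c (fun x => expR (l' * x))) (SS c (fun x => expR (l * x))) => X Y; lra.
Qed.

End CharacteristicFunction.

(** * Reduction of the wave to the abstract equation *)

Section TravellingWave.
Variable R : realType.
Local Notation mu := (@lebesgue_measure R).
Variables (d tau K M sigma c k : R) (f d1f d2f : R -> R -> R) (h phi : R -> R).
Hypotheses (d0 : 0 < d) (K0 : 0 < K) (M0 : 0 < M) (sigma0 : 0 < sigma) (k0 : 0 < k).
Hypotheses (fd2 : forall u v, sqK K (u, v) -> pderiv2_at K f u v (d2f u v))
  (f00 : f 0 0 = 0) (f_diag : forall u, 0 < u < K -> 0 < f u u)
  (d2f_ge0 : forall u v, sqK K (u, v) -> 0 <= d2f u v)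
  (f_lin : forall u v, sqK K (u, v) ->
     0 <= d1f 0 0 * u + d2f 0 0 * v - f u v <= M * (u + v) `^ (1 + sigma)).
Hypotheses (h_ge0 : forall x, 0 <= h x) (h_int : mu.-integrable setT (fun x => (h x)%:E))
  (h1 : (\int[mu]_(x in setT) (h x)%:E = 1)%E)
  (hk : d2f 0 0 = 0 \/ exp_moment h k).
Hypothesis tw : tw_solution d tau K f h c phi.
Implicit Types (x y u v : R).

Let a := d1f 0 0.
Let b := d2f 0 0.
Let S := kernel_functional h d b (c * tau).
Let c0 : 0 < c. Proof. by case: tw. Qed.
Let b0 : 0 <= b. Proof. by apply: d2f_ge0; split; rewrite /= lexx ltW. Qed.
Let HS : exp_functional k d S. Proof. exact: kernel_exp_functional. Qed.
Let phi_bd x : 0 <= phi x <= K. Proof. by case: tw => _ [_ [_ [_ [_ +]]]]; apply. Qed.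
Let phi_ge0 x : 0 <= phi x. Proof. by case/andP: (phi_bd x). Qed.
Let phi_to0 : phi x @[x --> -oo] --> 0. Proof. by case: tw => _ [_ [_ []]]. Qed.
Let phi_toK : phi x @[x --> +oo] --> K. Proof. by case: tw => _ [_ [_ [_ []]]]. Qed.

Lemma tw_le x : phi x <= K. Proof. by case/andP: (phi_bd x). Qed.

Lemma tw_deriv x : has_deriv phi x (derive1 phi x).
Proof. by case: tw => _ [phid _]; rewrite derive1E; split => //; exact: phid. Qed.

Let cphi : continuous phi. Proof. by move=> x; exact: has_deriv_continuous (tw_deriv x). Qed.

Let gphi l x : 0 <= l -> exp_growth l (fun y => phi (x + y)).
Proof.
move=> l0; apply: exp_growth_shift => //; split => //; exists K => y.
by rewrite ger0_norm // (le_trans (tw_le y)) // ler_peMr ?expabs_ge1 // ltW.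
Qed.

Lemma exp_moment0 : exp_moment h 0.
Proof.
rewrite /exp_moment (_ : (fun y => _) = (fun x => (h x)%:E)) //.
by apply/funext => y; rewrite /expabs mul0r expR0 mulr1.
Qed.

Let convE z : Defs.conv h phi z = \int[mu]_y (h y * (fun x => phi (z + x)) (- y - 0)).
Proof. by apply: eq_Rintegral => y _; rewrite subr0. Qed.

Lemma conv_bounds z : 0 <= Defs.conv h phi z <= K.
Proof.
apply/andP; split.
  by apply: Rintegral_ge0 => y _; rewrite mulr_ge0.
have i1 := kernel_integrable h_ge0 h_int 0 (lexx 0) exp_moment0 (gphi z (lexx 0)).
have hh : mu.-integrable setT (EFin \o h) by exact: h_int.
apply: (@le_trans _ _ (\int[mu]_y (K * h y))).
  rewrite convE; apply: le_Rintegral => //.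
    rewrite (_ : EFin \o _ = (fun y => K%:E * (h y)%:E)%E) //; exact: integrableZl.
  by move=> y _; rewrite mulrC ler_wpM2r // tw_le.
by rewrite RintegralZl // /Rintegral h1 mulr1.
Qed.

Lemma Sphi_conv x :
  S (fun y => phi (x + y)) = d * (phi (x + 1) + phi (x - 1)) + b * Defs.conv h phi (x - c * tau).
Proof.
rewrite /S /kernel_functional; congr (_ + _ * _).
by apply: eq_Rintegral => y _; congr (_ * phi _); ring.
Qed.

Definition defect_term x : R := a * phi x + b * Defs.conv h phi (x - c * tau)
  - f (phi x) (Defs.conv h phi (x - c * tau)).

Lemma tw_eq x :
  c * derive1 phi x = S (fun y => phi (x + y)) - (2 * d - a) * phi x - defect_term x.
Proof.
case: tw => _ [_ [/(_ x) E _]]; rewrite Sphi_conv /defect_term; lra.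
Qed.

Let in_sq x z : sqK K (phi x, Defs.conv h phi z). Proof. by split; [exact: phi_bd | exact: conv_bounds]. Qed.

Lemma defect_term_ge0 x : 0 <= defect_term x.
Proof. by have /andP[] := f_lin (in_sq x (x - c * tau)). Qed.

Let mono u v w : 0 <= u <= K -> 0 <= v -> v <= w -> w <= K -> f u v <= f u w.
Proof. exact: (pderiv2_ge0_monotone K0 fd2 d2f_ge0). Qed.

(** A zero of [phi] is a minimum, and there the equation leaves a vanishing sum of nonnegative
    terms, since [f 0 v >= f 0 0 = 0]. So the zero propagates from [y] to [y + 1], against the limit
    [K] at +oo. *)
Lemma tw_gt0 x : 0 < phi x.
Proof.
rewrite lt_neqAle phi_ge0 andbT eq_sym; apply/negP => /eqP px.
have step y : phi y = 0 -> phi (y + 1) = 0.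
  move=> py.
  have d1 : derive1 phi y = 0.
    have [||||_ E] := @derive1_at_min R phi (y - 1) (y + 1) y _ _ _ _.
    - by lra.
    - by move=> t _; case: (tw_deriv t).
    - by rewrite in_itv /=; lra.
    - by move=> t _; rewrite py.
    by rewrite derive1E E.
  case: tw => _ [_ [/(_ y) E _]]; move: E; rewrite py d1 !mulr0 subr0 addrC => E.
  have /andP[v0 vK] := conv_bounds (y - c * tau).
  have f0 : 0 <= f 0 (Defs.conv h phi (y - c * tau)).
    by have := @mono 0 0 _ _ (lexx _) v0 vK; rewrite f00; apply; rewrite lexx ltW.
  have := phi_ge0 (y - 1); have p1 := phi_ge0 (y + 1) => p2.
  have : d * (phi (y + 1) + phi (y - 1)) <= 0 by lra.
  rewrite pmulr_rle0 //; lra.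
have all n : phi (x + n%:R) = 0.
  by elim: n => [|n IH]; [rewrite addr0 | rewrite -natr1 addrA step].
have := phi_toK => /cvg_pinftyP/(_ (fun n => x + n%:R)) H.
have /H L : x + n%:R @[n --> \oo] --> +oo.
  apply/cvgryPge => A; have /cvgryPge/(_ (A - x)) := @cvgr_idn R.
  by apply: filterS => n; lra.
have L0 : phi (x + n%:R) @[n --> \oo] --> (0 : R).
  by under eq_fun do rewrite all; exact: cvg_cst.
have := cvg_unique _ L L0 => /(_ (@norm_hausdorff _ _)) E.
by move: K0; rewrite E ltxx.
Qed.

(** (F2) bounds the defect through the convolution, the abstract equation through [S], which
    dominates [b] times the convolution; for [b > 0] this costs the factor [1 + b^-1]. For [b = 0]
    the functional does not see the convolution: monotonicity replaces it by 0 inside [f], and the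
    factor is 1 by the convention [0^-1 = 0]. *)
Lemma defect_term_le x : defect_term x <=
  M * (1 + b^-1) `^ (1 + sigma) * (phi x + S (fun y => phi (x + y))) `^ (1 + sigma).
Proof.
have s1 : 0 <= 1 + sigma by rewrite addr_ge0 // ltW.
have S0 : 0 <= S (fun y => phi (x + y)).
  by apply: (functional_ge0 d0 HS) => //; apply: gphi; exact: ltW.
set z := x - c * tau; have /andP[v0 vK] := conv_bounds z.
have bi : 0 <= b^-1 by rewrite invr_ge0.
have p0 := phi_ge0 x.
suff [w [w0 wle wS]] : exists w, [/\ 0 <= w, defect_term x <= M * w `^ (1 + sigma) &
    w <= (1 + b^-1) * (phi x + S (fun y => phi (x + y)))].
  have bi1 : 0 <= 1 + b^-1 by rewrite addr_ge0.
  have V0 : 0 <= phi x + S (fun y => phi (x + y)) by apply: addr_ge0.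
  apply: le_trans wle _; rewrite -mulrA; apply: ler_wpM2l; first exact: ltW.
  rewrite -(powRM _ bi1 V0); apply: ge0_ler_powR => //.
  exact: le_trans wS.
have [bE|bn] := eqVneq b 0.
  exists (phi x); split => //; last by rewrite bE invr0 addr0 mul1r lerDl.
  have sq0 : sqK K (phi x, 0) by split; [exact: phi_bd | rewrite /= lexx ltW].
  have /andP[_] := f_lin sq0; have := mono (phi_bd x) (lexx 0) v0 vK.
  rewrite /defect_term -/z -/a -/b bE mul0r !addr0; lra.
have bp : 0 < b by rewrite lt_neqAle eq_sym bn.
exists (phi x + Defs.conv h phi z); split; first by rewrite addr_ge0.
  by have /andP[] := f_lin (in_sq x z).
rewrite mulrDl mul1r mulrDr.
have : Defs.conv h phi z <= b^-1 * S (fun y => phi (x + y)).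
  rewrite Sphi_conv -/z mulrDr mulKf // lerDr mulr_ge0 // mulr_ge0 ?(ltW d0) // addr_ge0 //.
have : 0 <= b^-1 * phi x by rewrite mulr_ge0.
lra.
Qed.

(** (F2) at a diagonal point where [f] is positive. It says that the characteristic function is
    negative at 0. *)
Lemma ab_gt0 : 0 < a + b.
Proof.
have K2 : 0 < K / 2 by rewrite divr_gt0.
have hK : 0 < K / 2 < K by rewrite K2 ltr_pdivrMr // ltr_pMr // ltr1n.
have sqh : sqK K (K / 2, K / 2) by case/andP: hK => h2 h3; split; rewrite /= !ltW.
have /andP[+ _] := f_lin sqh; rewrite -mulrDl -/a -/b => H.
have fp := f_diag hK.
rewrite -(pmulr_lgt0 _ K2); lra.
Qed.

Lemma kernel_functional1 : S (fun _ => 1) = 2 * d + b.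
Proof.
rewrite /S /kernel_functional (_ : \int[mu]_y (h y * 1) = 1); first by ring.
have -> : \int[mu]_y (h y * 1) = \int[mu]_y (h y).
  by apply: eq_Rintegral => y _; rewrite mulr1.
by rewrite /Rintegral h1.
Qed.

(** If the wave solved the linear equation, [c phi'] would tend to [K (a + b) > 0] at +oo, against
    boundedness of [phi]. *)
Lemma defect_term_neq0 : exists x, defect_term x != 0.
Proof.
apply: contrapT => nex.
have q0 x : defect_term x = 0.
  by apply: contrapT => /eqP qx; apply: nex; exists x.
pose L := K * (a + b).
have L0 : 0 < L by rewrite mulr_gt0 // ab_gt0.
have lim : c * derive1 phi x @[x --> +oo] --> L.
  apply/cvg_pinftyP => t tN.
  under eq_fun do rewrite tw_eq q0 subr0.
  have -> : L = S (fun _ => K) - (2 * d - a) * K.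
    by rewrite (functional_cst k0 HS) kernel_functional1 /L; ring.
  apply: cvgB; last by apply: cvgM; [exact: cvg_cst | move/cvg_pinftyP: phi_toK; apply].
  apply: (ef_dct HS (C := K)).
  - by move=> n; case: (gphi (t n) (ltW k0)).
  - move=> n x; rewrite ger0_norm // (le_trans (tw_le _)) //.
    by rewrite ler_peMr ?expabs_ge1 // ltW.
  - by apply: exp_growth_cst; exact: ltW.
  - move=> x; have /cvg_pinftyP H := phi_toK; apply: (H (fun n => t n + x)).
    apply/cvgryPge => A; move/cvgryPge: tN => /(_ (A - x)).
    by apply: filterS => n; lra.
have [X XP] : exists X, forall x, X <= x -> L / 2 <= c * derive1 phi x.
  have /cvgrPdist_le/(_ (L / 2)) := lim; rewrite divr_gt0 // => /(_ isT)[X [_ XH]].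
  exists (X + 1) => x xX; have := XH x; rewrite ler_norml /=.
  by move=> /(_ ltac:(lra)) /andP[_]; lra.
(* Long enough for a slope of at least [L / (2 c)] to raise [phi] by [K + 1]. *)
pose Y := X + 2 * c * (K + 1) / L.
have XY : X < Y by rewrite ltrDl divr_gt0 // !mulr_gt0 // addr_gt0.
have [t [Xt tY E]] := MVT_all tw_deriv XY.
have := XP t (ltW Xt) => Ht.
have E2 : c * (phi Y - phi X) = c * derive1 phi t * (Y - X) by rewrite E; ring.
have : L / 2 * (Y - X) <= c * (phi Y - phi X).
  by rewrite E2 ler_wpM2r // subr_ge0 ltW.
have -> : L / 2 * (Y - X) = c * (K + 1) by rewrite /Y; field; rewrite gt_eqF.
rewrite ler_pM2l //; have := tw_le Y; have := phi_ge0 X; lra.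
Qed.

End TravellingWave.

(** The strict inequality below [lambda_plus] provides the margin [k > l] on which all growth
    estimates draw. *)
Lemma lambda_plus_moment (R : realType) (b l : R) (h : R -> R) :
  (forall x, 0 <= h x) -> (forall x, h (- x) = h x) ->
  (@lebesgue_measure R).-integrable setT (fun x => (h x)%:E) ->
  0 <= b -> 0 < l -> (l%:E < lambda_plus b h)%E ->
  exists2 k : R, l < k & b = 0 \/ exp_moment h k.
Proof.
move=> h0 he hi b0 l0; rewrite /lambda_plus; have [bp|bn _] := ltP 0 b; last first.
  by exists (l + 1); [rewrite ltrDl | left; apply/eqP; rewrite eq_le bn b0].
move=> /ereal_sup_gt[_ [k /= hk <-]]; rewrite lte_fin => lk.
exists k => //; right; apply: exp_moment_half_line => //.
exact: ltW (lt_trans l0 lk).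
Qed.

Unset Implicit Arguments.

Theorem theorem4p2 (R : realType) (d tau K : R) (f : R -> R -> R)
    (d1f d2f : R -> R -> R) (h : R -> R) (M sigma cstar lamstar : R) :
  0 < d -> 0 <= tau -> 0 < K ->
  (* partial derivatives of f exist on [0,K]^2 and are d1f, d2f *)
  (forall u v, sqK K (u, v) ->
     pderiv1_at K f u v (d1f u v) /\ pderiv2_at K f u v (d2f u v)) ->
  (* (F1) *)
  {within sqK K, continuous (fun p : R * R => f p.1 p.2)} ->
  f 0 0 = 0 -> f K K = 0 ->
  (forall u, 0 < u < K -> 0 < f u u) ->
  (forall u v, sqK K (u, v) -> 0 <= d2f u v) ->
  (* (F2) *)
  0 < M -> 0 < sigma <= 1 ->
  (forall u v, sqK K (u, v) ->
     0 <= d1f 0 0 * u + d2f 0 0 * v - f u v <= M * (u + v) `^ (1 + sigma)) ->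
  d1f K K + d2f K K < 0 ->
  (* (H1) *)
  (forall x, 0 <= h x) -> (forall x, h (- x) = h x) ->
  (@lebesgue_measure R).-integrable setT (fun x => (h x)%:E) ->
  (\int[@lebesgue_measure R]_(x in setT) (h x)%:E = 1)%E ->
  (* (H2) *)
  (exists lam0 : \bar R, (0 < lam0)%E /\
     forall l : R, (l%:E < lam0)%E ->
       (\int[@lebesgue_measure R]_(x in [set x : R | (0 <= x)%R])
           (h x * expR (l * x))%:E < +oo)%E) ->
  (* (cstar, lamstar) is the unique pair with cstar > 0, lamstar in (0, lambda^+),
     Delta(cstar,lamstar) = 0 = d_lambda Delta(cstar,lamstar) *)
  0 < cstar -> 0 < lamstar ->
  (lamstar%:E < lambda_plus (d2f 0 0)%R h)%E ->
  Delta d tau (d1f 0 0) (d2f 0 0) h cstar lamstar = 0 ->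
  is_derive lamstar 1 (Delta d tau (d1f 0 0) (d2f 0 0) h cstar) 0 ->
  (forall c l, 0 < c -> 0 < l -> (l%:E < lambda_plus (d2f 0 0)%R h)%E ->
     Delta d tau (d1f 0 0) (d2f 0 0) h c l = 0 ->
     is_derive l 1 (Delta d tau (d1f 0 0) (d2f 0 0) h c) 0 ->
     c = cstar /\ l = lamstar) ->
  forall (c : R) (phi : R -> R) (lam1 : R),
    tw_solution d tau K f h c phi ->
    cstar <= c ->
    (* lam1 = lambda_1(c) *)
    (cstar < c -> smallest_pos_zero d tau (d1f 0 0) (d2f 0 0) h c lam1) ->
    (c = cstar -> lam1 = lamstar) ->
    (exists eta : R,
      (cstar < c ->
         (phi (x + eta) / expR (lam1 * x)) @[x --> -oo] --> (1:R)) /\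
      (c = cstar ->
         (phi (x + eta) / (- x * expR (lam1 * x))) @[x --> -oo]
           --> (1:R))) /\
    (derive1 phi x / phi x) @[x --> -oo] --> lam1.
Proof.
move=> d0 tau0 K0 fd cf f00 fKK f_diag d2f_ge0 M0 /andP[sigma0 sigma1] f_lin dK h_ge0 h_even
  h_int h1 hmom cs0 ls0 ls_lt Dls Dls' Duniq c phi lam1 tw csc lam1_zero lam1_eq.
set a := d1f 0 0 in Dls Dls' lam1_zero *; set b := d2f 0 0 in ls_lt Dls Dls' lam1_zero *.
have fd2 u v (uv : sqK K (u, v)) := (fd u v uv).2.
have b0 : 0 <= b by apply: d2f_ge0; split; rewrite /= lexx ltW.
have c0 : 0 < c by case: tw.
have [k lsk hk] := lambda_plus_moment h_ge0 h_even h_int b0 ls0 ls_lt.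
have k0 : 0 < k by exact: lt_trans lsk.
pose S := kernel_functional h d b (c * tau).
have HS : exp_functional k d S by exact: kernel_exp_functional.
have phi0 := tw_gt0 d0 K0 fd2 f00 d2f_ge0 h_ge0 h_int h1 tw.
have phid := tw_deriv tw.
have phi_to0 : phi x @[x --> -oo] --> (0 : R) by case: tw => _ [_ [_ []]].
pose D := charfun c (2 * d - a) S.
have DE l : 0 <= l -> l <= k -> D l = Delta d tau a b h c l.
  by move=> l0 lk; apply: (@charfun_Delta R d tau a b h h_ge0 h_int c k l k0 hk); rewrite ger0_norm.
have lam1P : [/\ 0 < lam1, lam1 < k, D lam1 = 0,
    forall l : R, 0 <= l < lam1 -> D l < 0 &
    (cstar < c -> S (fun x => x * expR (lam1 * x)) < c) /\
    (c = cstar -> S (fun x => x * expR (lam1 * x)) = c)].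
  move: csc; rewrite le_eqVlt => /predU1P[csE|csc].
    have lE := lam1_eq (esym csE).
    have Dl : D lamstar = 0 by rewrite DE ?(ltW ls0) ?(ltW lsk) // -csE.
    have [|m1 neg] := charfun_double_zero d0 b0 h_ge0 h_int k0 hk ls0 lsk Dl.
      by rewrite -csE.
    rewrite lE; split => //; split=> // ; by rewrite csE ltxx.
  have [l0 [[fin Dl]] lmin] := lam1_zero csc.
  have Dls_gt0 : 0 < D lamstar.
    by rewrite DE ?(ltW ls0) ?(ltW lsk) // -Dls; exact: Delta_increasing.
  have D0 : D 0 < 0.
    rewrite /D /charfun mulr0 add0r (_ : (fun x => _) = (fun _ => 1)); last first.
      by apply/funext => x; rewrite mul0r expR0.
    rewrite /S kernel_functional1 //; have := ab_gt0 K0 f_diag f_lin; rewrite -/a -/b; lra.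
  (* The sign change between 0 and [lamstar] places [lam1] strictly to the left of [lamstar]: it is
     below [k], and the positive value at [lamstar] makes it a simple root. *)
  have [l /andP[lp lls] Dl0] := charfun_zero d0 b0 h_ge0 h_int k0 hk ls0 lsk D0 Dls_gt0.
  have lk : l < k by exact: lt_trans lsk.
  have lam1l : lam1 <= l.
    apply: lmin => //; split; last by rewrite -DE ?(ltW lp) ?(ltW lk).
    case: hk => [->|hk]; [by left | right].
    by apply: (Gext_lty h_ge0 h_int k0 hk); rewrite ger0_norm ltW.
  have lam1ls : lam1 < lamstar by exact: le_lt_trans lls.
  have lam1k : lam1 < k by exact: lt_trans lsk.
  have Dl1 : D lam1 = 0 by rewrite DE ?(ltW l0) ?(ltW lam1k).
  have [m1 neg] := charfun_simple_zero d0 b0 h_ge0 h_int k0 hk l0 lam1ls lsk Dl1 Dls_gt0.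
  by split => //; split=> // csE; move: csc; rewrite csE ltxx.
have [l0 lk Dl neg [simple double]] := lam1P.
have M'0 : 0 < M * (1 + b^-1) `^ (1 + sigma).
  by rewrite mulr_gt0 // powR_gt0 // ltr_pwDl // invr_ge0.
have q_ge0 := defect_term_ge0 K0 f_lin h_ge0 h_int h1 tw.
have q_neq0 := defect_term_neq0 d0 K0 k0 f_diag d2f_ge0 f_lin h_ge0 h_int h1 hk tw.
have q_le := defect_term_le d0 K0 M0 sigma0 k0 fd2 d2f_ge0 f_lin h_ge0 h_int h1 hk tw.
have phi_eq := @tw_eq R d tau K c f d1f d2f h phi tw.
have phi_le := tw_le tw.
(* A translation by [eta] multiplies the leading coefficient by [exp (lam1 * eta)], which normalises
   [A] to 1. *)
have shift (A : R) : 0 < A -> exists eta : R, A * expR (lam1 * eta) = 1.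
  move=> A0; exists (- ln A / lam1); rewrite mulrCA divff ?gt_eqF // mulr1.
  by rewrite expRN lnK ?posrE // divff ?gt_eqF.
have to_Ny (eta : R) : x + eta @[x --> -oo] --> -oo by exact: cvg_addrr_Ny.
move: csc; rewrite le_eqVlt => /predU1P[csE|csc].
  have [[A A0 lim] ld] := wave_asymptotics_double k0 d0 HS c0 M'0 sigma0 l0 lk phid phi0
    phi_le phi_to0 phi_eq q_ge0 q_neq0 q_le Dl neg (double (esym csE)).
  split=> //; have [eta etaE] := shift A A0; exists eta; split; first by rewrite csE ltxx.
  move=> _.
  have lim1 : phi (x + eta) / (- (x + eta) * expR (lam1 * (x + eta))) @[x --> -oo] --> A.
    exact: cvg_comp (to_Ny eta) lim.
  (* The translation also turns the prefactor [- x] into [- (x + eta)], which does not affect the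
     limit. *)
  have lim2 : (x + eta) / x @[x --> -oo] --> (1 : R).
    apply/cvgNyP => e e0; exists (Num.min (-1) (- (`|eta| / e))) => x.
    rewrite le_min => /andP[x1 xe].
    rewrite (_ : (x + eta) / x - 1 = eta / x); last by field; lra.
    rewrite normrM normfV (@ltr0_norm _ x); last by lra.
    by rewrite ler_pdivrMr; [rewrite mulrC -ler_pdivrMr //; lra | lra].
  rewrite -etaE.
  have lim3 : phi (x + eta) / (- (x + eta) * expR (lam1 * (x + eta))) * ((x + eta) / x) * expR (lam1 * eta)
     @[x --> -oo] --> A * 1 * expR (lam1 * eta).
    by apply: cvgM; [exact: cvgM lim1 lim2 | exact: cvg_cst].
  rewrite mulr1 in lim3; apply: cvg_trans lim3; apply: near_eq_cvg.
  exists (Num.min (- eta) 0); split; first exact: num_real.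
  move=> x /=; rewrite lt_min => /andP[x1 x2].
  have xn : x != 0 by rewrite lt_eqF.
  have xen : x + eta != 0 by rewrite lt_eqF //; lra.
  rewrite mulrDr expRD; field.
  by rewrite xn xen !(gt_eqF (expR_gt0 _)).
have [[A A0 lim] ld] := wave_asymptotics_simple k0 d0 HS c0 M'0 sigma0 l0 lk phid phi0
  phi_le phi_to0 phi_eq q_ge0 q_neq0 q_le Dl neg (simple csc).
split=> //; have [eta etaE] := shift A A0; exists eta; split; last first.
  by move=> csE; move: csc; rewrite csE ltxx.
move=> _; rewrite -etaE.
have lim1 : phi (x + eta) / expR (lam1 * (x + eta)) @[x --> -oo] --> A.
  exact: cvg_comp (to_Ny eta) lim.
have lim3 : phi (x + eta) / expR (lam1 * (x + eta)) * expR (lam1 * eta)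
   @[x --> -oo] --> A * expR (lam1 * eta).
  by apply: cvgM; [exact: lim1 | exact: cvg_cst].
apply: cvg_trans lim3; apply: near_eq_cvg; apply: nearW => x.
by rewrite mulrDr expRD; field; rewrite !gt_eqF ?expR_gt0.
Qed.
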